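(* Let $\varepsilon_1,\varepsilon_2\in\{1,-1\}$ and let $p(y,t)$, $q(x,t)$ ($x,y\in\mathbb{R}$, $t\ge0$) be real, continuous and bounded functions. Consider the Cauchy problem in $L_2(\mathbb{R}^2)$ $$ \Bigl[i\frac{\partial}{\partial t}+\varepsilon_1\frac{\partial^2}{\partial x^2}+\varepsilon_2\frac{\partial^2}{\partial y^2}+p(y,t)+q(x,t)\Bigr]u(x,y;t)=0,\qquad u|_{t=0}=u_0(x,y)\in L_2(\mathbb{R}^2). $$ Let $U_1(t)$ and $U_2(t)$ be the unitary operators on $L_2(\mathbb{R})$ mapping initial data at time $0$ to the solution at time $t$ of the one-dimensional equations $$ \Bigl[i\frac{\partial}{\partial t}+\varepsilon_1\frac{\partial^2}{\partial x^2}+q(x,t)\Bigr]w(x,t)=0,\qquad \Bigl[i\frac{\partial}{\partial t}+\varepsilon_2\frac{\partial^2}{\partial y^2}+p(y,t)\Bigr]w(y,t)=0, $$ respectively. Then the solution of the Cauchy problem is $$ u(x,y;t)=U_1(t)U_2(t)u_0(x,y), $$ where $U_1(t)$ acts on the variable $x$ and $U_2(t)$ acts on the variable $y$. Moreover, if $A_0$ and $A(t)$ denote the integral operators on $L_2(\mathbb{R})$ with kernels $u_0(x,y)$ and $u(x,y;t)$, then $$ A(t)=U_1(t)\,A_0\,J\,U_2^*(t)\,J, $$ where $J a=\overline{a}$ is complex conjugation on $L_2(\mathbb{R})$; consequently $\|A(t)\|=\|A_0\|$, i.e. this operator norm does not depend on $t$.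
   Context: The integral operator with kernel $k(x,y)\in L_2(\mathbb{R}^2)$ is $(K\varphi)(x)=\int k(x,y)\varphi(y)\,dy$. Solutions of the linear Schrödinger equations are understood as continuous $L_2$-valued functions of $t\ge 0$ satisfying the corresponding integral (Duhamel) equation, e.g. for $[i\partial_t+\varepsilon\partial_x^2+w(x,t)]v=0$, $v|_{t=0}=v_0$: $v(t)=e^{i\varepsilon t\partial_x^2}v_0+i\int_0^t e^{i\varepsilon(t-s)\partial_x^2}w(\cdot,s)v(s)\,ds$, and analogously in two variables. For real, continuous, bounded $w$ the one-dimensional problem is uniquely solvable in $L_2(\mathbb{R})$ and its solution operator is unitary. *)

(* Defs.v *)
From HB Require Import structures.
From mathcomp Require Import all_boot all_order all_algebra.
From mathcomp Require Import complex.
From mathcomp Require Import all_classical all_reals all_analysis.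

Set Implicit Arguments.
Unset Strict Implicit.
Unset Printing Implicit Defensive.

Import Order.TTheory GRing.Theory Num.Theory.
Import numFieldNormedType.Exports.

Local Open Scope classical_set_scope.
Local Open Scope ring_scope.
Local Open Scope complex_scope.

(** * Complex-valued [L_2] functions

    Elements of [L_2] are represented by functions [T -> R[i]]; two functions
    represent the same element when they are equal [%[ae mu]]. *)

Definition norm2 {d : measure_display} {T : measurableType d} {R : realType}
    (mu : {measure set T -> \bar R}) (f : T -> R[i]) : \bar R :=
  Lnorm mu 2%:E (fun x => (ComplexField.Normc.normc (f x))%:E).

Definition inL2 {d : measure_display} {T : measurableType d} {R : realType}
    (mu : {measure set T -> \bar R}) (f : T -> R[i]) : Prop :=
  [/\ measurable_fun [set: T] (fun x => complex.Re (f x)),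
      measurable_fun [set: T] (fun x => complex.Im (f x)) &
      (norm2 mu f < +oo)%E].

Definition cintegral {d : measure_display} {T : measurableType d}
    {R : realType} (mu : {measure set T -> \bar R}) (D : set T)
    (f : T -> R[i]) : R[i] :=
  Rintegral mu D (fun x => complex.Re (f x))
  +i* Rintegral mu D (fun x => complex.Im (f x)).

Definition inner {d : measure_display} {T : measurableType d} {R : realType}
    (mu : {measure set T -> \bar R}) (f g : T -> R[i]) : R[i] :=
  cintegral mu [set: T] (fun x => f x * ((g x)^*)%C).

Definition cis {R : realType} (a : R) : R[i] := cos a +i* sin a.

(** * Operators on [L_2] *)

(** A linear operator of [L_2]; the second clause says that it acts on classes
    of a.e. equal functions. *)
Definition L2_linear {d : measure_display} {T : measurableType d}
    {R : realType} (mu : {measure set T -> \bar R})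
    (U : (T -> R[i]) -> (T -> R[i])) : Prop :=
  [/\ forall f, inL2 mu f -> inL2 mu (U f),
      forall f g, inL2 mu f -> inL2 mu g ->
        f = g %[ae mu] -> U f = U g %[ae mu] &
      forall (a : R[i]) f g, inL2 mu f -> inL2 mu g ->
        U (fun x => a * f x + g x) = (fun x => a * U f x + U g x) %[ae mu]].

Definition L2_unitary {d : measure_display} {T : measurableType d}
    {R : realType} (mu : {measure set T -> \bar R})
    (U : (T -> R[i]) -> (T -> R[i])) : Prop :=
  [/\ L2_linear mu U,
      forall f g, inL2 mu f -> inL2 mu g ->
        inner mu (U f) (U g) = inner mu f g &
      forall g, inL2 mu g -> exists2 f, inL2 mu f & U f = g %[ae mu]].

Definition L2_adjoint {d : measure_display} {T : measurableType d}
    {R : realType} (mu : {measure set T -> \bar R})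
    (U V : (T -> R[i]) -> (T -> R[i])) : Prop :=
  (forall g, inL2 mu g -> inL2 mu (V g)) /\
  (forall f g, inL2 mu f -> inL2 mu g ->
     inner mu (U f) g = inner mu f (V g)).

Definition opnorm {d : measure_display} {T : measurableType d} {R : realType}
    (mu : {measure set T -> \bar R}) (A : (T -> R[i]) -> (T -> R[i])) :
    \bar R :=
  ereal_sup [set norm2 mu (A f) | f in
    [set f | inL2 mu f /\ (norm2 mu f <= 1)%E]].

Definition conjop {T : Type} {R : realType} (f : T -> R[i]) : T -> R[i] :=
  fun x => (f x)^*.

(** * Mild solutions of Schroedinger equations *)

(** Tagged partitions [x_0 <= ... <= x_n], [x_k <= tau_k <= x_(k+1)] of
    [[a, b]] with mesh smaller than [delta]. *)
Definition tagged_partition {R : realType} (a b delta : R) (n : nat)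
    (x tau : nat -> R) : Prop :=
  [/\ x 0%N = a, x n = b &
      forall k, (k < n)%N ->
        [/\ x k <= tau k, tau k <= x k.+1 & x k.+1 - x k < delta]].

Definition riemann_sum {T : Type} {R : realType} (F : R -> T -> R[i])
    (n : nat) (x tau : nat -> R) : T -> R[i] :=
  fun z => \sum_(k < n) (x k.+1 - x k)%:C * F (tau k) z.

(** [S] is the integral over [[a, b]] of the [L_2]-valued function [F]: the
    limit in the norm of [L_2] of the Riemann sums as the mesh tends to [0]. *)
Definition L2_integral {d : measure_display} {T : measurableType d}
    {R : realType} (mu : {measure set T -> \bar R}) (a b : R)
    (F : R -> T -> R[i]) (S : T -> R[i]) : Prop :=
  inL2 mu S /\
  forall e : R, 0 < e -> exists2 delta : R, 0 < delta &
    forall (n : nat) (x tau : nat -> R), tagged_partition a b delta n x tau ->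
      (norm2 mu (fun z => riemann_sum F n x tau z - S z)%R < e%:E)%E.

(** [v] is a solution, continuous from [[0, +oo)] to [L_2], of
      [v(t) = E(t) v0 + i int_0^t E(t - s) w(., s) v(s) ds].
    The free propagator is given by its graph: [E t f g] means that [E(t)] maps
    the class of [f] to the class of [g]. The values of [v] at negative times
    are irrelevant. *)
Definition mild_solution {d : measure_display} {T : measurableType d}
    {R : realType} (mu : {measure set T -> \bar R})
    (E : R -> (T -> R[i]) -> (T -> R[i]) -> Prop) (w : T -> R -> R)
    (v0 : T -> R[i]) (v : R -> T -> R[i]) : Prop :=
  [/\ forall t, 0 <= t -> inL2 mu (v t),
      forall t, 0 <= t ->
        norm2 mu (fun z => v s z - v t z)
          @[s --> within [set s | 0 <= s] (nbhs t)] --> 0%E &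
      forall t, 0 <= t ->
        exists (g0 : T -> R[i]) (F : R -> T -> R[i]) (S : T -> R[i]),
        [/\ E t v0 g0,
            forall s, 0 <= s <= t ->
              E (t - s) (fun z => (w z s)%:C * v s z) (F s),
            L2_integral mu 0 t F S &
            v t = (fun z => g0 z + 'i%C * S z) %[ae mu]]].

(** * Fourier transform and free propagators *)

(** [fh] is the [L_2] Fourier transform of [f], with the normalization
    [fh(xi) = int e^{-i <x, xi>} f(x) dx], the integral being the limit in the
    norm of [L_2] of the integrals over the sets [box n]. *)
Definition is_fourier {d : measure_display} {T : measurableType d}
    {R : realType} (mu : {measure set T -> \bar R}) (dot : T -> T -> R)
    (box : nat -> set T) (f fh : T -> R[i]) : Prop :=
  [/\ inL2 mu f, inL2 mu fh &
      norm2 mu (fun xi =>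
        cintegral mu (box n) (fun x => cis (- dot x xi) * f x) - fh xi)
        @[n --> \oo] --> 0%E].

Definition leb (R : realType) : {measure set (measurableTypeR R) -> \bar R} :=
  @lebesgue_measure R.

Definition leb2 (R : realType) :
    {measure set (measurableTypeR R * measurableTypeR R)%type -> \bar R} :=
  (@lebesgue_measure R \x @lebesgue_measure R)%E.

Definition fourier1 {R : realType} (f fh : R -> R[i]) : Prop :=
  is_fourier (leb R) (fun x xi => x * xi)
    (fun n => `[- n%:R, n%:R]%classic) f fh.

Definition fourier2 {R : realType} (f fh : R * R -> R[i]) : Prop :=
  is_fourier (leb2 R) (fun z zeta => z.1 * zeta.1 + z.2 * zeta.2)
    (fun n => `[- n%:R, n%:R]%classic `*` `[- n%:R, n%:R]%classic) f fh.

(** [g = e^{i eps t d_x^2} f] *)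
Definition free1 {R : realType} (eps t : R) (f g : R -> R[i]) : Prop :=
  exists2 fh, fourier1 f fh &
    fourier1 g (fun xi => cis (- (t * (eps * xi ^+ 2))) * fh xi).

(** [g = e^{i t (eps1 d_x^2 + eps2 d_y^2)} f] *)
Definition free2 {R : realType} (eps1 eps2 t : R) (f g : R * R -> R[i]) :
    Prop :=
  exists2 fh, fourier2 f fh &
    fourier2 g (fun zeta =>
      cis (- (t * (eps1 * zeta.1 ^+ 2 + eps2 * zeta.2 ^+ 2))) * fh zeta).

(** [i d_t w + eps d_x^2 w + q(x, t) w = 0], [w(0) = w0] *)
Definition schrodinger1 {R : realType} (eps : R) (q : R -> R -> R)
    (w0 : R -> R[i]) (w : R -> R -> R[i]) : Prop :=
  mild_solution (leb R) (free1 eps) q w0 w.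

(** [i d_t u + eps1 d_x^2 u + eps2 d_y^2 u + (p(y, t) + q(x, t)) u = 0],
    [u(0) = u0] *)
Definition schrodinger2 {R : realType} (eps1 eps2 : R) (p q : R -> R -> R)
    (u0 : R * R -> R[i]) (u : R -> R * R -> R[i]) : Prop :=
  mild_solution (leb2 R) (free2 eps1 eps2) (fun z t => p z.2 t + q z.1 t) u0 u.

(** The unitary operators [U t], [t >= 0], mapping initial data at time [0] to
    the solution at time [t]. *)
Definition solution_operator {R : realType} (eps : R) (q : R -> R -> R)
    (U : R -> (R -> R[i]) -> (R -> R[i])) : Prop :=
  (forall t, 0 <= t -> L2_unitary (leb R) (U t)) /\
  (forall w0, inL2 (leb R) w0 -> schrodinger1 eps q w0 (fun t => U t w0)).

Definition continuous_bounded {R : realType} (w : R -> R -> R) : Prop :=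
  {within [set z : R * R | 0 <= z.2], continuous (fun z => w z.1 z.2)} /\
  exists M : R, forall x t, 0 <= t -> `|w x t| <= M.

(** * Operators acting on one of the two variables; integral operators *)

(** [g = U f], with [U] acting on the first, resp. second, variable. *)
Definition acts_on_x {R : realType} (U : (R -> R[i]) -> (R -> R[i]))
    (f g : R * R -> R[i]) : Prop :=
  [/\ inL2 (leb2 R) f, inL2 (leb2 R) g &
      {ae leb R, forall y,
        (fun x => g (x, y)) = U (fun x => f (x, y)) %[ae leb R]}].

Definition acts_on_y {R : realType} (U : (R -> R[i]) -> (R -> R[i]))
    (f g : R * R -> R[i]) : Prop :=
  [/\ inL2 (leb2 R) f, inL2 (leb2 R) g &
      {ae leb R, forall x,
        (fun y => g (x, y)) = U (fun y => f (x, y)) %[ae leb R]}].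

Definition integral_operator {R : realType} (k : R * R -> R[i])
    (phi : R -> R[i]) : R -> R[i] :=
  fun x => cintegral (leb R) [set: R] (fun y => k (x, y) * phi y).

(* Main.v *)
(** In Fourier variables the free propagators are multiplications by phases, and
    the phase in two variables is the product of the two one-dimensional ones.
    Writing [V] for the Fourier transform of a one-dimensional solution
    multiplied by the inverse phase, the Duhamel equation becomes
    [V(t) = V(0) + i int_0^t G] with [G] continuous in [L_2]; the product rule
    for [V_1 (x) V_2] then says that [(U_1(t) a)(x) (U_2(t) b)(y)] is a mild
    solution in two variables.  Finite sums of products are dense and
    [U_1(t) (x) U_2(t)] is isometric on them (Gram matrices), so solutions for
    arbitrary data are limits, uniform in [t], of such sums; a Gronwall argument
    gives uniqueness.  The two factorizations of [u(t)] and of [A(t)] are checked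
    on sums of products and passed to the limit, on almost every slice by an
    infimum argument and for the operators by the Hilbert-Schmidt bound.

    Plancherel's theorem is proved on the way: for indicators of intervals it
    reduces to the Dirichlet integral of [2 (1 - cos (c x)) / x^2], and it extends
    by density, by tensor products, and by exhaustion by boxes. *)
Require Import Defs.
From HB Require Import structures.
From mathcomp Require Import all_boot all_order all_algebra.
From mathcomp Require Import complex.
From mathcomp Require Import all_classical all_reals all_analysis.
From mathcomp Require Import measurable_realfun ring lra.

Import Order.TTheory GRing.Theory Num.Theory.
Import numFieldNormedType.Exports.

Local Open Scope classical_set_scope.
Local Open Scope ring_scope.
Local Open Scope complex_scope.

Set Implicit Arguments.
Unset Strict Implicit.
Unset Printing Implicit Defensive.

Local Notation re := complex.Re.
Local Notation im := complex.Im.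

(** * Complex-valued [L_2] functions *)

Section ComplexMeasurable.
Context {d : measure_display} {T : measurableType d} {R : realType}.
Implicit Types (f g : T -> R[i]) (z w : R[i]).

(** Surjectivity of the Fourier transform is never established, so it is not clear at the outset
    that a multiplied transform [m fh] is again a transform, that is, that the free propagators are
    defined everywhere. In one variable this is read off the given solution operators: a mild
    solution with datum [f] exhibits a value of the propagator at [f] for every time. In two
    variables it is inherited through tensor sums, because the propagator has a closed graph. This
    is why transforms and propagators are handled as relations with a norm identity
    ([isometric_relation]) and not as functions.

    Functions stand for classes, and equality almost everywhere is expressed by a vanishing norm of
    the difference, which triangle inequalities absorb. The Duhamel integral of a product or of a
    limit of solutions is not built as a limit: it is defined by solving the Duhamel equation for
    it, and the Riemann sums are then shown to converge to it. *)

Definition sqn z : R := re z ^+ 2 + im z ^+ 2.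

Lemma reD z w : re (z + w) = re z + re w. Proof. by case: z; case: w. Qed.
Lemma imD z w : im (z + w) = im z + im w. Proof. by case: z; case: w. Qed.
Lemma reM z w : re (z * w) = re z * re w - im z * im w.
Proof. by case: z; case: w. Qed.
Lemma imM z w : im (z * w) = re z * im w + im z * re w.
Proof. by case: z; case: w. Qed.
Lemma reN z : re (- z) = - re z. Proof. by case: z. Qed.
Lemma imN z : im (- z) = - im z. Proof. by case: z. Qed.
Lemma reJ z : re (z^*)%C = re z. Proof. by case: z. Qed.
Lemma imJ z : im (z^*)%C = - im z. Proof. by case: z. Qed.

Definition reimE := (reD, imD, reM, imM, reN, imN, reJ, imJ).

Lemma complexP z w : re z = re w -> im z = im w -> z = w.
Proof. by case: z; case: w => /= a b c e -> ->. Qed.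

Lemma sqn_ge0 z : 0 <= sqn z.
Proof. by rewrite addr_ge0// sqr_ge0. Qed.

Lemma sqn_eq0 z : sqn z = 0 -> z = 0.
Proof.
move/eqP; rewrite paddr_eq0 ?sqr_ge0// !sqrf_eq0 => /andP[/eqP a /eqP b].
exact: complexP.
Qed.

Lemma sqnM z w : sqn (z * w) = sqn z * sqn w.
Proof. rewrite /sqn !reimE; ring. Qed.

Lemma sqn_real (a : R) : sqn a%:C = a ^+ 2.
Proof. by rewrite /sqn /= expr0n addr0. Qed.

Lemma sqn_indic (A : set T) x : sqn (\1_A x : R)%:C <= 1.
Proof. by rewrite sqn_real indicE; case: (_ \in _); rewrite ?expr1n ?expr0n. Qed.

Lemma sqnJ z : sqn (z^*)%C = sqn z.
Proof. by rewrite /sqn !reimE sqrrN. Qed.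

Lemma sqn_cis (a : R) : sqn (cis a) = 1.
Proof. exact: cos2Dsin2. Qed.

Lemma normcE_sqn z : ComplexField.Normc.normc z = Num.sqrt (sqn z).
Proof. by case: z. Qed.

Lemma sqnD_le z w : sqn (z + w) <= 2 * (sqn z + sqn w).
Proof.
have := sqr_ge0 (re z - re w); have := sqr_ge0 (im z - im w).
rewrite /sqn !reimE; lra.
Qed.

Lemma cisD (a b : R) : cis (a + b) = cis a * cis b :> R[i].
Proof. by apply: complexP; rewrite !reimE /= ?cosD ?sinD// addrC mulrC. Qed.

Lemma cis0 : cis 0 = 1 :> R[i].
Proof. by rewrite /cis cos0 sin0. Qed.

Definition cmeas f := measurable_fun [set: T] (fun x => re (f x)) /\
  measurable_fun [set: T] (fun x => im (f x)).

Lemma cmeasD f g : cmeas f -> cmeas g -> cmeas (fun x => f x + g x).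
Proof.
move=> [a b] [c e]; split.
  by under eq_fun do rewrite reD; exact: measurable_funD.
by under eq_fun do rewrite imD; exact: measurable_funD.
Qed.

Lemma cmeasM f g : cmeas f -> cmeas g -> cmeas (fun x => f x * g x).
Proof.
move=> [a b] [c e]; split.
  by under eq_fun do rewrite reM; apply: measurable_funB; exact: measurable_funM.
by under eq_fun do rewrite imM; apply: measurable_funD; exact: measurable_funM.
Qed.

Lemma cmeas_cst z : cmeas (fun _ => z).
Proof. by split; exact: measurable_cst. Qed.

Lemma cmeasJ f : cmeas f -> cmeas (fun x => (f x)^*)%C.
Proof.
move=> [a b]; split.
  by under eq_fun do rewrite reJ.
by under eq_fun do rewrite imJ; exact: measurableT_comp.
Qed.

Lemma cmeas_real (f : T -> R) : measurable_fun [set: T] f -> cmeas (fun x => (f x)%:C).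
Proof. by move=> mf; split => //=; exact: measurable_cst. Qed.

Lemma cmeas_cis (f : T -> R) :
  measurable_fun [set: T] f -> cmeas (fun x => cis (f x)).
Proof.
move=> mf; split => /=; apply: measurableT_comp mf; apply: continuous_measurable_fun.
  exact: continuous_cos.
exact: continuous_sin.
Qed.

Lemma measurable_sqn f : cmeas f -> measurable_fun [set: T] (fun x => sqn (f x)).
Proof. by move=> [a b]; apply: measurable_funD; exact: measurable_funX. Qed.

Lemma cmeas_sum n (f : nat -> T -> R[i]) : (forall i, (i < n)%N -> cmeas (f i)) ->
  cmeas (fun x => \sum_(i < n) f i x).
Proof.
elim: n => [|n IH] h.
  by under eq_fun do rewrite big_ord0; exact: cmeas_cst.
under eq_fun do rewrite big_ord_recr /=.
apply: cmeasD; last exact: h.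
by apply: IH => i /ltnW /h.
Qed.

End ComplexMeasurable.

Section L2.
Context {d : measure_display} {T : measurableType d} {R : realType}.
Variable mu : {measure set T -> \bar R}.
Implicit Types (f g h : T -> R[i]).

(** The real part of [inner mu f g]. Its imaginary part is [rdot] of [f] and [i g], so
    Cauchy-Schwarz and polarization can be done with real integrals. *)
Definition rdot f g : R :=
  \int[mu]_x (re (f x) * re (g x) + im (f x) * im (g x)).

(** The real-valued form of [norm2], equal to it on L2 functions ([norm2_N]). When the integral is
    infinite its real value defaults to [0], hence the L2 hypotheses below. *)
Definition N f : R := Num.sqrt (\int[mu]_x sqn (f x)).

Lemma norm2E f : norm2 mu f = poweR (\int[mu]_x (sqn (f x))%:E)%E 2^-1.
Proof.
rewrite /norm2 unlock; congr poweR; apply: eq_integral => x _ /=.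
rewrite normcE_sqn ger0_norm ?sqrtr_ge0//.
by rewrite powR_mulrn ?sqrtr_ge0// sqr_sqrtr ?sqn_ge0.
Qed.

Lemma inL2P f : inL2 mu f <->
  cmeas f /\ mu.-integrable [set: T] (EFin \o (sqn \o f)).
Proof.
have sqge0 : (0 <= \int[mu]_x (sqn (f x))%:E)%E.
  by apply: integral_ge0 => x _; rewrite lee_fin sqn_ge0.
have E : (\int[mu]_x `|(EFin \o (sqn \o f)) x| = \int[mu]_x (sqn (f x))%:E)%E.
  by apply: eq_integral => x _ /=; rewrite ger0_norm ?sqn_ge0.
split.
- move=> [m1 m2]; rewrite norm2E => h; split => //; apply/integrableP; split.
    by apply/measurable_EFinP; exact: (@measurable_sqn _ _ _ f).
  rewrite E; move: h sqge0; case: (integral _ _ _) => [r _ _|/=|//].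
    exact: ltry.
  by rewrite invr_eq0 pnatr_eq0.
- move=> [[m1 m2] /integrableP[mf]]; rewrite E => h; split => //.
  rewrite norm2E; move: h sqge0; case: (integral _ _ _) => //= r _ _.
  by rewrite ltry.
Qed.

Lemma inL2_lty f : cmeas f -> (\int[mu]_x (sqn (f x))%:E < +oo)%E -> inL2 mu f.
Proof.
move=> mf fy; apply/inL2P; split => //; apply/integrableP; split.
  by apply/measurable_EFinP; exact: measurable_sqn.
apply: le_lt_trans fy; rewrite le_eqVlt; apply/orP; left; apply/eqP.
by apply: eq_integral => x _ /=; rewrite ger0_norm ?sqn_ge0.
Qed.

Lemma inL2_cmeas f : inL2 mu f -> cmeas f. Proof. by case. Qed.

Lemma integrable_sqn f : inL2 mu f -> mu.-integrable [set: T] (EFin \o (sqn \o f)).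
Proof. by move/inL2P => []. Qed.

Lemma inL2_dom f (g : T -> R) : cmeas f -> mu.-integrable [set: T] (EFin \o g) ->
  (forall x, sqn (f x) <= g x) -> inL2 mu f.
Proof.
move=> mf ig fg; apply/inL2P; split => //.
apply: le_integrable ig => //; first by apply/measurable_EFinP; exact: measurable_sqn.
by move=> x _ /=; rewrite lee_fin ger0_norm ?sqn_ge0// (le_trans (fg x))// ler_norm.
Qed.

Lemma N_ge0 f : 0 <= N f. Proof. exact: sqrtr_ge0. Qed.

Lemma Nsq f : N f ^+ 2 = \int[mu]_x sqn (f x).
Proof. by rewrite sqr_sqrtr// Rintegral_ge0// => x _; exact: sqn_ge0. Qed.

Lemma integral_sqn f : inL2 mu f -> (\int[mu]_x (sqn (f x))%:E)%E = (N f ^+ 2)%:E.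
Proof.
move=> /integrable_sqn i; rewrite Nsq /Rintegral fineK//.
exact: integrable_fin_num i.
Qed.

Lemma norm2_N f : inL2 mu f -> norm2 mu f = (N f)%:E.
Proof.
move=> hf; rewrite norm2E integral_sqn//= -powR_mulrn ?N_ge0// -powRrM.
by rewrite mulfV// powRr1 ?N_ge0.
Qed.

Lemma N_rdot f : N f ^+ 2 = rdot f f.
Proof. by rewrite Nsq; apply: eq_Rintegral => x _; rewrite /sqn !expr2. Qed.

Lemma inL2D f g : inL2 mu f -> inL2 mu g -> inL2 mu (fun x => f x + g x).
Proof.
move=> hf hg; have := integrableD measurableT (integrable_sqn hf) (integrable_sqn hg).
move=> /(integrableZl measurableT 2) h.
apply: (inL2_dom _ h); first exact: cmeasD (inL2_cmeas hf) (inL2_cmeas hg).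
by move=> x /=; exact: sqnD_le.
Qed.

Lemma inL2M (m : T -> R[i]) f C : cmeas m -> (forall x, sqn (m x) <= C) ->
  inL2 mu f -> inL2 mu (fun x => m x * f x).
Proof.
move=> mm mC hf.
apply: (inL2_dom (g := fun x => C * sqn (f x))).
- exact: cmeasM mm (inL2_cmeas hf).
- by have := integrableZl measurableT C (integrable_sqn hf).
- by move=> x; rewrite sqnM ler_wpM2r ?sqn_ge0.
Qed.

Lemma inL2Z a f : inL2 mu f -> inL2 mu (fun x => a * f x).
Proof. by apply: (@inL2M (fun=> a) _ (sqn a)) => //; exact: cmeas_cst. Qed.

Lemma inL2N f : inL2 mu f -> inL2 mu (fun x => - f x).
Proof. by move/(inL2Z (-1)); under eq_fun do rewrite mulN1r. Qed.

Lemma inL2B f g : inL2 mu f -> inL2 mu g -> inL2 mu (fun x => f x - g x).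
Proof. by move=> hf hg; apply: inL2D => //; exact: inL2N. Qed.

Lemma inL2J f : inL2 mu f -> inL2 mu (fun x => (f x)^*)%C.
Proof.
move=> hf; apply: (inL2_dom (g := fun x => sqn (f x))).
- exact: cmeasJ (inL2_cmeas hf).
- exact: integrable_sqn.
- by move=> x; rewrite sqnJ.
Qed.

Lemma inL20 : inL2 mu (fun _ => 0).
Proof.
apply: (inL2_dom (g := fun=> 0)); [exact: cmeas_cst|exact: integrable0|].
by move=> x; rewrite /sqn /= expr0n /= addr0.
Qed.

Lemma inL2_sum n (f : nat -> T -> R[i]) : (forall i, (i < n)%N -> inL2 mu (f i)) ->
  inL2 mu (fun x => \sum_(i < n) f i x).
Proof.
elim: n => [|n IH] h.
  by under eq_fun do rewrite big_ord0; exact: inL20.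
under eq_fun do rewrite big_ord_recr /=.
apply: inL2D; last exact: h.
by apply: IH => i /ltnW /h.
Qed.

Lemma integrable_dom (f g : T -> R) : measurable_fun [set: T] f ->
  mu.-integrable [set: T] (EFin \o g) ->
  (forall x, `|f x| <= g x) -> mu.-integrable [set: T] (EFin \o f).
Proof.
move=> mf ig fg; apply: le_integrable ig => //; first exact/measurable_EFinP.
by move=> x _ /=; rewrite lee_fin (le_trans (fg x))// ler_norm.
Qed.

Lemma integrable_rdot f g : inL2 mu f -> inL2 mu g ->
  mu.-integrable [set: T] (EFin \o (fun x => re (f x) * re (g x) + im (f x) * im (g x))).
Proof.
move=> hf hg; have := integrableD measurableT (integrable_sqn hf) (integrable_sqn hg).
move=> h; apply: (integrable_dom (g := fun x => sqn (f x) + sqn (g x))) => //.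
  have [m1 m2 _] := hf; have [m3 m4 _] := hg.
  by apply: measurable_funD; exact: measurable_funM.
move=> x; rewrite /sqn ler_norml.
move: (re (f x)) (im (f x)) (re (g x)) (im (g x)) => a b c e.
have := sqr_ge0 (a - c); have := sqr_ge0 (a + c).
have := sqr_ge0 (b - e); have := sqr_ge0 (b + e).
by move=> *; apply/andP; split; nra.
Qed.

Lemma rdotC f g : rdot f g = rdot g f.
Proof. by apply: eq_Rintegral => x _; rewrite mulrC (mulrC (im _)). Qed.

Lemma rdotDl f g h : inL2 mu f -> inL2 mu g -> inL2 mu h ->
  rdot (fun x => f x + g x) h = rdot f h + rdot g h.
Proof.
move=> hf hg hh; rewrite /rdot -RintegralD//; try exact: integrable_rdot.
by apply: eq_Rintegral => x _; rewrite !reimE; ring.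
Qed.

Lemma rdotZl (a : R) f h : inL2 mu f -> inL2 mu h ->
  rdot (fun x => a%:C * f x) h = a * rdot f h.
Proof.
move=> hf hh; rewrite /rdot -RintegralZl//; try exact: integrable_rdot.
by apply: eq_Rintegral => x _; rewrite !reimE /=; ring.
Qed.

Lemma rdotDr f g h : inL2 mu f -> inL2 mu g -> inL2 mu h ->
  rdot h (fun x => f x + g x) = rdot h f + rdot h g.
Proof. by move=> *; rewrite rdotC rdotDl// !(rdotC h). Qed.

Lemma rdotZr (a : R) f h : inL2 mu f -> inL2 mu h ->
  rdot h (fun x => a%:C * f x) = a * rdot h f.
Proof. by move=> *; rewrite rdotC rdotZl// (rdotC h). Qed.

Lemma N_sqD f g : inL2 mu f -> inL2 mu g ->
  N (fun x => f x + g x) ^+ 2 = N f ^+ 2 + 2 * rdot f g + N g ^+ 2.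
Proof.
move=> hf hg; have hfg := inL2D hf hg.
by rewrite !N_rdot rdotDl// !rdotDr// (rdotC g f); ring.
Qed.

Lemma NM_unit (m : T -> R[i]) f : (forall x, sqn (m x) = 1) ->
  N (fun x => m x * f x) = N f.
Proof.
by move=> m1; congr Num.sqrt; apply: eq_Rintegral => x _; rewrite sqnM m1 mul1r.
Qed.

Lemma eqN f g : (forall x, f x = g x) -> N f = N g.
Proof. by move=> fg; congr N; exact/funext. Qed.

Lemma NZ (a : R[i]) f : inL2 mu f -> N (fun x => a * f x) = Num.sqrt (sqn a) * N f.
Proof.
move=> hf; rewrite /N -sqrtrM ?sqn_ge0// -RintegralZl//; last exact: integrable_sqn.
by congr Num.sqrt; apply: eq_Rintegral => x _; rewrite sqnM.
Qed.

Lemma NZr (a : R) f : inL2 mu f -> N (fun x => a%:C * f x) = `|a| * N f.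
Proof.
move=> hf; rewrite NZ//; congr (_ * _).
by rewrite /sqn /= expr0n /= addr0 sqrtr_sqr.
Qed.

Lemma NN f : N (fun x => - f x) = N f.
Proof. by congr Num.sqrt; apply: eq_Rintegral => x _; rewrite /sqn !reimE !sqrrN. Qed.

Lemma NBC f g : N (fun x => f x - g x) = N (fun x => g x - f x).
Proof. by rewrite -NN; apply: eqN => x; rewrite opprB. Qed.

Lemma Ni f : N (fun x => 'i%C * f x) = N f.
Proof. by apply: NM_unit => x; rewrite /sqn /= expr0n /= add0r expr1n. Qed.

Lemma NJ f : N (fun x => (f x)^*)%C = N f.
Proof. by congr Num.sqrt; apply: eq_Rintegral => x _; rewrite sqnJ. Qed.

Lemma N0 : N (fun=> 0) = 0.
Proof.
rewrite -(@eqN (fun x => 0%:C * 0)); last by move=> x; rewrite mulr0.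
by rewrite (@NZr 0 (fun=> 0)) ?normr0 ?mul0r//; exact: inL20.
Qed.

(** Write [a], [b] for the norms and [c] for the product. The quadratic [t -> N (f + t g) ^+ 2] is
    nonnegative, but if [c] exceeded [a b] it would be negative at [t = - a / b], where it equals
    [2 a (a b - c) / b]. When [a] or [b] vanishes another [t] is chosen. *)
Lemma CS f g : inL2 mu f -> inL2 mu g -> rdot f g <= N f * N g.
Proof.
move=> hf hg.
have H (t : R) : 0 <= N f ^+ 2 + 2 * t * rdot f g + t ^+ 2 * N g ^+ 2.
  have := sqr_ge0 (N (fun x => f x + t%:C * g x)).
  rewrite N_sqD//; last exact: inL2Z.
  by rewrite rdotZr// NZr// exprMn real_normK ?num_real// mulrA.
have := N_ge0 f; have := N_ge0 g.
move: (N f) (N g) (rdot f g) H => a b c H b0 a0.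
have [b00|b1] := eqVneq b 0.
  rewrite b00 mulr0; rewrite leNgt; apply/negP => c0.
  have := H (- (a ^+ 2 + 1) / (2 * c)).
  rewrite b00 expr0n mulr0 addr0.
  have -> : 2 * (- (a ^+ 2 + 1) / (2 * c)) * c = - (a ^+ 2 + 1).
    by field; rewrite gt_eqF.
  lra.
have bp : 0 < b by rewrite lt_def b1.
rewrite leNgt; apply/negP => cab.
have := H (- a / b).
have -> : a ^+ 2 + 2 * (- a / b) * c + (- a / b) ^+ 2 * b ^+ 2 =
  2 * a * (a * b - c) / b by field.
case: (ltrgt0P a) a0 => // [ap _|a00 _]; last first.
  have := H (- c / b ^+ 2); rewrite a00.
  have -> : 0 ^+ 2 + 2 * (- c / b ^+ 2) * c + (- c / b ^+ 2) ^+ 2 * b ^+ 2 =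
    - (c / b) ^+ 2 by field.
  move: cab; rewrite a00 mul0r => cp; rewrite oppr_ge0 leNgt exprn_gt0//.
  exact: divr_gt0.
rewrite leNgt; apply/negP/negPn; rewrite pmulr_llt0 ?invr_gt0//.
rewrite pmulr_rlt0 ?subr_lt0//; lra.
Qed.

Lemma N_triangle f g : inL2 mu f -> inL2 mu g -> N (fun x => f x + g x) <= N f + N g.
Proof.
move=> hf hg; rewrite -ler_sqr ?nnegrE ?addr_ge0 ?N_ge0// N_sqD//.
have := CS hf hg; lra.
Qed.

Lemma N_triangleB f g : inL2 mu f -> inL2 mu g -> N (fun x => f x - g x) <= N f + N g.
Proof. by move=> hf hg; rewrite -(NN g) N_triangle//; exact: inL2N. Qed.

Lemma N_split h f g : inL2 mu f -> inL2 mu g -> inL2 mu h ->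
  N (fun x => f x - g x) <= N (fun x => f x - h x) + N (fun x => h x - g x).
Proof.
move=> hf hg hh; rewrite -[leLHS](@eqN (fun x => (f x - h x) + (h x - g x))).
  by apply: N_triangle; exact: inL2B.
by move=> x; rewrite addrA subrK.
Qed.

Lemma N_lip f g : inL2 mu f -> inL2 mu g -> N f <= N g + N (fun x => f x - g x).
Proof.
move=> hf hg; rewrite -[leLHS](@eqN (fun x => g x + (f x - g x))).
  by apply: N_triangle => //; exact: inL2B.
by move=> x; rewrite addrC subrK.
Qed.

Lemma N_sum n (f : nat -> T -> R[i]) : (forall i, (i < n)%N -> inL2 mu (f i)) ->
  N (fun x => \sum_(i < n) f i x) <= \sum_(i < n) N (f i).
Proof.
elim: n => [|n IH] h.
  by rewrite big_ord0 -[leLHS](@eqN (fun=> 0)) ?N0// => x; rewrite big_ord0.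
rewrite -[leLHS](@eqN (fun x => (\sum_(i < n) f i x) + f n x)); last first.
  by move=> x; rewrite big_ord_recr.
rewrite big_ord_recr /= (le_trans (N_triangle _ _))//.
- by apply: inL2_sum => i /ltnW /h.
- exact: h.
- by rewrite lerD2r IH// => i /ltnW /h.
Qed.

Lemma N_le f g : inL2 mu f -> inL2 mu g ->
  (forall x, sqn (f x) <= sqn (g x)) -> N f <= N g.
Proof.
move=> hf hg fg; rewrite ler_sqrt ?Rintegral_ge0//; last by move=> x _; exact: sqn_ge0.
by apply: le_Rintegral => //; exact: integrable_sqn.
Qed.

Lemma N_mul_le (m : T -> R[i]) f (C : R) : cmeas m -> 0 <= C ->
  (forall x, sqn (m x) <= C ^+ 2) ->
  inL2 mu f -> N (fun x => m x * f x) <= C * N f.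
Proof.
move=> mm C0 mC hf; rewrite -[C]ger0_norm// -NZr//; apply: N_le.
- exact: inL2M mm mC hf.
- exact: inL2Z.
- move=> x; rewrite !sqnM ler_wpM2r ?sqn_ge0//.
  by rewrite (le_trans (mC x))// /sqn /= expr0n /= addr0.
Qed.

Lemma ae_N0 f g : inL2 mu f -> inL2 mu g ->
  f = g %[ae mu] <-> N (fun x => f x - g x) = 0.
Proof.
move=> hf hg; have hfg := inL2B hf hg.
have mE : measurable_fun [set: T] (fun x => (sqn (f x - g x))%:E).
  by apply/measurable_EFinP; exact: (@measurable_sqn _ _ _ (fun x => f x - g x)) (inL2_cmeas _).
have H := ae_eq_integral_abs mu measurableT mE.
have E : (\int[mu]_x `|(sqn (f x - g x))%:E| = (N (fun x => (f x - g x)%R) ^+ 2)%:E)%E.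
  by rewrite -integral_sqn//; apply: eq_integral => x _ /=; rewrite ger0_norm ?sqn_ge0.
split.
- move=> fg.
  suff : (N (fun x => (f x - g x)) ^+ 2)%:E = 0%E.
    by move=> [] /eqP; rewrite sqrf_eq0 => /eqP.
  rewrite -E; apply/H; apply: filterS fg => x fgx _ /=.
  by rewrite fgx// subrr /sqn /= expr0n /= addr0.
- move=> n0; have /H : (\int[mu]_x `|(sqn (f x - g x))%:E| = 0)%E.
    by rewrite E n0 expr0n.
  apply: filterS => x /(_ I) /= [] /sqn_eq0 /eqP.
  by rewrite subr_eq0 => /eqP.
Qed.

End L2.

(** * Completeness and convergence in [L_2] *)

Section Convergence.
Context {d : measure_display} {T : measurableType d} {R : realType}.
Variable mu : {measure set T -> \bar R}.
Implicit Types (f g h : T -> R[i]).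

Lemma cvg_to_EFin (u : nat -> R) (l : R) :
  u @ \oo --> l -> (fun k => (u k)%:E) @ \oo --> l%:E.
Proof. by move=> ul; apply/fine_cvgP; split => //; exact: nearW. Qed.

Definition ccvg (u : nat -> R[i]) (l : R[i]) :=
  ((fun k => re (u k)) @ \oo --> re l) /\ ((fun k => im (u k)) @ \oo --> im l).

Lemma ccvg_sqn u l : ccvg u l -> (fun k => sqn (u k)) @ \oo --> sqn l.
Proof.
move=> [a b]; rewrite /sqn !expr2; under eq_fun do rewrite !expr2.
by apply: cvgD; exact: cvgM.
Qed.

Lemma ccvgD u l v m : ccvg u l -> ccvg v m -> ccvg (fun k => u k + v k) (l + m).
Proof.
move=> [a b] [c e]; split; rewrite reimE; under eq_fun do rewrite reimE; exact: cvgD.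
Qed.

Lemma ccvgM u l v m : ccvg u l -> ccvg v m -> ccvg (fun k => u k * v k) (l * m).
Proof.
move=> [a b] [c e]; split; rewrite reimE; under eq_fun do rewrite reimE.
  by apply: cvgB; exact: cvgM.
by apply: cvgD; exact: cvgM.
Qed.

Lemma ccvg_cst l : ccvg (fun=> l) l.
Proof. by split; exact: cvg_cst. Qed.

Lemma cmeas_lim (h : nat -> T -> R[i]) g : (forall k, cmeas (h k)) ->
  (forall x, ccvg (fun k => h k x) (g x)) -> cmeas g.
Proof.
move=> mh hg; split.
  apply: (@measurable_fun_cvg _ _ _ setT (fun k x => re (h k x))).
    by move=> k; have [] := mh k.
  by move=> x _; have [] := hg x.
apply: (@measurable_fun_cvg _ _ _ setT (fun k x => im (h k x))).
  by move=> k; have [] := mh k.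
by move=> x _; have [] := hg x.
Qed.

Lemma limn_einf_le (u : nat -> \bar R) c : (\forall n \near \oo, u n <= c)%E ->
  (limn_einf u <= c)%E.
Proof.
move=> [n0 _ H]; rewrite limn_einf_lim; apply: lime_le; first exact: is_cvg_einfs.
apply: nearW => n; rewrite /einfs /=; apply: le_trans (H (maxn n n0) _); last first.
  exact: leq_maxr.
by apply: ereal_inf_lbound; exists (maxn n n0) => //=; exact: leq_maxl.
Qed.

(** Fatou's lemma yields membership in L2 together with the bound. The approximants are bounded only
    eventually, which suits differences [h n - h k] controlled for [n >= k]. *)
Lemma N_fatou (h : nat -> T -> R[i]) g (C : R) : (forall k, inL2 mu (h k)) ->
  0 <= C -> (forall x, ccvg (fun k => h k x) (g x)) ->
  (\forall k \near \oo, N mu (h k) <= C) -> inL2 mu g /\ N mu g <= C.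
Proof.
move=> hh C0 hg hC; have mg : cmeas g.
  by apply: cmeas_lim hg => k; exact: inL2_cmeas.
have F : (\int[mu]_x (sqn (g x))%:E <= (C ^+ 2)%:E)%E.
  rewrite (eq_integral (fun x => limn_einf (fun k => (sqn (h k x))%:E))); last first.
    move=> x _; have /ccvg_sqn H := hg x.
    have /cvg_limn_einf_sup[-> //] : (fun k => (sqn (h k x))%:E) @ \oo --> (sqn (g x))%:E.
    exact: cvg_to_EFin H.
  apply: le_trans (fatou _ _ _ _) _ => //.
  - by move=> k; apply/measurable_EFinP; apply: measurable_sqn; exact: inL2_cmeas.
  - by move=> k x _; rewrite lee_fin sqn_ge0.
  apply: limn_einf_le; apply: filterS hC => k hk.
  by rewrite integral_sqn// lee_fin ler_sqr// nnegrE N_ge0.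
have hg2 : inL2 mu g.
  apply/inL2P; split=> //; apply/integrableP; split.
    by apply/measurable_EFinP; exact: measurable_sqn.
  apply: le_lt_trans (ltry (C ^+ 2)); apply: le_trans F.
  rewrite le_eqVlt; apply/orP; left; apply/eqP; apply: eq_integral => x _ /=.
  by rewrite ger0_norm ?sqn_ge0.
split => //; rewrite -ler_sqr ?nnegrE ?N_ge0//.
by rewrite integral_sqn// lee_fin in F.
Qed.

Lemma cvg_geometric_increments (u : nat -> R) (c : R) :
  (forall k, `|u k.+1 - u k| <= c * 2^-1 ^+ k) -> cvgn u.
Proof.
move=> H; have c0 : 0 <= c.
  by have := H 0%N; rewrite expr0 mulr1; apply: le_trans; exact: normr_ge0.
have : cvgn (series (telescope u)).
  apply: normed_cvg; apply: (series_le_cvg (v_ := geometric c 2^-1)) => //=.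
  - by move=> n; rewrite mulr_ge0// exprn_ge0// invr_ge0.
  - by apply: is_cvg_geometric_series; rewrite ger0_norm ?invr_ge0// invf_lt1// ltr1n.
rewrite telescopeK => /cvg_ex[l hl]; apply/cvg_ex; exists (l + u 0%N).
move: (u 0%N) hl => a hl.
rewrite (_ : u = [sequence u n - a]_n \+ cst a); last first.
  by apply/funext => n /=; rewrite subrK.
by apply: cvgD => //; exact: cvg_cst.
Qed.

Lemma cvg_increments_sqn (u : nat -> R[i]) (c : R) :
  (forall k, sqn (u k.+1 - u k) <= c ^+ 2 * (4^-1) ^+ k) -> 0 <= c ->
  ccvg u (limn (fun k => re (u k)) +i* limn (fun k => im (u k))).
Proof.
move=> H c0; have E k : c ^+ 2 * 4^-1 ^+ k = (c * 2^-1 ^+ k) ^+ 2.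
  by rewrite exprMn -exprM mulnC exprM; congr (_ * _ ^+ k); rewrite exprVn -natrX.
have p k : 0 <= c * 2^-1 ^+ k by rewrite mulr_ge0// exprn_ge0// invr_ge0.
split => /=; apply: (@cvg_geometric_increments _ c) => k.
- rewrite -[leRHS]ger0_norm// -ler_sqr ?nnegrE// !real_normK ?num_real//.
  by rewrite -E (le_trans _ (H k))// /sqn !reimE lerDl sqr_ge0.
- rewrite -[leRHS]ger0_norm// -ler_sqr ?nnegrE// !real_normK ?num_real//.
  by rewrite -E (le_trans _ (H k))// /sqn !reimE lerDr sqr_ge0.
Qed.

(** Riesz-Fischer: the sum of [4 ^ k |h (k+1) - h k| ^ 2] has finite integral, because its terms
    have integral at most [4 ^ -k]. Where the sum is finite the increments are bounded by a multiple
    of [2 ^ -k], so the sequence converges pointwise there. *)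
Lemma L2_complete_fast (h : nat -> T -> R[i]) : (forall k, inL2 mu (h k)) ->
  (forall k, N mu (fun x => h k.+1 x - h k x) <= (4^-1) ^+ k) ->
  exists g, inL2 mu g /\ forall k, N mu (fun x => g x - h k x) <= 2 * (4^-1) ^+ k.
Proof.
move=> hh hN.
pose a k x : \bar R := (4 ^+ k * sqn (h k.+1 x - h k x))%:E.
have a0 k x : (0 <= a k x)%E by rewrite lee_fin mulr_ge0 ?sqn_ge0// exprn_ge0.
have hB k : inL2 mu (fun x => h k.+1 x - h k x) by exact: inL2B.
have ma k : measurable_fun [set: T] (a k).
  apply/measurable_EFinP; apply: measurable_funM; first exact: measurable_cst.
  exact: (measurable_sqn (inL2_cmeas (hB k))).
pose G x := (\sum_(k <oo) a k x)%E.
have mG : measurable_fun [set: T] G by apply: ge0_emeasurable_sum.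
have G0 x : (0 <= G x)%E by apply: nneseries_ge0.
have iG : mu.-integrable [set: T] G.
  apply/integrableP; split => //.
  rewrite (eq_integral G); last by move=> x _; rewrite gee0_abs.
  rewrite integral_nneseries//.
  apply: (@le_lt_trans _ _ (\sum_(k <oo) (geometric 1 4^-1 k)%:E)%E).
    apply: lee_nneseries => [k _ _|k _]; first exact: integral_ge0.
    rewrite /a; under eq_integral do rewrite EFinM.
    rewrite ge0_integralZl//; last 2 first.
    - apply/measurable_EFinP; exact: (measurable_sqn (inL2_cmeas (hB k))).
    - by move=> x _; rewrite lee_fin sqn_ge0.
    rewrite (integral_sqn (hB k)) -EFinM lee_fin /geometric /= mul1r.
    apply: (@le_trans _ _ (4 ^+ k * ((4^-1) ^+ k) ^+ 2)).
      by rewrite ler_wpM2l ?exprn_ge0// ler_sqr ?nnegrE ?N_ge0// exprn_ge0 ?invr_ge0.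
    by rewrite expr2 mulrA -exprMn mulfV// expr1n mul1r.
  have C : series (geometric 1 4^-1) @ \oo --> 1 * (1 - 4^-1 : R)^-1.
    by apply: cvg_geometric_series; rewrite ger0_norm ?invr_ge0// invf_lt1// ltr1n.
  rewrite (_ : limn _ = (1 * (1 - 4^-1 : R)^-1)%:E) ?ltry//.
  apply/cvg_lim => //; have := cvg_to_EFin C.
  apply: cvg_trans; apply: near_eq_cvg; apply: nearW => n /=.
  by rewrite sumEFin.
(* On the null set where [G] is infinite convergence may fail; cutting [h] by [E] gives
   representatives that converge everywhere, with a measurable limit. *)
pose E := [set x | G x < +oo]%E.
have mE : measurable E.
  by rewrite /E -[X in measurable X]setTI; apply: emeasurable_fun_infty_o.
have aeE : {ae mu, forall x, E x}.
  apply: filterS (integrable_ae measurableT iG) => x /(_ I).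
  by rewrite ge0_fin_numE.
pose h' k x : R[i] := (\1_E x)%:C * h k x.
have hh' k : inL2 mu (h' k).
  apply: (@inL2M _ _ _ _ (fun x => (\1_E x)%:C) _ 1) => //.
    by apply: cmeas_real; exact: measurable_indic.
  by move=> x; exact: sqn_indic.
have eqh k : h' k = h k %[ae mu].
  apply: filterS aeE => x Ex _; rewrite /h' indicE mem_set// mul1r//.
pose g x : R[i] := limn (fun k => re (h' k x)) +i* limn (fun k => im (h' k x)).
have cg x : ccvg (fun k => h' k x) (g x).
  have [Ex|nEx] := pselect (E x); last first.
    apply: (@cvg_increments_sqn (fun k => h' k x) 0) => // k.
    by rewrite /h' indicE memNset// !mul0r subrr /sqn /= expr0n /= addr0 mul0r.
  have Gf : G x \is a fin_num by rewrite ge0_fin_numE.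
  apply: (@cvg_increments_sqn (fun k => h' k x) (Num.sqrt (fine (G x)))); last exact: sqrtr_ge0.
  move=> k; rewrite sqr_sqrtr ?fine_ge0// /h' indicE mem_set// !mul1r.
  rewrite exprVn ler_pdivlMr ?exprn_gt0// mulrC -lee_fin fineK//.
  rewrite -[leLHS]/(a k x).
  apply: le_trans (@nneseries_lim_ge _ (a^~ x) xpredT 0%N k.+1 _); last by move=> *.
  rewrite big_nat_recr//= leeDr// sume_ge0//.
have step k n : N mu (fun x => h (k + n)%N x - h k x) <= 2 * (4^-1) ^+ k.
  have e4 j : 0 <= (4^-1 : R) ^+ j by rewrite exprn_ge0// invr_ge0.
  (* The subtracted term makes the induction close: [4 ^ -j <= 2 * 4 ^ -j - 2 * 4 ^ -(j+1)]. *)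
  have : N mu (fun x => h (k + n)%N x - h k x) <= 2 * (4^-1) ^+ k - 2 * (4^-1) ^+ (k + n).
    elim: n => [|n IH].
      rewrite addn0 subrr -[leLHS](@eqN _ _ _ _ (fun=> 0)) ?N0// => x.
      by rewrite subrr.
    rewrite addnS (le_trans (@N_split _ _ _ mu (h (k + n)%N) _ _ _ _ _))//.
    rewrite exprS; have := hN (k + n)%N; have := e4 (k + n)%N; lra.
  by have := e4 (k + n)%N; lra.
have NE (f1 f2 : T -> R[i]) : inL2 mu f1 -> inL2 mu f2 -> f1 = f2 %[ae mu] ->
   N mu f1 = N mu f2.
  move=> h1 h2 /(ae_N0 h1 h2) e; apply/eqP; rewrite eq_le.
  have := N_lip h1 h2; rewrite e addr0 => ->.
  by have := N_lip h2 h1; rewrite NBC e addr0.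
have F k : inL2 mu (fun x => g x - h' k x) /\
    N mu (fun x => g x - h' k x) <= 2 * (4^-1) ^+ k.
  apply: (@N_fatou (fun n x => h' n x - h' k x)).
  - by move=> n; exact: inL2B.
  - by rewrite mulr_ge0// exprn_ge0// invr_ge0.
  - by move=> x; apply: ccvgD (cg x) _; exact: ccvg_cst.
  - exists k => // n /= kn; have := step k (n - k)%N; rewrite subnKC//.
    apply: le_trans; rewrite le_eqVlt; apply/orP; left; apply/eqP.
    apply: NE; [exact: inL2B..|].
    by apply: filterS2 (eqh n) (eqh k) => x e1 e2 _; rewrite e1// e2.
have hg : inL2 mu g.
  have := inL2D (F 0%N).1 (hh' 0%N).
  by congr inL2; apply/funext => x; rewrite subrK.
exists g; split=> // k; apply: le_trans (F k).2; rewrite le_eqVlt; apply/orP; left.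
apply/eqP/NE; [exact: inL2B..|].
by apply: filterS (eqh k) => x e1 _; rewrite e1.
Qed.

Lemma L2_complete (h : nat -> T -> R[i]) : (forall k, inL2 mu (h k)) ->
  (forall e, 0 < e -> exists n0, forall m n, (n0 <= m)%N -> (n0 <= n)%N ->
     N mu (fun x => h m x - h n x) <= e) ->
  exists g, inL2 mu g /\ (fun k => N mu (fun x => h k x - g x)) @ \oo --> 0.
Proof.
move=> hh hC.
have e4 k : 0 < (4^-1 : R) ^+ k by rewrite exprn_gt0// invr_gt0.
have /choice[phi Hphi] k := hC _ (e4 k).
(* The running maximum is nondecreasing, so [psi k] and [psi k.+1] both lie beyond the Cauchy
   threshold [phi k]. *)
pose psi k := (\max_(j < k.+1) phi j)%N.
have psiP k : (phi k <= psi k)%N by exact: (leq_bigmax (@ord_max k)).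
have psiS k : (psi k <= psi k.+1)%N.
  by rewrite /psi [leqRHS]big_ord_recr /= leq_maxl.
have [||g [hg Hg]] := @L2_complete_fast (fun k => h (psi k)) => //.
  by move=> k; apply: Hphi; rewrite // (leq_trans (psiP k)).
exists g; split=> //; apply/cvgrPdist_le => e e0.
have : (fun k => 3 * (4^-1 : R) ^+ k) @ \oo --> 3 * (0 : R).
  apply: cvgMr; apply: cvg_expr; rewrite ger0_norm ?invr_ge0// invf_lt1// ltr1n//.
rewrite mulr0 => /cvgrPdist_le/(_ _ e0)[k _ /(_ k (leqnn k))].
rewrite sub0r normrN ger0_norm ?mulr_ge0 ?(ltW (e4 k))// => ke.
exists (psi k) => // n /= kn; rewrite sub0r normrN ger0_norm ?N_ge0//.
rewrite (le_trans (@N_split _ _ _ mu (h (psi k)) _ _ _ _ _))//.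
have := Hg k; rewrite NBC.
have := Hphi k n (psi k) (leq_trans (psiP k) kn) (psiP k).
by move: ke; lra.
Qed.

Lemma N_dominated (h : nat -> T -> R[i]) (g : T -> R) : (forall k, cmeas (h k)) ->
  mu.-integrable [set: T] (EFin \o g) -> (forall k x, sqn (h k x) <= g x) ->
  (forall x, ccvg (fun k => h k x) 0) -> (fun k => N mu (h k)) @ \oo --> 0.
Proof.
move=> mh ig hg h0.
have hh k : inL2 mu (h k) by apply: inL2_dom ig (hg k).
have mF k : measurable_fun [set: T] (fun x => (sqn (h k x))%:E).
  by apply/measurable_EFinP; exact: measurable_sqn (mh k).
have F0 : {ae mu, forall x, [set: T] x -> (fun k => (sqn (h k x))%:E) @ \oo --> 0%E}.
  apply: aeW => x _; apply: cvg_to_EFin.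
  by have := ccvg_sqn (h0 x); rewrite sqn_real expr0n.
have Fg : {ae mu, forall x n, [set: T] x -> (`|(sqn (h n x))%:E| <= (EFin \o g) x)%E}.
  by apply: aeW => x k _ /=; rewrite lee_fin ger0_norm ?sqn_ge0.
have [_ _] := dominated_convergence measurableT mF (measurable_cst _) F0 ig Fg.
rewrite integral0 (_ : [sequence _]_n = fun k => (N mu (h k) ^+ 2)%:E); last first.
  by apply/funext => k; rewrite -integral_sqn.
move=> /fine_cvgP[_ H].
rewrite (_ : (fun k => _) = Num.sqrt \o (fun k => N mu (h k) ^+ 2)); last first.
  by apply/funext => k /=; rewrite sqrtr_sqr ger0_norm ?N_ge0.
by rewrite -[X in _ --> X](@sqrtr0 R); apply: (cvg_comp _ _ H); exact: sqrt_continuous.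
Qed.

(** Dominated convergence in the form used for cut-offs by growing boxes, for phases, and for
    potentials at converging times. *)
Lemma N_mul_cvg0 (m : nat -> T -> R[i]) f (B : R) : (forall k, cmeas (m k)) ->
  (forall k x, sqn (m k x) <= B) -> (forall x, ccvg (fun k => m k x) 0) ->
  inL2 mu f -> (fun k => N mu (fun x => m k x * f x)) @ \oo --> 0.
Proof.
move=> mm mB m0 hf; apply: (@N_dominated _ (fun x => B * sqn (f x))).
- by move=> k; exact: cmeasM (mm k) (inL2_cmeas hf).
- by have := integrableZl measurableT B (integrable_sqn hf).
- by move=> k x; rewrite sqnM ler_wpM2r ?sqn_ge0.
- by move=> x; rewrite -(mul0r (f x)); apply: ccvgM => //; exact: ccvg_cst.
Qed.

End Convergence.

(** * Density *)

Import HBNNSimple.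

Section Density.
Context {d : measure_display} {T : measurableType d} {R : realType}.
Variable mu : {measure set T -> \bar R}.
Implicit Types (f g h : T -> R[i]).

Definition L2_closure (V : (T -> R[i]) -> Prop) f :=
  inL2 mu f /\ forall e : R, 0 < e -> exists2 g, V g & N mu (fun x => f x - g x) <= e.

Variable V : (T -> R[i]) -> Prop.
Hypothesis V_L2 : forall f, V f -> inL2 mu f.
Hypothesis V0 : V (fun=> 0).
Hypothesis V_lin : forall a f g, V f -> V g -> V (fun x => a * f x + g x).

Lemma clV_lin a f g : L2_closure V f -> L2_closure V g ->
  L2_closure V (fun x => a * f x + g x).
Proof.
move=> [hf Hf] [hg Hg]; split; first exact: inL2D (inL2Z _ hf) hg.
move=> e e0; have s0 := sqrtr_ge0 (sqn a).
have e1 : 0 < e / 2 / (Num.sqrt (sqn a) + 1) by rewrite !divr_gt0// ltr_wpDl.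
have [f' Vf Nf] := Hf _ e1.
have e2 : 0 < e / 2 by rewrite divr_gt0.
have [g' Vg Ng] := Hg _ e2.
exists (fun x => a * f' x + g' x); first exact: V_lin.
have hf' := inL2B hf (V_L2 Vf); have hg' := inL2B hg (V_L2 Vg).
rewrite -[leLHS](@eqN _ _ _ _ (fun x => a * (f x - f' x) + (g x - g' x))); last first.
  by move=> x; ring.
rewrite (le_trans (N_triangle (inL2Z _ hf') hg'))// NZ//.
have : Num.sqrt (sqn a) * N mu (fun x => f x - f' x) <= e / 2.
  apply: le_trans (_ : (Num.sqrt (sqn a) + 1) * (e / 2 / (Num.sqrt (sqn a) + 1)) <= _).
    by apply: ler_pM => //; [exact: N_ge0|rewrite lerDl].
  by rewrite mulrC divfK// gt_eqF// ltr_wpDl.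
by move: Ng; lra.
Qed.

Lemma V_closure f : V f -> L2_closure V f.
Proof.
move=> Vf; split; first exact: V_L2.
move=> e e0; exists f => //; rewrite -[leLHS](@eqN _ _ _ _ (fun=> 0)) ?N0 ?ltW// => x.
by rewrite subrr.
Qed.

Lemma clV_Z a f : L2_closure V f -> L2_closure V (fun x => a * f x).
Proof.
move=> hf; have := clV_lin a hf (V_closure V0).
by congr L2_closure; apply/funext => x; rewrite addr0.
Qed.

Lemma clV_D f g : L2_closure V f -> L2_closure V g -> L2_closure V (fun x => f x + g x).
Proof.
move=> hf hg; have := clV_lin 1 hf hg.
by congr L2_closure; apply/funext => x; rewrite mul1r.
Qed.

Lemma clV_sum (I : Type) (s : seq I) (F : I -> T -> R[i]) :
  (forall i, L2_closure V (F i)) -> L2_closure V (fun x => \sum_(i <- s) F i x).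
Proof.
move=> H; elim: s => [|i s IH].
  by under eq_fun do rewrite big_nil; exact: V_closure.
by under eq_fun do rewrite big_cons; exact: clV_D.
Qed.

Lemma clV_cvg (h : nat -> T -> R[i]) f : (forall k, L2_closure V (h k)) -> inL2 mu f ->
  (fun k => N mu (fun x => h k x - f x)) @ \oo --> 0 -> L2_closure V f.
Proof.
move=> Vh hf /cvgrPdist_le H; split=> // e e0.
have e2 : 0 < e / 2 by rewrite divr_gt0.
have [n _ /(_ n (leqnn n))] := H _ e2.
rewrite sub0r normrN ger0_norm ?N_ge0// => hn.
have [hhn /(_ _ e2)[g Vg Ng]] := Vh n.
exists g => //; rewrite (le_trans (@N_split _ _ _ mu (h n) _ _ _ _ _))//; first exact: V_L2.
by rewrite NBC; move: Ng hn; lra.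
Qed.

Variables (G : set (set T)) (D : set T).
Hypothesis mD : measurable D.
Hypothesis GE : @measurable _ T = <<s G >>.
Hypothesis GI : setI_closed G.
Hypothesis VG : forall A, G A -> L2_closure V (fun x => (\1_A x * \1_D x : R)%:C).
Hypothesis VD : L2_closure V (fun x => (\1_D x : R)%:C).

(** Dynkin's theorem: the sets [A] whose indicator, cut to [D], is a limit of [V] form a
    lambda-system. Complements are available because the indicator of the window [D] is itself such
    a limit. *)
Lemma clV_indic A : measurable A -> L2_closure V (fun x => (\1_A x * \1_D x : R)%:C).
Proof.
move=> mA; have : (<<s G >>) A by rewrite -GE.
move: A {mA}; apply: (dynkin_induction GE GI).
- by move: VD; congr L2_closure; apply/funext => x; rewrite indicT mul1r.
- by move=> A; exact: VG.
- move=> A mA hA; have := clV_D VD (clV_Z (-1) hA).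
  congr L2_closure; apply/funext => x; rewrite mulN1r -rmorphB/= indicC.
  by rewrite !indicE; case: (_ \in A) => /=; congr (_%:C); ring.
- move=> F mF tF hF.
  pose S n := fun x => \sum_(k < n) (\1_(F k) x * \1_D x : R)%:C.
  have hS n : L2_closure V (S n).
    have := @clV_sum _ (index_enum 'I_n)
      (fun (k : 'I_n) x => (\1_(F k) x * \1_D x : R)%:C) (fun k => hF k).
    by [].
  have mU : measurable (\bigcup_k F k) by exact: bigcupT_measurable.
  have h1 (A : set T) : measurable A -> cmeas (fun x => (\1_A x : R)%:C).
    by move=> mA; apply: cmeas_real; exact: measurable_indic.
  have hD : inL2 mu (fun x => (\1_D x : R)%:C) := VD.1.
  apply: clV_cvg hS _ _.
    under eq_fun do rewrite rmorphM /=; apply: (inL2M (C := 1)) => //; first exact: h1.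
    by move=> x; exact: sqn_indic.
  pose m n x := \sum_(k < n) (\1_(F k) x : R)%:C - (\1_(\bigcup_k F k) x : R)%:C.
  have U k j x : F k x -> F j x -> k = j.
    by move=> Fk Fj; apply: tF => //; exists x.
  (* By disjointness the error is [-1] at the points of a tail set [F j] with [n <= j], and [0]
     elsewhere, so it tends to [0] pointwise. *)
  have mE n x : m n x = if pselect (exists2 j, F j x & (n <= j)%N) then -1 else 0.
    rewrite /m; case: pselect => [[j Fj nj]|H].
      rewrite big1 ?sub0r ?indicE ?mem_set//; first by exists j.
      move=> k _; rewrite indicE memNset// => Fk.
      by have := ltn_ord k; rewrite (U _ _ _ Fk Fj) ltnNge nj.
    rewrite indicE; have [[j _ Fj]|nU] := pselect ((\bigcup_k F k) x).
      rewrite mem_set; last by exists j.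
      have jn : (j < n)%N by rewrite ltnNge; apply/negP => nj; apply: H; exists j.
      rewrite (bigD1 (Ordinal jn))//= indicE mem_set// big1 ?addr0 ?subrr// => k /eqP kj.
      by rewrite indicE memNset// => Fk; apply: kj; apply/val_inj/(U _ _ _ Fk Fj).
    rewrite memNset// subr0 big1// => k _; rewrite indicE memNset// => Fk.
    by apply: nU; exists k.
  rewrite (_ : (fun k => _) = (fun k => N mu (fun x => m k x * (\1_D x : R)%:C))); last first.
    apply/funext => n; apply: eqN => x; rewrite /S /m mulrBl rmorphM /= mulr_suml.
    by congr (_ - _); apply: eq_bigr => i _; rewrite rmorphM.
  apply: (@N_mul_cvg0 _ _ _ _ _ _ 1) => //.
  + move=> n; rewrite /m; under eq_fun do rewrite -mulN1r.
    apply: cmeasD; last by apply: cmeasM; [exact: cmeas_cst|exact: h1].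
    by apply: (cmeas_sum (f := fun k x => (\1_(F k) x : R)%:C)) => k _; exact: h1.
  + move=> n x; rewrite mE /sqn; case: pselect => _ /=; rewrite ?oppr0; lra.
  + move=> x; have [[j _ Fj]|nU] := pselect ((\bigcup_k F k) x).
      have m0 : \forall n \near \oo, m n x = 0.
        exists j.+1 => // n /= jn; rewrite mE; case: pselect => // -[k Fk nk].
        by move: jn; rewrite -(U _ _ _ Fk Fj) ltnNge nk.
      by split; apply: cvg_near_cst; apply: filterS m0 => n ->.
    rewrite (_ : (fun k => m k x) = (fun=> 0)); first exact: ccvg_cst.
    apply/funext => n; rewrite mE; case: pselect => [[k Fk kn]|//].
    by exfalso; apply: nU; exists k.
Qed.

Lemma clV_ge0 (f : T -> R) : (forall x, 0 <= f x) -> inL2 mu (fun x => (f x)%:C) ->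
  L2_closure V (fun x => (f x * \1_D x)%:C).
Proof.
move=> f0 hf.
have mf : measurable_fun [set: T] (EFin \o f).
  by apply/measurable_EFinP; case: hf => /= [].
pose s := nnsfun_approx measurableT mf.
have s_cvg x : (fun k => s k x) @ \oo --> f x.
  have /fine_cvgP[_] := @cvg_nnsfun_approx _ _ _ _ measurableT _ mf
    (fun x _ => (f0 x : 0 <= (EFin \o f) x)%E) x I.
  by [].
have s_le k x : s k x <= f x.
  rewrite -(cvg_lim _ (s_cvg x))//; apply: nondecreasing_cvgn_le => //.
    move=> m n mn; have /lefP := @nd_nnsfun_approx _ _ _ _ measurableT _ mf m n mn.
    exact.
  by apply/cvg_ex; exists (f x).
have s0 k x : 0 <= s k x by [].
have hs k : L2_closure V (fun x => (s k x * \1_D x)%:C).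
  have E x : (s k x * \1_D x)%:C = \sum_(y <- finmap.enum_fset (fset_set (range (s k))))
      (y%:C * (\1_(s k @^-1` [set y]) x * \1_D x : R)%:C).
    rewrite {1}fimfunE fsbig_finite//= mulr_suml rmorph_sum /=; apply: eq_bigr => y _.
    by rewrite -mulrA rmorphM.
  rewrite (funext E); apply: clV_sum => y; apply: clV_Z; apply: clV_indic; exact: measurable_sfunP.
have mi : measurable_fun [set: T] (\1_D : T -> R) by exact: measurable_indic.
apply: clV_cvg hs _ _.
  under eq_fun do rewrite mulrC rmorphM /=; apply: (inL2M (C := 1)) => //.
  by move=> x; exact: sqn_indic.
apply: (@N_dominated _ _ _ _ _ (fun x => sqn (f x)%:C)).
- move=> k; under eq_fun do rewrite -rmorphB /=.
  apply: cmeas_real; apply: measurable_funB; apply: measurable_funM => //.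
  exact/measurable_EFinP.
- exact: integrable_sqn hf.
- move=> k x; rewrite -rmorphB /= !sqn_real -mulrBl exprMn.
  have := s_le k x; have := s0 k x; have := f0 x; rewrite indicE.
  by case: (_ \in _); rewrite ?expr0n ?mulr0 ?sqr_ge0// ?expr1n ?mulr1 ; nra.
- move=> x; split; last first.
    under eq_fun do rewrite -rmorphB /=; exact: cvg_cst.
  under eq_fun do rewrite -rmorphB /= -mulrBl.
  have -> : re 0 = (f x - f x) * \1_D x :> R by rewrite subrr mul0r.
  by apply: cvgM; [apply: cvgB => //; exact: cvg_cst|exact: cvg_cst].
Qed.

(** Nonnegative functions are reached through simple functions; real and imaginary parts are then
    split into positive and negative parts, each with square dominated by [sqn f]. *)
Lemma L2_dense f : inL2 mu f -> L2_closure V (fun x => (\1_D x : R)%:C * f x).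
Proof.
move=> hf.
have key (g : T -> R) : measurable_fun [set: T] g -> (forall x, g x ^+ 2 <= sqn (f x)) ->
    L2_closure V (fun x => (g x * \1_D x)%:C).
  move=> mg gf.
  have hp (g' : T -> R) : measurable_fun [set: T] g' -> (forall x, 0 <= g' x <= `|g x|) ->
      L2_closure V (fun x => (g' x * \1_D x)%:C).
    move=> mg' gg'; apply: clV_ge0 => [x|]; first by have /andP[] := gg' x.
    apply: inL2_dom (integrable_sqn hf) _; first exact: cmeas_real.
    move=> x /=; rewrite sqn_real (le_trans _ (gf x))//.
    rewrite -[leRHS]real_normK ?num_real// ler_sqr ?nnegrE//; by have /andP[] := gg' x.
  have m0 : measurable_fun [set: T] (fun=> 0 : R) by exact: measurable_cst.
  have mo : measurable_fun [set: T] (fun x => - g x) by exact: measurableT_comp.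
  have h1 : L2_closure V (fun x => (Num.max (g x) 0 * \1_D x)%:C).
    apply: hp; first exact: measurable_maxr.
    by move=> x; rewrite le_max lexx orbT ge_max ler_norm normr_ge0.
  have h2 : L2_closure V (fun x => (Num.max (- g x) 0 * \1_D x)%:C).
    apply: hp; first exact: measurable_maxr.
    by move=> x; rewrite le_max lexx orbT ge_max normr_ge0 -normrN ler_norm.
  have := clV_D h1 (clV_Z (-1) h2); congr L2_closure; apply/funext => x.
  rewrite mulN1r -rmorphB /=; congr (_%:C); rewrite -mulrBl; congr (_ * _).
  by rewrite /Num.max; case: ltP => ?; case: ltP => ?; lra.
have [mr mi] := inL2_cmeas hf.
have h1 := key _ mr (fun x => _); have h2 := key _ mi (fun x => _).
have := clV_D (h1 _) (clV_Z 'i%C (h2 _)).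
have e1 x : re (f x) ^+ 2 <= sqn (f x) by rewrite lerDl sqr_ge0.
have e2 x : im (f x) ^+ 2 <= sqn (f x) by rewrite lerDr sqr_ge0.
move=> /(_ e1 e2); congr L2_closure; apply/funext => x.
by apply: complexP; rewrite !reimE /=; ring.
Qed.

End Density.

(** * Inner products and spans *)

Section Span.
Context {T : Type} {R : realType}.
Implicit Types (f g : T -> R[i]).

(** Built one generator at a time, so that sesquilinear identities extend from the generators by
    induction. *)
Inductive cspan (S : (T -> R[i]) -> Prop) : (T -> R[i]) -> Prop :=
| cspan0 : cspan S (fun=> 0)
| cspan_cons a f g : S f -> cspan S g -> cspan S (fun x => a * f x + g x).

Lemma cspan_lin S a f g : cspan S f -> cspan S g -> cspan S (fun x => a * f x + g x).
Proof.
move=> sf sg; elim: sf => [|b f' g' Sf' sg' IH].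
  by move: sg; congr cspan; apply/funext => x; rewrite mulr0 add0r.
have := cspan_cons (a * b) Sf' IH; congr cspan; apply/funext => x; ring.
Qed.

Lemma cspan_gen S f : S f -> cspan S f.
Proof.
by move=> Sf; have := cspan_cons 1 Sf (cspan0 S); congr cspan; apply/funext => x; rewrite mul1r addr0.
Qed.

End Span.

Section Inner.
Context {d : measure_display} {T : measurableType d} {R : realType}.
Variable mu : {measure set T -> \bar R}.
Implicit Types (f g h : T -> R[i]).

Lemma innerE f g : inner mu f g = rdot mu f g +i* rdot mu f (fun x => 'i%C * g x).
Proof.
rewrite /inner /cintegral /rdot; congr (_ +i* _); apply: eq_Rintegral => x _;
  rewrite !reimE /=; ring.
Qed.

Lemma innerC f g : inL2 mu f -> inL2 mu g -> inner mu f g = (inner mu g f)^*%C.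
Proof.
move=> hf hg; rewrite !innerE; apply: complexP; rewrite !reimE /=; first exact: rdotC.
rewrite -mulN1r -rdotZl//; last exact: inL2Z.
by apply: eq_Rintegral => x _; rewrite !reimE /=; ring.
Qed.

Lemma inner_linl a f g h : inL2 mu f -> inL2 mu g -> inL2 mu h ->
  inner mu (fun x => a * f x + g x) h = a * inner mu f h + inner mu g h.
Proof.
move=> hf hg hh.
have hih := inL2Z 'i%C hh; have hif := inL2Z 'i%C hf.
have I1 : rdot mu (fun x => 'i%C * f x) h = - rdot mu f (fun x => 'i%C * h x).
  rewrite -mulN1r -rdotZr//; apply: eq_Rintegral => x _; rewrite !reimE /=; ring.
have I2 : rdot mu (fun x => 'i%C * f x) (fun x => 'i%C * h x) = rdot mu f h.
  apply: eq_Rintegral => x _; rewrite !reimE /=; ring.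
have E (w : T -> R[i]) : inL2 mu w -> rdot mu (fun x => a * f x + g x) w =
    re a * rdot mu f w + im a * rdot mu (fun x => 'i%C * f x) w + rdot mu g w.
  move=> hw'; rewrite -[RHS]addrA.
  have -> : (fun x => a * f x + g x) =
      (fun x => (re a)%:C * f x + ((im a)%:C * ('i%C * f x) + g x)).
    by apply/funext => x; apply: complexP; rewrite !reimE /=; ring.
  rewrite rdotDl//; [|exact: inL2Z|by apply: inL2D => //; exact: inL2Z].
  by rewrite rdotDl// ?rdotZl//; exact: inL2Z.
by rewrite !innerE !E// I1 I2; apply: complexP; rewrite !reimE /=; ring.
Qed.

Lemma inner_linr a f g h : inL2 mu f -> inL2 mu g -> inL2 mu h ->
  inner mu h (fun x => a * f x + g x) = (a^*)%C * inner mu h f + inner mu h g.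
Proof.
move=> hf hg hh; rewrite innerC//; last by apply: inL2D => //; exact: inL2Z.
rewrite inner_linl// (innerC hh hf) (innerC hh hg).
by apply: complexP; rewrite !reimE /=; ring.
Qed.

Lemma inner_linBl f g h : inL2 mu f -> inL2 mu g -> inL2 mu h ->
  inner mu (fun x => f x - g x) h = inner mu f h - inner mu g h.
Proof.
move=> hf hg hh; have := inner_linl (-1) hg hf hh.
have -> : (fun x => -1 * g x + f x) = (fun x => f x - g x) by apply/funext => x; ring.
by move=> ->; ring.
Qed.

Lemma inner_linBr f g h : inL2 mu f -> inL2 mu g -> inL2 mu h ->
  inner mu h (fun x => f x - g x) = inner mu h f - inner mu h g.
Proof.
move=> hf hg hh; have := inner_linr (-1) hg hf hh.
have -> : (fun x => -1 * g x + f x) = (fun x => f x - g x) by apply/funext => x; ring.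
by move=> ->; rewrite rmorphN1; ring.
Qed.

Lemma inner0l h : inner mu (fun=> 0) h = 0.
Proof.
rewrite /inner /cintegral; apply: complexP => /=.
  rewrite -[RHS](@Rintegral_set0 _ _ _ mu (fun=> 0)) /Rintegral integral_set0.
  by congr fine; rewrite -[RHS](@integral0 _ _ _ mu setT); apply: eq_integral => x _; rewrite mul0r.
rewrite -[RHS](@Rintegral_set0 _ _ _ mu (fun=> 0)) /Rintegral integral_set0.
by congr fine; rewrite -[RHS](@integral0 _ _ _ mu setT); apply: eq_integral => x _; rewrite mul0r.
Qed.

Lemma inner_N f : inL2 mu f -> inner mu f f = (N mu f ^+ 2)%:C.
Proof.
move=> hf; rewrite innerE -N_rdot; congr (_ +i* _).
rewrite /rdot /Rintegral -[RHS]/(fine 0%:E); congr fine.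
rewrite -[RHS](@integral0 _ _ _ mu setT); apply: eq_integral => x _.
by congr EFin; rewrite !reimE /=; ring.
Qed.

Lemma N_eq_inner f g c : inL2 mu f -> inL2 mu g -> 0 <= c ->
  inner mu g g = (c ^+ 2)%:C * inner mu f f -> N mu g = c * N mu f.
Proof.
move=> hf hg c0; rewrite !inner_N// -rmorphM /= -exprMn => /complexI /eqP.
by rewrite eqrXn2 ?mulr_ge0 ?N_ge0// => /eqP.
Qed.

Lemma inner_suml n (F : nat -> T -> R[i]) h :
  (forall k, (k < n)%N -> inL2 mu (F k)) -> inL2 mu h ->
  inner mu (fun x => \sum_(k < n) F k x) h = \sum_(k < n) inner mu (F k) h.
Proof.
move=> hF hh; elim: n hF => [|n IH] hF.
  rewrite big_ord0 -[RHS](inner0l h); apply: (congr1 (fun g => inner mu g h)).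
  by apply/funext => x; rewrite big_ord0.
rewrite big_ord_recr /= -IH; last by move=> k /ltnW /hF.
rewrite addrC -[X in X + _]mul1r -inner_linl//; [|exact: hF|by apply: inL2_sum => k /ltnW /hF].
apply: (congr1 (fun g => inner mu g h)).
by apply/funext => x; rewrite big_ord_recr /= mul1r addrC.
Qed.

Lemma inner_sumr n (F : nat -> T -> R[i]) h :
  (forall k, (k < n)%N -> inL2 mu (F k)) -> inL2 mu h ->
  inner mu h (fun x => \sum_(k < n) F k x) = \sum_(k < n) inner mu h (F k).
Proof.
move=> hF hh; rewrite innerC//; last exact: inL2_sum.
rewrite inner_suml// rmorph_sum; apply: eq_bigr => k _.
by rewrite (innerC hh)//; exact: hF.
Qed.

Lemma rdot_N f g : inL2 mu f -> inL2 mu g ->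
  rdot mu f g = (N mu f ^+ 2 + N mu g ^+ 2 - N mu (fun x => f x - g x) ^+ 2) / 2.
Proof.
move=> hf hg; have := N_sqD hf (inL2N hg).
have -> : rdot mu f (fun x => - g x) = - rdot mu f g.
  rewrite -mulN1r -rdotZr//; apply: eq_Rintegral => x _; rewrite !reimE /=; ring.
by rewrite NN => ->; field.
Qed.

Lemma rdot_abs f g : inL2 mu f -> inL2 mu g -> `|rdot mu f g| <= N mu f * N mu g.
Proof.
move=> hf hg; rewrite ler_norml CS// andbT lerNl -(NN mu f) -mulN1r -rdotZl//.
rewrite (_ : (fun x => _) = (fun x => - f x)); first by apply: CS => //; exact: inL2N.
by apply/funext => x; apply: complexP; rewrite !reimE /=; ring.
Qed.

Lemma inner_null g h : inL2 mu g -> inL2 mu h -> N mu g = 0 -> inner mu h g = 0.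
Proof.
move=> hg hh g0; rewrite innerE; apply: complexP => /=.
  by have := rdot_abs hh hg; rewrite g0 mulr0 normr_le0 => /eqP.
by have := rdot_abs hh (inL2Z 'i%C hg); rewrite Ni g0 mulr0 normr_le0 => /eqP.
Qed.

Lemma N_sub_inner f g f' g' : inL2 mu f -> inL2 mu g -> inL2 mu f' -> inL2 mu g' ->
  inner mu f f = inner mu f' f' -> inner mu g g = inner mu g' g' ->
  inner mu f g = inner mu f' g' ->
  N mu (fun x => f x - g x) = N mu (fun x => f' x - g' x).
Proof.
move=> hf hg hf' hg' eff egg efg.
have nf : N mu f ^+ 2 = N mu f' ^+ 2.
  by have := congr1 (fun z : R[i] => re z) eff; rewrite (inner_N hf) (inner_N hf').
have ng : N mu g ^+ 2 = N mu g' ^+ 2.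
  by have := congr1 (fun z : R[i] => re z) egg; rewrite (inner_N hg) (inner_N hg').
have rfg : rdot mu f g = rdot mu f' g' by have := congr1 (fun z : R[i] => re z) efg; rewrite !innerE.
have e : N mu (fun x => f x - g x) ^+ 2 = N mu (fun x => f' x - g' x) ^+ 2.
  have := rfg; rewrite (rdot_N hf hg) (rdot_N hf' hg') nf ng; lra.
by apply/eqP; rewrite -(@eqrXn2 _ 2%N) ?N_ge0// e.
Qed.

Lemma cspan_L2 S f : (forall f, S f -> inL2 mu f) -> cspan S f -> inL2 mu f.
Proof.
move=> hS; elim => [|a {}f g Sf sg IH]; first exact: inL20.
by apply: inL2D => //; apply: inL2Z; exact: hS.
Qed.

(** A Gram matrix scaled by [c ^ 2] on the generators is scaled so on the whole span, first in the
    right argument, then in the left one. Linearity of [U] is asked at every point, as holds for a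
    transform given by an integral at each point. *)
Lemma cspan_isometry S (U : (T -> R[i]) -> T -> R[i]) (c : R) :
  (forall f, S f -> inL2 mu f) -> 0 <= c ->
  (forall a f g, inL2 mu f -> inL2 mu g ->
    U (fun x => a * f x + g x) = (fun x => a * U f x + U g x)) ->
  U (fun=> 0) = (fun=> 0) ->
  (forall f, S f -> inL2 mu (U f)) ->
  (forall f g, S f -> S g -> inner mu (U f) (U g) = (c ^+ 2)%:C * inner mu f g) ->
  forall f, cspan S f -> inL2 mu (U f) /\ N mu (U f) = c * N mu f.
Proof.
move=> hS c0 Ulin U0 US Uin f sf.
have sL2 g : cspan S g -> inL2 mu g by exact: cspan_L2.
have UL2 g : cspan S g -> inL2 mu (U g).
  elim => [|a g1 g2 Sg1 sg2 IH]; first by rewrite U0; exact: inL20.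
  rewrite Ulin; [|exact: hS|exact: sL2].
  by apply: inL2D => //; apply: inL2Z; exact: US.
split; first exact: UL2.
apply: N_eq_inner => //; [exact: sL2|exact: UL2|].
have H1 g h : S g -> cspan S h -> inner mu (U g) (U h) = (c ^+ 2)%:C * inner mu g h.
  move=> Sg; elim => [|a h1 h2 Sh1 sh2 IH].
    have z := inL20 mu; rewrite U0 (innerC (US _ Sg) z) (innerC (hS _ Sg) z) !inner0l.
    by rewrite rmorph0 mulr0.
  rewrite Ulin; [|exact: hS|exact: sL2].
  rewrite !inner_linr//; do ?[exact: hS|exact: US|exact: UL2|exact: sL2].
  by rewrite IH Uin//; ring.
have H2 g h : cspan S g -> cspan S h -> inner mu (U g) (U h) = (c ^+ 2)%:C * inner mu g h.
  move=> + sh; elim => [|a g1 g2 Sg1 sg2 IH]; first by rewrite U0 !inner0l mulr0.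
  rewrite Ulin; [|exact: hS|exact: sL2].
  rewrite !inner_linl//; do ?[exact: hS|exact: US|exact: UL2|exact: sL2].
  by rewrite IH H1//; ring.
exact: H2.
Qed.

End Inner.

(** * The truncated Fourier transform *)

Section FourierTransform.
Context {d : measure_display} {T : measurableType d} {R : realType}.
Variable mu : {measure set T -> \bar R}.
Implicit Types (f g h : T -> R[i]).

(** Fourier transforms and propagators are known through their graphs, with values determined up to
    null functions. [iso_ae] says that the relation lives on classes; [iso_lin] and [iso_N] make the
    class of the value unique. Totality is a separate matter. *)
Record isometric_relation (c : R) (E : (T -> R[i]) -> (T -> R[i]) -> Prop) : Prop := {
  iso_l : forall f g, E f g -> inL2 mu f;
  iso_r : forall f g, E f g -> inL2 mu g;
  iso_lin : forall a f g f' g', E f g -> E f' g' ->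
    E (fun x => a * f x + f' x) (fun x => a * g x + g' x);
  iso_N : forall f g, E f g -> N mu g = c * N mu f;
  iso_ae : forall f g f' g', E f g -> inL2 mu f' -> inL2 mu g' ->
    N mu (fun x => f x - f' x) = 0 -> N mu (fun x => g x - g' x) = 0 -> E f' g' }.

Variable dot : T -> T -> R.
Hypothesis mdot : forall xi, measurable_fun [set: T] (dot^~ xi).

(** The truncated character [e^{i <x, xi>}]. Conjugation in [inner] produces the sign of the
    transform, so [trf] is the pairing with this L2 function. *)
Definition wave (D : set T) xi x : R[i] := (\1_D x : R)%:C * cis (dot x xi).

Definition trf (D : set T) f xi : R[i] :=
  cintegral mu D (fun x => cis (- dot x xi) * f x).

Lemma inL2_indic D : measurable D -> (mu D < +oo)%E -> inL2 mu (fun x => (\1_D x : R)%:C).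
Proof.
move=> mD fD; apply: (inL2_dom (g := \1_D)).
- by apply: cmeas_real; exact: measurable_indic.
- apply/integrableP; split; first by apply/measurable_EFinP; exact: measurable_indic.
  rewrite (eq_integral (fun x => (\1_D x)%:E)) ?integral_indic ?setIT//.
  by move=> x _ /=; rewrite ger0_norm.
- by move=> x; rewrite sqn_real indicE; case: (_ \in _); rewrite ?expr1n ?expr0n.
Qed.

Lemma inL2_wave D xi : measurable D -> (mu D < +oo)%E -> inL2 mu (wave D xi).
Proof.
move=> mD fD; rewrite /wave; under eq_fun do rewrite mulrC.
apply: (inL2M (C := 1)); last exact: inL2_indic.
- by apply: cmeas_cis.
- by move=> x; rewrite sqn_cis.
Qed.

Lemma trf_inner D f xi : trf D f xi = inner mu f (wave D xi).
Proof.
rewrite innerE /trf /cintegral /rdot; congr (_ +i* _); rewrite Rintegral_mkcond;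
  apply: eq_Rintegral => x _; rewrite /wave patchE indicE; case: (_ \in _);
  rewrite -?[point]/(0 : R) !reimE /= ?cosN ?sinN; ring.
Qed.

Variable D : set T.
Hypothesis mD : measurable D.
Hypothesis muD : (mu D < +oo)%E.

Let wL2 xi := inL2_wave xi mD muD.

Lemma trf_lin a f g xi : inL2 mu f -> inL2 mu g ->
  trf D (fun x => a * f x + g x) xi = a * trf D f xi + trf D g xi.
Proof. by move=> hf hg; rewrite !trf_inner inner_linl. Qed.

Lemma trfB f g xi : inL2 mu f -> inL2 mu g ->
  trf D (fun x => f x - g x) xi = trf D f xi - trf D g xi.
Proof. by move=> hf hg; rewrite !trf_inner inner_linBl. Qed.

Lemma trf_indic A f xi : D `<=` A -> trf D (fun x => (\1_A x : R)%:C * f x) xi = trf D f xi.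
Proof.
move=> DA; rewrite /trf /cintegral; congr (_ +i* _); apply: eq_Rintegral => x;
  by rewrite inE => /DA Ax; rewrite indicE mem_set// mul1r.
Qed.

Lemma trf_sub A f xi : measurable A -> A `<=` D ->
  trf D (fun x => (\1_A x : R)%:C * f x) xi = trf A f xi.
Proof.
move=> mA AD; rewrite !trf_inner !innerE /rdot; congr (_ +i* _); apply: eq_Rintegral => x _;
  rewrite /wave !indicE !reimE /=; have [Ax|Ax] := pselect (A x);
  rewrite ?(mem_set Ax) ?(memNset Ax) ?(mem_set (AD _ Ax)) /=; ring.
Qed.

(** Pairing with the fixed L2 function [wave] is continuous. Convergence thus holds at every [xi],
    which is what Fatou's lemma needs in [plancherel_dense]. *)
Lemma trf_cvg (h : nat -> T -> R[i]) f xi : (forall k, inL2 mu (h k)) -> inL2 mu f ->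
  (fun k => N mu (fun x => h k x - f x)) @ \oo --> 0 ->
  ccvg (fun k => trf D (h k) xi) (trf D f xi).
Proof.
move=> hh hf H.
have key (w : T -> R[i]) : inL2 mu w -> (fun k => rdot mu (h k) w) @ \oo --> rdot mu f w.
  move=> hw; apply/cvgrPdist_le => e e0.
  have w0 : 0 < N mu w + 1 by rewrite ltr_wpDl// N_ge0.
  move/cvgrPdist_le: H => /(_ _ (divr_gt0 e0 w0)); apply: filterS => k.
  rewrite sub0r normrN ger0_norm ?N_ge0// ler_pdivlMr// => He.
  have -> : rdot mu f w - rdot mu (h k) w = - rdot mu (fun x => h k x - f x) w.
    rewrite (_ : (fun x => _) = (fun x => (-1)%:C * f x + h k x)); last first.
      by apply/funext => x; apply: complexP; rewrite !reimE /=; ring.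
    rewrite rdotDl//; last exact: inL2Z.
    by rewrite rdotZl//; ring.
  rewrite normrN (le_trans (rdot_abs _ hw))//; first exact: inL2B.
  by rewrite (le_trans _ He)// ler_wpM2l ?N_ge0// lerDl.
rewrite trf_inner innerE (funext (fun k => etrans (trf_inner D (h k) xi) (innerE mu (h k) _))).
by split; apply: key; [exact: wL2|exact/inL2Z/wL2].
Qed.

Section PlancherelDense.
Variables (c : R) (V : (T -> R[i]) -> Prop).
Hypothesis c0 : 0 <= c.
Hypothesis V_L2 : forall f, V f -> inL2 mu f.
Hypothesis V_lin : forall a f g, V f -> V g -> V (fun x => a * f x + g x).
Hypothesis V_dense : forall f, inL2 mu f -> L2_closure mu V (fun x => (\1_D x : R)%:C * f x).
Hypothesis V_trf : forall f, V f -> inL2 mu (trf D f) /\ N mu (trf D f) = c * N mu f.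

(** The transforms of the approximants [v k] converge at every [xi], so Fatou's lemma puts
    [trf D g - trf D (v l)] in L2 with norm at most [2 c ep l]. The norm identity follows by letting
    [l] grow. *)
Lemma plancherel_dense f : inL2 mu f ->
  inL2 mu (trf D f) /\ N mu (trf D f) = c * N mu (fun x => (\1_D x : R)%:C * f x).
Proof.
move=> hf; pose g x : R[i] := (\1_D x : R)%:C * f x.
have tg : trf D f = trf D g.
  by apply/funext => xi; rewrite trf_indic.
rewrite -/g tg; have [hg Hg] := V_dense hf; rewrite -/g in hg Hg.
pose ep k : R := k.+1%:R^-1.
have e0 k : 0 < ep k by rewrite invr_gt0.
have /choice[v Hv] k : exists v, V v /\ N mu (fun x => g x - v x) <= ep k.
  by have [v Vv Nv] := Hg _ (e0 k); exists v.
have hv k : inL2 mu (v k) := V_L2 (Hv k).1.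
have VB f1 f2 : V f1 -> V f2 -> V (fun x => f1 x - f2 x).
  move=> h1 h2; have := V_lin (-1) h2 h1.
  by congr V; apply/funext => x; rewrite mulN1r addrC.
have e_dec k l : (l <= k)%N -> ep k <= ep l.
  by move=> lk; rewrite /ep lef_pV2 ?posrE ?ltr0n// ler_nat.
have F l : inL2 mu (fun xi => trf D g xi - trf D (v l) xi) /\
    N mu (fun xi => trf D g xi - trf D (v l) xi) <= c * (2 * ep l).
  apply: (@N_fatou _ _ _ _ (fun k xi => trf D (v k) xi - trf D (v l) xi)).
  - by move=> k; apply: inL2B; exact: (V_trf (Hv _).1).1.
  - by rewrite !mulr_ge0// ltW.
  - move=> xi; apply: ccvgD; last exact: ccvg_cst.
    apply: trf_cvg => //; apply/cvgrPdist_le => e e_gt0.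
    have [n _ Hn] := (cvgrPdist_le _ _).1 (@cvg_harmonic R) _ e_gt0.
    exists n => // k /Hn /=; rewrite !sub0r !normrN !ger0_norm ?N_ge0//.
    by apply: le_trans; rewrite NBC; exact: (Hv k).2.
  - exists l => // k /= lk.
    rewrite -[leLHS](@eqN _ _ _ _ (trf D (fun x => v k x - v l x))); last first.
      by move=> xi; rewrite trfB.
    rewrite (V_trf (VB _ _ (Hv k).1 (Hv l).1)).2 ler_wpM2l//.
    rewrite (le_trans (@N_split _ _ _ mu g _ _ _ _ _))//.
    rewrite NBC; have := (Hv k).2; have := (Hv l).2; have := e_dec _ _ lk; lra.
have hl l : inL2 mu (trf D (v l)) := (V_trf (Hv l).1).1.
have htg : inL2 mu (trf D g).
  have := inL2D (F 0%N).1 (hl 0%N).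
  by congr inL2; apply/funext => x; rewrite subrK.
split => //; apply/eqP; rewrite -subr_eq0 -normr_le0; apply/ler_addgt0Pl => e e_gt0.
(* The factor [3 c] adds the error [2 c ep] of the transforms to the error [c ep] between the norms
   of [g] and [v n]; the [+ 1] keeps the divisor positive. *)
have [n _ /(_ n (leqnn n))] := (cvgrPdist_le _ _).1 (@cvg_harmonic R) _
  (divr_gt0 e_gt0 (ltr_wpDl (mulr_ge0 (ler0n R 3) c0) ltr01)).
rewrite /= sub0r normrN ger0_norm// -/(ep n) ler_pdivlMr; last by rewrite ltr_wpDl ?mulr_ge0.
move=> He.
rewrite addr0 (le_trans _ He)//.
have := N_lip htg (hl n); have := N_lip (hl n) htg.
rewrite NBC (V_trf (Hv n).1).2 => l1 l2; have := (F n).2.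
have n1 : c * N mu g <= c * (N mu (v n) + ep n).
  by rewrite ler_wpM2l// (le_trans (N_lip hg (hv n)))// lerD2l (Hv n).2.
have n2 : c * N mu (v n) <= c * (N mu g + ep n).
  by rewrite ler_wpM2l// (le_trans (N_lip (hv n) hg))// lerD2l NBC (Hv n).2.
have := e0 n.
move=> p0 Fn; clear -l1 l2 Fn n1 n2 p0 He; rewrite ler_norml; apply/andP; split; nra.
Qed.

End PlancherelDense.
End FourierTransform.

(** * The Fourier transform as an L2 limit over boxes *)

Section FourierRelation.
Context {d : measure_display} {T : measurableType d} {R : realType}.
Variable mu : {measure set T -> \bar R}.
Implicit Types (f g h : T -> R[i]).

Lemma norm2_cvg0 {U : Type} (F : set_system U) (FF : Filter F) (h : U -> T -> R[i]) :
  (\forall u \near F, inL2 mu (h u)) ->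
  (norm2 mu (h u) @[u --> F] --> 0%E) <-> ((fun u => N mu (h u)) @ F --> 0).
Proof.
move=> hh; split => H.
- have /fine_cvgP[_] := H; apply: cvg_trans; apply: near_eq_cvg.
  by apply: filterS hh => u hu /=; rewrite norm2_N.
- apply/fine_cvgP; split; first by apply: filterS hh => u hu; rewrite norm2_N.
  apply: cvg_trans H; apply: near_eq_cvg.
  by apply: filterS hh => u hu /=; rewrite norm2_N.
Qed.

Variable dot : T -> T -> R.
Hypothesis mdot : forall xi, measurable_fun [set: T] (dot^~ xi).
Variable box : nat -> set T.
Hypothesis mbox : forall n, measurable (box n).
Hypothesis fbox : forall n, (mu (box n) < +oo)%E.
Hypothesis box_nested : forall m n, (m <= n)%N -> box m `<=` box n.
Hypothesis box_cover : forall x, exists n, box n x.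
Variable c : R.
Hypothesis c0 : 0 <= c.
Hypothesis plancherel : forall n f, inL2 mu f -> inL2 mu (trf mu dot (box n) f) /\
  N mu (trf mu dot (box n) f) = c * N mu (fun x => (\1_(box n) x : R)%:C * f x).

Local Notation tr n f := (trf mu dot (box n) f).
Local Notation fourier := (is_fourier mu dot box).

Lemma box_cvg f : inL2 mu f ->
  (fun n => N mu (fun x => (\1_(box n) x : R)%:C * f x - f x)) @ \oo --> 0.
Proof.
move=> hf; under eq_fun do (under eq_fun do rewrite -[X in _ - X]mul1r -mulrBl).
apply: (@N_mul_cvg0 _ _ _ _ _ _ 1) => //.
- move=> k; apply: cmeasD; last exact: cmeas_cst.
  by apply: cmeas_real; exact: measurable_indic.
- move=> k x; rewrite indicE /sqn; case: (_ \in _) => /=; lra.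
- move=> x; have [n bn] := box_cover x.
  suff : \forall k \near \oo, (\1_(box k) x : R)%:C - 1 = 0.
    by move=> H; split; apply: cvg_near_cst; apply: filterS H => k ->.
  exists n => // k /= nk; rewrite indicE mem_set ?subrr//.
  exact: box_nested bn.
Qed.

Lemma inL2_box n f : inL2 mu f -> inL2 mu (fun x => (\1_(box n) x : R)%:C * f x).
Proof.
apply: (inL2M (C := 1)); last by move=> x; exact: sqn_indic.
by apply: cmeas_real; exact: measurable_indic.
Qed.

Lemma box_le n f : inL2 mu f -> N mu (fun x => (\1_(box n) x : R)%:C * f x) <= N mu f.
Proof.
move=> hf; rewrite -[leRHS]mul1r; apply: N_mul_le => //.
  by apply: cmeas_real; exact: measurable_indic.
by move=> x; rewrite expr1n; exact: sqn_indic.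
Qed.

Lemma fourierP f fh : fourier f fh <->
  [/\ inL2 mu f, inL2 mu fh & (fun n => N mu (fun xi => tr n f xi - fh xi)) @ \oo --> 0].
Proof.
have hn : inL2 mu f -> inL2 mu fh ->
    \forall n \near \oo, inL2 mu (fun xi => tr n f xi - fh xi).
  by move=> hf hfh; apply: nearW => n; apply: inL2B => //; exact: (plancherel n hf).1.
by split=> -[hf hfh H]; split => //; apply/(norm2_cvg0 _ (hn hf hfh)).
Qed.

Lemma cvg0_le (u v : nat -> R) : (forall n, 0 <= u n) -> (forall n, u n <= v n) ->
  v @ \oo --> 0 -> u @ \oo --> 0.
Proof.
move=> u0 uv v0; apply: (squeeze_cvgr (f := fun=> 0) (h := v)) => //; last exact: cvg_cst.
by apply: nearW => n; rewrite u0 uv.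
Qed.

Lemma fourier_N f fh : fourier f fh -> N mu fh = c * N mu f.
Proof.
move=> /fourierP[hf hfh H].
have ht n := (plancherel n hf).1; have hb n := inL2_box n hf.
have H2 : (fun n => N mu (fun xi => tr n f xi - fh xi) +
    c * N mu (fun x => (\1_(box n) x : R)%:C * f x - f x)) @ \oo --> 0.
  rewrite -[X in _ --> X](addr0 0); apply: cvgD => //.
  by rewrite -(mulr0 c); apply: cvgMl_tmp; exact: box_cvg.
have H3 : (fun n : nat => `|N mu fh - c * N mu f|) @ \oo --> 0.
  apply: cvg0_le H2 => n //.
  have a1 := N_lip hfh (ht n); have a2 := N_lip (ht n) hfh.
  rewrite NBC (plancherel n hf).2 in a1.
  rewrite (plancherel n hf).2 in a2.
  have b1 := ler_wpM2l c0 (N_lip hf (hb n)); have b2 := ler_wpM2l c0 (N_lip (hb n) hf).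
  rewrite NBC in b1.
  clear -a1 a2 b1 b2; rewrite ler_norml; apply/andP; split; lra.
have := cvg_unique _ H3 (cvg_cst _) => /(_ (@Rhausdorff R)) e.
by apply/eqP; rewrite -subr_eq0 -normr_eq0; rewrite -e.
Qed.

(** For [m <= n] the difference of the transforms over [box m] and [box n] is the transform over
    [box n] of [1_(box m) f - f]. Plancherel bounds it by a tail of [f], so the sequence is
    Cauchy. *)
Lemma fourier_total f : inL2 mu f -> exists fh, fourier f fh.
Proof.
move=> hf.
have ht n := (plancherel n hf).1; have hb n := inL2_box n hf.
have step m n : (m <= n)%N -> N mu (fun xi => tr m f xi - tr n f xi) <=
    c * N mu (fun x => (\1_(box m) x : R)%:C * f x - f x).
  move=> mn; rewrite -[leLHS](@eqN _ _ _ _ (tr n (fun x => (\1_(box m) x : R)%:C * f x - f x))).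
    rewrite (plancherel n _).2; last exact: inL2B.
    rewrite ler_wpM2l//; apply: box_le; exact: inL2B.
  move=> xi; rewrite trfB// trf_sub//; exact: box_nested.
have [fh [hfh H]] : exists g, inL2 mu g /\ (fun k => N mu (fun x => tr k f x - g x)) @ \oo --> 0.
  apply: L2_complete => // e e0.
  have : (fun n => c * N mu (fun x => (\1_(box n) x : R)%:C * f x - f x)) @ \oo --> 0.
    by rewrite -(mulr0 c); apply: cvgMl_tmp; exact: box_cvg.
  move=> /cvgrPdist_le/(_ _ e0)[n0 _ Hn0]; exists n0 => m n.
  have le0 (x : R) : `|0 - x| <= e -> x <= e.
    by rewrite sub0r normrN; apply: le_trans; exact: ler_norm.
  move=> /Hn0 /le0 Hm /Hn0 /le0 Hn.
  have [mn|/ltnW nm] := leqP m n; first exact: le_trans (step _ _ mn) Hm.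
  by rewrite NBC; exact: le_trans (step _ _ nm) Hn.
by exists fh; apply/fourierP.
Qed.

Lemma isometric_fourier : isometric_relation mu c fourier.
Proof.
split.
- by move=> f g [].
- by move=> f g [].
- move=> a f g f' g' /fourierP[hf hg H] /fourierP[hf' hg' H']; apply/fourierP; split.
  + exact: inL2D (inL2Z _ hf) hf'.
  + exact: inL2D (inL2Z _ hg) hg'.
  + have ht n := inL2B (plancherel n hf).1 hg.
    have ht' n := inL2B (plancherel n hf').1 hg'.
    apply: (@cvg0_le _ (fun n => Num.sqrt (sqn a) * N mu (fun xi => tr n f xi - g xi) +
        N mu (fun xi => tr n f' xi - g' xi))).
    * by move=> n; exact: N_ge0.
    * move=> n; rewrite -NZ//.
      rewrite -[leLHS](@eqN _ _ _ _ (fun x => a * (tr n f x - g x) + (tr n f' x - g' x))).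
        by apply: N_triangle => //; exact: inL2Z.
      by move=> x; rewrite trf_lin//; ring.
    * rewrite -[X in _ --> X](addr0 0); apply: cvgD => //.
      by rewrite -[X in _ --> X](mulr0 (Num.sqrt (sqn a))); apply: cvgMl_tmp.
- exact: fourier_N.
- move=> f g f' g' /fourierP[hf hg H] hf' hg' ff' gg'; apply/fourierP; split => //.
  apply: cvg0_le H => n; first exact: N_ge0.
  have ht := (plancherel n hf).1; have ht' := (plancherel n hf').1.
  have e0 : N mu (fun xi => tr n f' xi - tr n f xi) = 0.
    rewrite -[LHS](@eqN _ _ _ _ (tr n (fun x => f' x - f x))); last by move=> x; rewrite trfB.
    rewrite (plancherel n _).2; last exact: inL2B.
    apply/eqP; rewrite mulf_eq0; apply/orP; right; rewrite eq_le N_ge0 andbT.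
    by have := box_le n (inL2B hf' hf); rewrite [leRHS]NBC ff'.
  rewrite (le_trans (@N_split _ _ _ mu (tr n f) _ _ _ _ _))// e0 add0r.
  by rewrite (le_trans (@N_split _ _ _ mu g _ _ _ _ _))// gg' addr0.
Qed.

End FourierRelation.

(** * Calculus of isometric relations *)

Section Isometric.
Context {d : measure_display} {T : measurableType d} {R : realType}.
Variable mu : {measure set T -> \bar R}.
Variables (c : R) (E : (T -> R[i]) -> (T -> R[i]) -> Prop).
Hypothesis isoE : isometric_relation mu c E.

Lemma isoB f g f' g' : E f g -> E f' g' -> E (fun x => f x - f' x) (fun x => g x - g' x).
Proof.
move=> h h'; have := iso_lin isoE (-1) h' h.
by congr E; apply/funext => x; rewrite mulN1r addrC.
Qed.

Lemma iso_NB f g f' g' : E f g -> E f' g' ->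
  N mu (fun x => g x - g' x) = c * N mu (fun x => f x - f' x).
Proof. by move=> h h'; have := iso_N isoE (isoB h h'). Qed.

Lemma isoD f g f' g' : E f g -> E f' g' -> E (fun x => f x + f' x) (fun x => g x + g' x).
Proof.
move=> h h'; have := iso_lin isoE 1 h h'.
by congr E; apply/funext => x; rewrite mul1r.
Qed.

Lemma iso0 f g : E f g -> E (fun=> 0) (fun=> 0).
Proof. by move=> h; have := isoB h h; congr E; apply/funext => x; rewrite subrr. Qed.

Lemma isoZ a f g : E f g -> E (fun x => a * f x) (fun x => a * g x).
Proof.
move=> h; have := iso_lin isoE a h (iso0 h).
by congr E; apply/funext => x; rewrite addr0.
Qed.

Lemma iso_sum n (F G : nat -> T -> R[i]) : E (fun=> 0) (fun=> 0) ->
  (forall k, (k < n)%N -> E (F k) (G k)) ->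
  E (fun x => \sum_(k < n) F k x) (fun x => \sum_(k < n) G k x).
Proof.
move=> E0; elim: n => [|n IH] H.
  by under eq_fun do rewrite big_ord0; under [X in E _ X]eq_fun do rewrite big_ord0.
under eq_fun do rewrite big_ord_recr /=.
under [X in E _ X]eq_fun do rewrite big_ord_recr /=.
by apply: isoD; [apply: IH => k /ltnW /H|exact: H].
Qed.

Hypothesis c0 : 0 < c.
Variable m : T -> R[i].
Hypothesis m1 : forall x, sqn (m x) = 1.

(** A unimodular multiplication conjugated by the transform: the factor [c] enters once on each side
    and cancels. The free propagators are of this form. *)
Lemma isometric_multiplier :
  isometric_relation mu 1 (fun f g => exists2 fh, E f fh & E g (fun x => m x * fh x)).
Proof.
split.
- by move=> f g [fh /(iso_l isoE)].
- by move=> f g [fh _ /(iso_l isoE)].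
- move=> a f g f' g' [fh h1 h2] [fh' h1' h2'].
  exists (fun x => a * fh x + fh' x); first exact: (iso_lin isoE).
  have := iso_lin isoE a h2 h2'; congr E; apply/funext => x; ring.
- move=> f g [fh /(iso_N isoE) h1 /(iso_N isoE) h2].
  rewrite mul1r; apply: (mulfI (lt0r_neq0 c0)); rewrite -h2 -h1.
  exact: NM_unit.
- move=> f g f' g' [fh h1 h2] hf' hg' n1 n2; exists fh.
    by apply: (iso_ae isoE h1) => //; [exact: iso_r isoE _ _ h1|rewrite -[LHS](@eqN _ _ _ _ (fun=> 0)) ?N0// => x; rewrite subrr].
  apply: (iso_ae isoE h2) => //; first exact: iso_r isoE _ _ h2.
  by rewrite -[LHS](@eqN _ _ _ _ (fun=> 0)) ?N0// => x; rewrite subrr.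
Qed.

End Isometric.

(** * The Dirichlet integral *)

Section Calculus.
Context {R : realType}.
Implicit Types (F f : R -> R) (a b c s x t l : R).
Local Notation mu := (@lebesgue_measure R).

Lemma is_derive_lin c x : is_derive x 1 (fun t => t * c) c.
Proof.
have := is_deriveM (is_derive_id x 1) (is_derive_cst c x 1).
by move=> /is_derive_eq; apply; rewrite /GRing.scale /= mulr0 add0r mulr1.
Qed.

Lemma is_derive_lin_comp f df c x :
  is_derive (x * c) 1 f df -> is_derive x 1 (fun t => f (t * c)) (df * c).
Proof. by move=> h; apply: (is_derive1_comp (g := fun t => t * c)) (is_derive_lin c x). Qed.

Lemma is_derive_add f g df dg x : is_derive x 1 f df -> is_derive x 1 g dg ->
  is_derive x 1 (fun t => f t + g t) (df + dg).
Proof. exact: is_deriveD. Qed.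

Lemma is_derive_mul f g df dg x : is_derive x 1 f df -> is_derive x 1 g dg ->
  is_derive x 1 (fun t => f t * g t) (f x * dg + g x * df).
Proof. exact: is_deriveM. Qed.

Lemma is_derive_mulr f df c x : is_derive x 1 f df ->
  is_derive x 1 (fun t => f t * c) (df * c).
Proof.
move=> h; have := is_deriveM h (is_derive_cst c x 1).
by move=> /is_derive_eq; apply; rewrite /GRing.scale /= mulr0 add0r mulrC.
Qed.

Lemma is_derive_continuous F f : (forall x, is_derive x 1 F (f x)) -> continuous F.
Proof. by move=> h x; apply/differentiable_continuous/derivable1_diffP; have [] := h x. Qed.

Lemma FTC F f a b : (forall x, is_derive x 1 F (f x)) -> continuous f -> a <= b ->
  Rintegral mu `[a, b] f = F b - F a.
Proof.
move=> dF cf; rewrite le_eqVlt => /orP[/eqP ->|ab].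
  by rewrite set_itv1 Rintegral_set1 subrr.
have cF := is_derive_continuous dF.
rewrite /Rintegral (@continuous_FTC2 _ f F)//.
- exact: continuous_subspaceT.
- split; first by move=> x _; have [] := dF x.
    by apply: cvg_at_right_filter; exact: cF.
  by apply: cvg_at_left_filter; exact: cF.
- by move=> x _; rewrite derive1E; have [] := dF x.
Qed.

Lemma FTC_infty F f a l : (forall x, is_derive x 1 F (f x)) -> continuous f ->
  (forall x, a <= x -> 0 <= f x) -> F x @[x --> +oo] --> l ->
  (\int[mu]_(x in `[a, +oo[) (f x)%:E = (l - F a)%:E)%E.
Proof.
move=> dF cf f0 Fl; have cF := is_derive_continuous dF.
rewrite (ge0_continuous_FTC2y f0 _ Fl) ?EFinB//.
- exact: continuous_subspaceT.
- by apply: cvg_at_right_filter; exact: cF.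
- by move=> x _; rewrite derive1E; have [] := dF x.
Qed.

Lemma cvgy_lin c : 0 < c -> (x * c) @[x --> +oo] --> +oo.
Proof.
move=> c0; apply/cvgryPge => A; near=> x.
by rewrite -ler_pdivrMr//; near: x; exact: nbhs_pinfty_ge.
Unshelve. all: by end_near. Qed.

Lemma cvgy_expRN s : 0 < s -> expR (- (x * s)) @[x --> +oo] --> 0.
Proof.
move=> s0; exact: (@cvg_comp _ _ _ (fun x => x * s) (fun y => expR (- y)) _ _ _
  (cvgy_lin s0) (@cvgr_expR R)).
Qed.

Lemma cvgy_bounded_expRN (g : R -> R) s C : 0 < s -> (forall x, `|g x| <= C) ->
  (g x * expR (- (x * s))) @[x --> +oo] --> 0.
Proof.
move=> s0 gC; have C0 : 0 <= C by apply: le_trans (gC 0).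
have H : (C * expR (- (x * s))) @[x --> +oo] --> 0.
  by rewrite -[X in _ --> X](mulr0 C); apply: cvgMl_tmp; exact: cvgy_expRN.
apply/norm_cvg0P; apply: (squeeze_cvgr (f := fun=> 0)) H; last exact: cvg_cst.
apply: nearW => x; rewrite normr_ge0 normrM (ger0_norm (expR_ge0 _)).
by rewrite ler_wpM2r ?expR_ge0.
Qed.

(** Half of the exponential absorbs the factor [x], by [y <= e ^ y] at [y = x s / 2]. *)
Lemma cvgy_mul_expRN s : 0 < s -> (x * expR (- (x * s))) @[x --> +oo] --> 0.
Proof.
move=> s0; have s2 : 0 < s / 2 by rewrite divr_gt0.
have H : ((2 / s) * expR (- (x * (s / 2)))) @[x --> +oo] --> 0.
  by rewrite -[X in _ --> X](mulr0 (2 / s)); apply: cvgMl_tmp; exact: cvgy_expRN.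
apply: (squeeze_cvgr (f := fun=> 0)) H; last exact: cvg_cst.
near=> x; have x0 : 0 <= x by near: x; exact: nbhs_pinfty_ge.
rewrite mulr_ge0 ?expR_ge0//=.
have -> : - (x * s) = - (x * (s / 2)) + - (x * (s / 2)) by field.
rewrite expRD mulrA ler_wpM2r ?expR_ge0//.
rewrite expRN -ler_pdivlMr ?invr_gt0 ?expR_gt0// invrK.
rewrite (le_trans (_ : x <= 2 / s * (x * (s / 2))))//.
  by rewrite le_eqVlt; apply/orP; left; apply/eqP; field; rewrite gt_eqF.
rewrite ler_wpM2l ?divr_ge0 ?ltW//.
by rewrite (lt_le_trans _ (expR_ge1Dx _))// ltrDr.
Unshelve. all: by end_near. Qed.

Lemma integral_laplace_id x : 0 < x ->
  (\int[mu]_(s in `[0%R, +oo[) (s * expR (- (s * x)))%:E = (x ^- 2)%:E)%E.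
Proof.
move=> x0; have xn0 : x != 0 by rewrite gt_eqF.
have dE s : is_derive s 1 (fun t => expR (- (t * x))) (- x * expR (- (s * x))).
  have -> : (fun t => expR (- (t * x))) = (fun t => expR (t * (- x))).
    by apply/funext => t; rewrite mulrN.
  have /is_derive_eq := is_derive_lin_comp (is_derive_expR (s * - x)).
  by apply; rewrite [LHS]mulrC [s * _]mulrN.
pose F s := (s * expR (- (s * x))) * (- x^-1) + expR (- (s * x)) * (- x ^- 2).
have dF s : is_derive s 1 F (s * expR (- (s * x))).
  have /is_derive_eq := is_derive_add
    (is_derive_mulr (- x^-1) (is_derive_mul (is_derive_id s 1) (dE s)))
    (is_derive_mulr (- x ^- 2) (dE s)).
  by apply; field.
rewrite (FTC_infty dF (l := 0)).
- by congr EFin; rewrite /F !mul0r oppr0 expR0; ring.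
- exact: (is_derive_continuous (fun s => is_derive_mul (is_derive_id s 1) (dE s))).
- by move=> s s0; rewrite mulr_ge0// expR_ge0.
- rewrite -[X in _ --> X](addr0 0); apply: cvgD.
    by rewrite -[X in _ --> X](mul0r (- x^-1)); apply: cvgMr_tmp; exact: cvgy_mul_expRN.
  by rewrite -[X in _ --> X](mul0r (- x ^- 2)); apply: cvgMr_tmp; exact: cvgy_expRN.
Qed.

Lemma integral_laplace_cos c s : 0 < s ->
  (\int[mu]_(x in `[0%R, +oo[) ((1 - cos (x * c)) * expR (- (x * s)))%:E =
   (c ^+ 2 / (s * (c ^+ 2 + s ^+ 2)))%:E)%E.
Proof.
move=> s0; have sn0 : s != 0 by rewrite gt_eqF.
have cs0 : c ^+ 2 + s ^+ 2 != 0 by rewrite gt_eqF// ltr_wpDl ?sqr_ge0// exprn_gt0.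
have dE x : is_derive x 1 (fun t => expR (- (t * s))) (- s * expR (- (x * s))).
  have -> : (fun t => expR (- (t * s))) = (fun t => expR (t * (- s))).
    by apply/funext => t; rewrite mulrN.
  have /is_derive_eq := is_derive_lin_comp (is_derive_expR (x * - s)).
  by apply; rewrite [LHS]mulrC [x * _]mulrN.
have dc x : is_derive x 1 (fun t => cos (t * c)) (- sin (x * c) * c).
  exact: (is_derive_lin_comp (is_derive_cos (x * c))).
have ds x : is_derive x 1 (fun t => sin (t * c)) (cos (x * c) * c).
  exact: (is_derive_lin_comp (is_derive_sin (x * c))).
pose K := (c ^+ 2 + s ^+ 2)^-1.
(* The trigonometric part comes from the real part of a primitive of [e^{- x (s - i c)}]. *)
pose G x := - s^-1 + (cos (x * c) * (s * K) + sin (x * c) * (- c * K)).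
pose F x := G x * expR (- (x * s)).
have dG x : is_derive x 1 G (0 + ((- sin (x * c) * c) * (s * K) + (cos (x * c) * c) * (- c * K))).
  exact: (is_derive_add (is_derive_cst (- s^-1) x 1)
    (is_derive_add (is_derive_mulr _ (dc x)) (is_derive_mulr _ (ds x)))).
have dF x : is_derive x 1 F ((1 - cos (x * c)) * expR (- (x * s))).
  have /is_derive_eq := is_derive_mul (dG x) (dE x).
  by apply; rewrite /G /K; field; rewrite sn0 cs0.
rewrite (FTC_infty dF (l := 0)).
- rewrite /F /G !mul0r oppr0 cos0 sin0 expR0; congr EFin; rewrite /K; field.
  by rewrite sn0 cs0.
- exact: (is_derive_continuous (fun x => is_derive_mul
    (is_derive_add (is_derive_cst (1 : R) x 1) (is_deriveN (dc x))) (dE x))).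
- by move=> x _; rewrite mulr_ge0 ?expR_ge0// subr_ge0 cos_le1.
- apply: (@cvgy_bounded_expRN _ _ (s^-1 + (`|s * K| + `|c * K|))) => // x.
  rewrite (le_trans (ler_normD _ _))// normrN ger0_norm ?invr_ge0 ?(ltW s0)//.
  rewrite lerD2l (le_trans (ler_normD _ _))// lerD// normrM.
    by rewrite ler_piMl// ler_norml cos_geN1 cos_le1.
  by rewrite mulNr normrN ler_piMl// ler_norml sin_geN1 sin_le1.
Qed.

Lemma integral_cauchy c : 0 < c ->
  (\int[mu]_(s in `[0%R, +oo[) (c ^+ 2 / (c ^+ 2 + s ^+ 2))%:E = (c * (pi / 2))%:E)%E.
Proof.
move=> c0; have cn0 : c != 0 by rewrite gt_eqF.
have n0 s : c ^+ 2 + s ^+ 2 != 0 by rewrite gt_eqF// ltr_wpDr ?sqr_ge0// exprn_gt0.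
have dF s : is_derive s 1 (fun s => atan (s * c^-1) * c) (c ^+ 2 / (c ^+ 2 + s ^+ 2)).
  have /is_derive_eq := is_derive_mulr c (is_derive_lin_comp (is_derive1_atan (s * c^-1))).
  by apply; field; rewrite n0 cn0.
rewrite (FTC_infty dF (l := pi / 2 * c)).
- by rewrite mul0r atan0 mul0r subr0 mulrC.
- move=> s; apply: cvgM; first exact: cvg_cst.
  apply: cvgV => //; apply: cvgD; first exact: cvg_cst.
  exact: exprn_continuous.
- by move=> s _; rewrite divr_ge0// ?addr_ge0 ?sqr_ge0.
- have ci : 0 < c^-1 by rewrite invr_gt0.
  by apply: cvgMr_tmp; exact: (@cvg_comp _ _ _ (fun x => x * c^-1) atan _ _ _
    (cvgy_lin ci) (@cvgy_atan R)).
Qed.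

End Calculus.

(** * Tonelli's theorem and the value of the integral *)

Section Dirichlet.
Context {R : realType}.
Implicit Types (c s x : R).
Local Notation mu := (@lebesgue_measure R).

Lemma integral_indicM (D : set R) (g : R -> R) :
  (\int[mu]_x (\1_D x * g x)%:E = \int[mu]_(x in D) (g x)%:E)%E.
Proof.
rewrite [RHS]integral_mkcond; apply: eq_integral => x _.
by rewrite patchE indicE; case: (_ \in _); rewrite ?mul1r ?mul0r.
Qed.

Lemma integral_even (g : R -> R) : measurable_fun [set: R] g -> (forall x, 0 <= g x) ->
  (forall x, g (- x) = g x) ->
  (\int[mu]_x (g x)%:E = 2%:E * \int[mu]_(x in `[0%R, +oo[) (g x)%:E)%E.
Proof.
move=> mg g0 ge; have mE : measurable_fun [set: R] (EFin \o g) by exact/measurable_EFinP.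
have E0 := ge0_integration_by_substitution0 mE (fun r => g0 r : (0 <= (g r)%:E)%E).
have U : [set: R] = `]-oo, 0%R]%classic `|` `]0%R, +oo[%classic.
  apply/seteqP; split => // x _ /=; rewrite !in_itv /= andbT.
  by case: (leP x 0) => ?; [left|right].
rewrite U ge0_integral_setU//=; first last.
- apply/disj_setPS => x /= []; rewrite !in_itv /= andbT => a b.
  by move: (le_lt_trans a b); rewrite ltxx.
- by move=> x _; rewrite lee_fin.
- by apply/measurable_funTS.
rewrite integral_itv_obnd_cbnd; last exact: measurable_funTS.
rewrite -[X in (X + _)%E]/(\int[mu]_(x in `]-oo, 0%R]) (g x)%:E)%E.
have <- : (\int[mu]_(x in `[0%R, +oo[) (g x)%:E = \int[mu]_(x in `]-oo, 0%R]) (g x)%:E)%E.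
  by rewrite [LHS]E0; apply: eq_integral => x _ /=; rewrite ge.
have -> : (2%:E = 1%:E + 1%:E :> \bar R)%E by rewrite -EFinD; congr EFin; ring.
by rewrite ge0_muleDl ?lee_fin// mul1e.
Qed.

Lemma measurable_cont (g : R -> R) : continuous g -> measurable_fun [set: R] g.
Proof. exact: continuous_measurable_fun. Qed.

Lemma measurable_cosM c : measurable_fun [set: R] (fun x => cos (x * c)).
Proof.
apply: (measurableT_comp (measurable_cont (@continuous_cos R))).
by apply: measurable_funM.
Qed.

Lemma measurable_funV_ge0 (h : R -> R) : measurable_fun [set: R] h ->
  (forall x, 0 <= h x) -> measurable_fun [set: R] (fun x => (h x)^-1).
Proof.
move=> mh h0; under eq_fun do rewrite -powR_inv1//.
exact: (measurableT_comp (measurable_powR _) mh).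
Qed.

(** Tonelli, with [x^-2] written as the integral of [s e^{-s x}] over [s > 0]. *)
Lemma integral_dirichlet_half c : 0 < c ->
  (\int[mu]_(x in `[0%R, +oo[) ((1 - cos (x * c)) * x ^- 2)%:E = (c * (pi / 2))%:E)%E.
Proof.
move=> c0.
(* [P] contains [0], where the integrand vanishes because [1 - cos 0 = 0]; [Q] omits [0] because the
   Laplace transform in [x] needs [s > 0]. *)
pose P : set R := `[0%R, +oo[%classic; pose Q : set R := `]0%R, +oo[%classic.
pose k (z : R * R) : R := (\1_P z.1 * (1 - cos (z.1 * c))) *
  (\1_Q z.2 * (z.2 * expR (- (z.2 * z.1)))).
have q0 s t : 0 <= \1_Q s * (s * expR t).
  rewrite indicE; case: (boolP (_ \in _)); rewrite ?mul0r// inE /Q /= in_itv/= andbT.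
  by move=> /ltW s0; rewrite mul1r mulr_ge0 ?expR_ge0.
have k0 z : (0 <= (k z)%:E)%E.
  by rewrite lee_fin /k mulr_ge0// mulr_ge0// subr_ge0 cos_le1.
have mP : measurable P by exact: measurable_itv.
have mQ : measurable Q by exact: measurable_itv.
have mk : measurable_fun [set: (R * R)%type] (EFin \o k).
  apply/measurable_EFinP; apply: measurable_funM; apply: measurable_funM.
  - exact: (measurableT_comp (measurable_indic mP) measurable_fst).
  - apply: measurable_funB => //.
    exact: (measurableT_comp (measurable_cosM c) measurable_fst).
  - exact: (measurableT_comp (measurable_indic mQ) measurable_snd).
  - apply: measurable_funM; first exact: measurable_snd.
    apply: measurableT_comp; first exact: measurable_expR.
    apply: measurableT_comp => //; apply: measurable_funM.
      exact: measurable_snd.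
    exact: measurable_fst.
have := @fubini_tonelli _ _ _ _ R mu mu _ mk k0.
have E1 x : (\int[mu]_s (EFin \o k) (x, s) = (\1_P x * ((1 - cos (x * c)) * x ^- 2))%:E)%E.
  rewrite /k /=.
  have [Px|nPx] := boolP (x \in P); last first.
    rewrite indicE (negbTE nPx); under eq_integral do rewrite !mul0r.
    by rewrite integral0 mul0r.
  rewrite indicE Px; have [x0|xn0] := eqVneq x 0.
    rewrite x0 mul0r cos0 subrr; under eq_integral do rewrite !mulr0 mul0r.
    by rewrite integral0 mul0r mulr0.
  have x0 : 0 < x by move: Px; rewrite inE /P /= in_itv/= andbT lt_def xn0.
  under eq_integral do rewrite EFinM.
  rewrite ge0_integralZl//; last 2 first.
  - apply/measurable_EFinP; apply: measurable_funM; first exact: measurable_indic.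
    apply: measurable_funM => //; apply: measurableT_comp => //.
    by apply: measurableT_comp => //; apply: measurable_funM.
  - by move=> s _; rewrite lee_fin.
  rewrite integral_indicM integral_itv_obnd_cbnd; last first.
    apply/measurable_EFinP; apply: measurable_funM => //; apply: measurableT_comp => //.
    by apply: measurableT_comp => //; apply: measurable_funM.
  by rewrite integral_laplace_id// -EFinM mulrA.
have E2 s : (\int[mu]_x (EFin \o k) (x, s) = (\1_Q s * (c ^+ 2 / (c ^+ 2 + s ^+ 2)))%:E)%E.
  rewrite /k /=.
  have [Qs|nQs] := boolP (s \in Q); last first.
    rewrite indicE (negbTE nQs); under eq_integral do rewrite mul0r mulr0.
    by rewrite integral0 mul0r.
  have s0 : 0 < s by move: Qs; rewrite inE /Q /= in_itv/= andbT.
  rewrite indicE Qs mul1r.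
  transitivity (\int[mu]_x (s%:E * (\1_P x * ((1 - cos (x * c)) * expR (- (x * s))))%:E))%E.
    by apply: eq_integral => x _; rewrite -EFinM (mulrC s x) mul1r; congr EFin; ring.
  rewrite ge0_integralZl//; last 2 first.
  - apply/measurable_EFinP; apply: measurable_funM; first exact: measurable_indic.
    apply: measurable_funM; first by apply: measurable_funB => //; exact: measurable_cosM.
    apply: measurableT_comp => //.
    by apply: measurableT_comp => //; apply: measurable_funM.
  - by rewrite lee_fin ltW.
  rewrite integral_indicM integral_laplace_cos// -EFinM; congr EFin.
  by field; rewrite (gt_eqF s0) gt_eqF// ltr_wpDr ?sqr_ge0// exprn_gt0.
under eq_integral do rewrite E1.
under [X in _ = X -> _]eq_integral do rewrite E2.
rewrite !integral_indicM => ->; rewrite integral_itv_obnd_cbnd ?integral_cauchy//.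
apply/measurable_EFinP; apply: measurable_funTS; apply: measurable_funM => //.
apply: measurable_funV_ge0 => [|x]; last by rewrite addr_ge0 ?sqr_ge0.
by apply: measurable_funD => //; exact: measurable_funX.
Qed.

Lemma integral_dirichlet c :
  (\int[mu]_x (2 * (1 - cos (x * c)) * x ^- 2)%:E = (2 * pi * `|c|)%:E)%E.
Proof.
have m (e : R) : measurable_fun [set: R] (fun x => (1 - cos (x * e)) * x ^- 2).
  apply: measurable_funM; first by apply: measurable_funB => //; exact: measurable_cosM.
  by apply: measurable_funV_ge0 => [|x]; [exact: measurable_funX|exact: sqr_ge0].
have [->|cn0] := eqVneq c 0.
  under eq_integral do rewrite mulr0 cos0 subrr mulr0 mul0r.
  by rewrite integral0 normr0 mulr0.
transitivity (\int[mu]_x (2%:E * ((1 - cos (x * `|c|)) * x ^- 2)%:E))%E.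
  apply: eq_integral => x _; rewrite -EFinM mulrA; congr ((2 * (1 - _) * _)%:E).
  by case: (ger0P c) => // _; rewrite mulrN cosN.
have p0 x : (0 <= ((1 - cos (x * `|c|)) * x ^- 2)%:E)%E.
  by rewrite lee_fin mulr_ge0 ?subr_ge0 ?cos_le1// invr_ge0 sqr_ge0.
rewrite ge0_integralZl//; [|by apply/measurable_EFinP; exact: m].
rewrite integral_even//; last by move=> x; rewrite mulNr cosN sqrrN.
rewrite integral_dirichlet_half ?normr_gt0// -!EFinM; congr EFin; by field.
Qed.

End Dirichlet.

(** * Plancherel in one variable *)

Section Plancherel1.
Context {R : realType}.
Implicit Types (a b c x t xi : R).
Local Notation mu := (leb R).
Local Notation dot := (fun x xi : R => x * xi).

Lemma leb_itv (i : interval R) : mu [set` i] =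
  (if (i.1 < i.2)%E then ((i.2 : \bar R) - i.1)%E else 0%E).
Proof. exact: lebesgue_measure_itv. Qed.

(** Reflection preserves Lebesgue measure. The lemma serves to kill the imaginary part of the inner
    products of the transforms of real step functions. *)
Lemma integral_odd (h : R -> R) : mu.-integrable [set: R] (EFin \o h) ->
  (forall x, h (- x) = - h x) -> Rintegral mu [set: R] h = 0.
Proof.
move=> ih oh.
have E : (\int[mu]_x (h x)%:E = \int[mu]_x (h (- x)%R)%:E)%E.
  have mN : measurable_fun [set: measurableTypeR R] (-%R : measurableTypeR R -> measurableTypeR R).
    exact: oppr_measurable.
  have mh : measurable_fun [set: measurableTypeR R] (EFin \o h) by case/integrableP: ih.
  have ihN : mu.-integrable ((-%R : measurableTypeR R -> measurableTypeR R) @^-1` setT)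
      ((EFin \o h) \o -%R).
    rewrite preimage_setT; move/integrableN: ih; apply: eq_integrable => //.
    by move=> x _ /=; rewrite oh.
  have := integral_pushforward mN mh ihN measurableT.
  rewrite preimage_setT => <-.
  by apply: eq_measure_integral => A mA _; exact/esym/lebesgue_measureN.
have : Rintegral mu [set: R] h = - Rintegral mu [set: R] h.
  rewrite {1}/Rintegral E -mulN1r -RintegralZl//; congr fine.
  by apply: eq_integral => x _; rewrite oh mulN1r.
lra.
Qed.

(** A primitive in [x] of [e^{-i x xi}]; at [xi = 0] the quotients are [0], so the
    value [x] has to be added. *)
Definition wave_primitive xi x : R[i] :=
  (sin (x * xi) / xi + x * (xi == 0)%:R) +i* ((cos (x * xi) - 1) / xi).

Lemma is_derive_wave_re xi x :
  is_derive x 1 (fun t => re (wave_primitive xi t)) (cos (x * xi)).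
Proof.
have /is_derive_eq := is_derive_add
  (is_derive_mulr xi^-1 (is_derive_lin_comp (is_derive_sin (x * xi))))
  (is_derive_lin ((xi == 0)%:R) x).
apply; have [->|x0] := eqVneq xi 0; first by rewrite !mulr0 mul0r add0r cos0.
by rewrite addr0 mulfK.
Qed.

Lemma is_derive_wave_im xi x :
  is_derive x 1 (fun t => im (wave_primitive xi t)) (- sin (x * xi)).
Proof.
have /is_derive_eq := is_derive_mulr xi^-1 (is_derive_add
  (is_derive_lin_comp (is_derive_cos (x * xi))) (is_derive_cst (-1 : R) x 1)).
apply; have [->|x0] := eqVneq xi 0; first by rewrite !mulr0 sin0 oppr0 addr0 mul0r.
by rewrite addr0 mulfK.
Qed.

Lemma measurable_inv : measurable_fun [set: R] (fun x : R => x^-1).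
Proof.
have -> : (fun x : R => x^-1) = (fun x : R => x * (x ^+ 2)^-1).
  apply/funext => x; have [->|x0] := eqVneq x 0; first by rewrite invr0 mul0r.
  by rewrite expr2 invfM mulrA mulfV// mul1r.
apply: measurable_funM => //; apply: measurable_funV_ge0 => [|x].
  exact: measurable_funX.
exact: sqr_ge0.
Qed.

Lemma cmeas_wave_primitive x : cmeas (wave_primitive^~ x).
Proof.
have m1 : measurable_fun [set: R] (fun xi => x * xi) by apply: measurable_funM.
have mc : measurable_fun [set: R] (fun xi => cos (x * xi)).
  exact: (measurableT_comp (measurable_cont (@continuous_cos R))).
have ms : measurable_fun [set: R] (fun xi => sin (x * xi)).
  exact: (measurableT_comp (measurable_cont (@continuous_sin R))).
split => /=.
  apply: measurable_funD; first exact: measurable_funM ms measurable_inv.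
  apply: measurable_funM => //.
  have -> : (fun xi : R => (xi == 0)%:R) = (\1_[set 0] : R -> R).
    apply/funext => xi; rewrite indicE; case: eqVneq => [->|/eqP H].
      by rewrite mem_set.
    by rewrite memNset.
  exact: measurable_indic.
apply: measurable_funM; last exact: measurable_inv.
by apply: measurable_funB.
Qed.

Variable r : R.
Hypothesis r0 : 0 <= r.
Let D : set R := `[- r, r]%classic.

(** All intervals start at [- r]: for end points in the window the inner product of two steps is
    [min a b + r], and their difference is, up to sign, the indicator of an interval of length
    [|a - b|]. These are the data that polarization needs. *)
Definition step a : R -> R[i] := fun x => (\1_(`]- r, a]%classic) x : R)%:C.

Definition steps (f : R -> R[i]) := exists2 a, - r <= a <= r & f = step a.

Lemma step_L2 a : inL2 mu (step a).
Proof.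
apply: inL2_indic; first exact: measurable_itv.
by rewrite leb_itv /=; case: ifP => // _; rewrite -EFinB ltry.
Qed.

Lemma trf_step a xi : - r <= a <= r ->
  trf mu dot D (step a) xi = wave_primitive xi a - wave_primitive xi (- r).
Proof.
move=> /andP[ra ar].
have key (F g : R -> R) : (forall x, is_derive x 1 F (g x)) -> continuous g ->
    Rintegral mu D (fun x => g x * \1_(`]- r, a]%classic) x) = F a - F (- r).
  move=> dF cg.
  have I : lebesgue_measure.-integrable `[- r, a]%classic (EFin \o g).
    apply: continuous_compact_integrable; first exact: segment_compact.
    exact: continuous_subspaceT.
  have I' : lebesgue_measure.-integrable `]- r, a]%classic (EFin \o g).
    apply: integrableS I => //.
    by move=> x /=; rewrite !in_itv /= => /andP[/ltW -> ->].
  have <- : Rintegral mu `]- r, a]%classic g = F a - F (- r).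
    by rewrite -(FTC dF cg ra); exact: Rintegral_itv_obnd_cbnd I'.
  rewrite [LHS]Rintegral_mkcond [RHS]Rintegral_mkcond; apply: eq_Rintegral => x _.
  rewrite !patchE indicE; case: (boolP (x \in `]- r, a]%classic)) => [xa|_]; last first.
    by rewrite mulr0 if_same.
  rewrite mulr1 mem_set//; move: xa; rewrite inE /D /= !in_itv /= => /andP[x1 x2].
  by rewrite ltW// (le_trans x2).
apply: complexP; rewrite /trf /cintegral !reimE /=.
  rewrite -(key _ _ (is_derive_wave_re xi)).
    by apply: eq_Rintegral => x _; rewrite cosN mulr0 subr0.
  exact: (is_derive_continuous (fun x => is_derive_lin_comp (is_derive_cos (x * xi)))).
rewrite -(key _ _ (is_derive_wave_im xi)).
  by apply: eq_Rintegral => x _; rewrite sinN mulr0 add0r.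
exact: (is_derive_continuous (fun x => is_deriveN (is_derive_lin_comp (is_derive_sin (x * xi))))).
Qed.

(** Away from [xi = 0] the squared modulus of the transform of an interval depends only on its
    length, and it is the integrand of the Dirichlet integral. *)
Lemma sqn_wave_primitiveB a b xi : xi != 0 ->
  sqn (wave_primitive xi a - wave_primitive xi b) = 2 * (1 - cos (xi * (a - b))) * xi ^- 2.
Proof.
move=> x0; rewrite /sqn !reimE /= (negbTE x0) !mulr0 !addr0.
rewrite (mulrBr xi a b) cosB (mulrC xi a) (mulrC xi b).
have := cos2Dsin2 (a * xi); have := cos2Dsin2 (b * xi).
move: (cos _) (sin _) (cos _) (sin _) => cb sb ca sa hb ha.
transitivity (((sa ^+ 2 + ca ^+ 2) + (sb ^+ 2 + cb ^+ 2) - 2 * (ca * cb + sa * sb)) * xi ^- 2).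
  by field.
by rewrite (addrC (sa ^+ 2)) (addrC (sb ^+ 2)) ha hb; congr (_ * _); ring.
Qed.

Lemma wave_primitive_N a b :
  inL2 mu (fun xi => wave_primitive xi a - wave_primitive xi b) /\
  N mu (fun xi => wave_primitive xi a - wave_primitive xi b) ^+ 2 = 2 * pi * `|a - b|.
Proof.
have mB : cmeas (fun xi => wave_primitive xi a - wave_primitive xi b).
  under eq_fun do rewrite -mulN1r.
  apply: cmeasD; first exact: cmeas_wave_primitive.
  by apply: cmeasM; [exact: cmeas_cst|exact: cmeas_wave_primitive].
have E : (\int[mu]_xi (sqn (wave_primitive xi a - wave_primitive xi b))%:E
    = (2 * pi * `|a - b|)%:E)%E.
  rewrite -integral_dirichlet; apply: ge0_ae_eq_integral => //.
  - by apply/measurable_EFinP; exact: (measurable_sqn mB).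
  - apply/measurable_EFinP; apply: measurable_funM.
      by apply: measurable_funM => //; apply: measurable_funB => //; exact: measurable_cosM.
    by apply: measurable_funV_ge0 => [|x]; [exact: measurable_funX|exact: sqr_ge0].
  - by move=> x _; rewrite lee_fin sqn_ge0.
  - move=> x _; rewrite lee_fin !mulr_ge0// ?subr_ge0 ?cos_le1//.
    by rewrite invr_ge0 sqr_ge0.
  (* At [xi = 0] the left side is [(a - b) ^ 2] and the right side is [0], so this point is put into
     the exceptional null set. *)
  - exists [set 0]; split; [exact: measurable_set1|exact: lebesgue_measure_set1|].
    move=> x /= nx; apply: contrapT => /eqP x0; apply: nx => _.
    by congr EFin; exact: sqn_wave_primitiveB.
have h : inL2 mu (fun xi => wave_primitive xi a - wave_primitive xi b).
  by apply: inL2_lty => //; rewrite E ltry.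
split => //; have := integral_sqn h; rewrite E => -[] ->.
by [].
Qed.

Lemma wave_primitive_opp xi x : wave_primitive (- xi) x = (wave_primitive xi x)^*%C.
Proof.
apply: complexP; rewrite !reimE /=; rewrite mulrN ?sinN ?cosN invrN ?mulrNN ?mulrN//.
by rewrite oppr_eq0.
Qed.

Lemma trf_stepB_N a b : - r <= a <= r -> - r <= b <= r ->
  N mu (fun xi => trf mu dot D (step a) xi - trf mu dot D (step b) xi) ^+ 2 =
  2 * pi * `|a - b|.
Proof.
move=> ha hb; rewrite -(wave_primitive_N a b).2; congr (_ ^+ 2); apply: eqN => xi.
by rewrite !trf_step// opprB addrA subrK.
Qed.

Lemma rdot_step a b : rdot mu (step a) (step b) =
  fine (mu (`]- r, a]%classic `&` `]- r, b]%classic)).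
Proof.
rewrite /rdot /Rintegral; congr fine.
transitivity (\int[mu]_x (\1_(`]- r, a]%classic `&` `]- r, b]%classic) x)%:E)%E; last first.
  rewrite integral_indic ?setIT//.
  by apply: measurableI; exact: measurable_itv.
by apply: eq_integral => x _; rewrite /step /= mulr0 addr0 indicI.
Qed.

Lemma rdot_step_le a b : - r <= a -> a <= b -> rdot mu (step a) (step b) = a + r.
Proof.
move=> ra ab; rewrite rdot_step.
have -> : `]- r, a]%classic `&` `]- r, b]%classic = `]- r, a]%classic.
  by apply/setIidPl => x /=; rewrite !in_itv /= => /andP[-> /le_trans -> //].
rewrite leb_itv /= lte_fin; case: ltP => [_|ar]; first by rewrite opprK.
have -> : a = - r by apply/eqP; rewrite eq_le ar ra.
by rewrite addNr.
Qed.

Lemma trf_step_L2 a : - r <= a <= r ->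
  inL2 mu (trf mu dot D (step a)) /\ N mu (trf mu dot D (step a)) ^+ 2 = 2 * pi * (a + r).
Proof.
move=> ha; rewrite (funext (fun xi => trf_step xi ha)).
have [h ->] := wave_primitive_N a (- r).
by split => //; rewrite opprK ger0_norm//; case/andP: ha => ha _; rewrite -lerBlDr sub0r.
Qed.

(** Polarization gives the real part: up to [2 pi], the squared norms [a + r], [b + r] and [|a - b|]
    combine to [min a b + r]. The imaginary part is the integral of an odd function, since the
    transform at [- xi] is the conjugate of that at [xi]. *)
Lemma inner_trf_step a b : - r <= a <= r -> - r <= b <= r ->
  inner mu (trf mu dot D (step a)) (trf mu dot D (step b)) =
  (Num.sqrt (2 * pi) ^+ 2)%:C * inner mu (step a) (step b).
Proof.
move=> ha hb; have [la na] := trf_step_L2 ha; have [lb nb] := trf_step_L2 hb.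
rewrite sqr_sqrtr ?mulr_ge0 ?pi_ge0// !innerE.
have i0 : rdot mu (step a) (fun x => 'i%C * step b x) = 0.
  rewrite /rdot /Rintegral -[RHS]/(fine 0%:E); congr fine.
  rewrite -[RHS](@integral0 _ _ _ mu setT); apply: eq_integral => x _.
  by congr EFin; rewrite /step !reimE /=; ring.
have odd0 : rdot mu (trf mu dot D (step a)) (fun x => 'i%C * trf mu dot D (step b) x) = 0.
  apply: integral_odd; first exact: integrable_rdot la (inL2Z _ lb).
  move=> xi; rewrite !trf_step// !wave_primitive_opp.
  move: (wave_primitive xi a) (wave_primitive xi b) (wave_primitive xi (- r)) => u v w.
  by rewrite !reimE /=; ring.
have re1 : rdot mu (trf mu dot D (step a)) (trf mu dot D (step b)) =
    2 * pi * rdot mu (step a) (step b).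
  have -> : rdot mu (trf mu dot D (step a)) (trf mu dot D (step b)) =
      (2 * pi * (a + r) + 2 * pi * (b + r) - 2 * pi * `|a - b|) / 2.
    by rewrite -na -nb -(trf_stepB_N ha hb); exact: (rdot_N la lb).
  case/andP: ha => ra ar; case/andP: hb => rb br.
  have [ab|/ltW ba] := leP a b.
    by rewrite (rdot_step_le ra ab) ler0_norm ?subr_le0//; field.
  by rewrite rdotC (rdot_step_le rb ba) ger0_norm ?subr_ge0//; field.
by rewrite i0 odd0 re1; apply: complexP; rewrite !reimE /=; ring.
Qed.

Lemma stepsI a : - r <= a <= r -> steps (step a).
Proof. by move=> ha; exists a. Qed.

Lemma steps_L2 f : steps f -> inL2 mu f.
Proof. by move=> [a _ ->]; exact: step_L2. Qed.

Lemma steps_dense f : inL2 mu f ->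
  L2_closure mu (cspan steps) (fun x => (\1_D x : R)%:C * f x).
Proof.
have V_L2 g : cspan steps g -> inL2 mu g by exact: (@cspan_L2 _ _ _ mu _ _ steps_L2).
have r_r : - r <= r <= r by rewrite lexx andbT; apply: le_trans r0; rewrite oppr_le0.
have mD : measurable D by exact: measurable_itv.
have fD : (mu D < +oo)%E.
  by rewrite /D leb_itv /=; case: ifP => // _; rewrite -EFinB ltry.
(* Clamping the end points to the window writes any half-open interval, cut to [D], as a difference
   of two steps, except at the point [- r]. *)
pose cl t := Num.max (- r) (Num.min t r).
have clr t : - r <= cl t <= r.
  by rewrite /cl le_max lexx ge_max /= ge_min lexx orbT andbT; case/andP: r_r.
(* Steps omit the left end [- r] of [D], a null set that the closure does not see. *)
have close (A : set R) g : measurable A -> cspan steps g ->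
    (forall x, x != - r -> (\1_A x * \1_D x : R)%:C = g x) ->
    L2_closure mu (cspan steps) (fun x => (\1_A x * \1_D x : R)%:C).
  move=> mA sg Ag.
  have hA : inL2 mu (fun x => (\1_A x * \1_D x : R)%:C).
    under eq_fun do rewrite rmorphM /=; apply: (inL2M (C := 1)).
    - by apply: cmeas_real; exact: measurable_indic.
    - by move=> x; exact: sqn_indic.
    - exact: inL2_indic.
  split => // e e0; exists g => //.
  have -> : N mu (fun x => (\1_A x * \1_D x : R)%:C - g x) = 0; last exact: ltW.
  apply/(ae_N0 hA (V_L2 _ sg)).
  exists [set - r]; split; [exact: measurable_set1|exact: lebesgue_measure_set1|].
  by move=> x /= nx; apply: contrapT => /eqP xr; apply: nx => _; exact: Ag.
have stepE a b : a <= b -> cspan steps (fun x => step (cl b) x - step (cl a) x).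
  move=> ab; have := cspan_lin (-1) (cspan_gen (stepsI (clr a)))
    (cspan_gen (stepsI (clr b))).
  by congr cspan; apply/funext => x; rewrite mulN1r addrC.
have clE t x : - r < x -> (x <= cl t) = (x <= t) && (x <= r).
  by move=> rx; rewrite /cl le_max (leNgt x) rx /= le_min.
have V_lin (a0 : R[i]) (g h : R -> R[i]) : cspan steps g -> cspan steps h ->
    cspan steps (fun x => a0 * g x + h x) by exact: cspan_lin.
have VG (A : set R) : ocitv A ->
    L2_closure mu (cspan steps) (fun x => (\1_A x * \1_D x : R)%:C).
  move=> [[a b] _ <-] /=.
  have [ab|ba] := leP a b; last first.
    apply: (close _ _ _ (cspan0 _)); first exact: measurable_itv.
    by move=> x _; rewrite set_itv_ge ?indic0 ?mul0r// bnd_simp -leNgt ltW.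
  apply: (close _ _ _ (stepE _ _ ab)); first exact: measurable_itv.
  move=> x xr; rewrite /step -rmorphB /=; congr (_%:C); rewrite !indicE /D.
  rewrite !mem_setE !in_itv /=; case: (ltgtP (- r) x) => [rx|xr'|e]; last by rewrite e eqxx in xr.
    rewrite !clE//; case: (leP x r) => xr2; rewrite ?andbT ?andbF ?mulr0 ?mulr1 ?subrr//.
    case: (ltP a x) => ax /=; last by rewrite (le_trans ax ab) subrr.
    by rewrite subr0.
  by rewrite mulr0 subrr.
have VD : L2_closure mu (cspan steps) (fun x => (\1_D x : R)%:C).
  have -> : (fun x => (\1_D x : R)%:C) = (fun x => (\1_[set: R] x * \1_D x : R)%:C).
    by apply/funext => x; rewrite indicT mul1r.
  apply: (close _ (step r) measurableT (cspan_gen (stepsI r_r))) => x xr.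
  rewrite indicT mul1r /step !indicE /D !mem_setE !in_itv /=.
  by case: (ltgtP (- r) x) => // e; rewrite e eqxx in xr.
move=> hf.
by refine (@L2_dense _ _ _ mu (cspan steps) V_L2 (cspan0 _) V_lin (@ocitv R) D mD _ (@ocitvI R) VG VD f hf).
Qed.

Lemma plancherel1 f : inL2 mu f -> inL2 mu (trf mu dot D f) /\
  N mu (trf mu dot D f) = Num.sqrt (2 * pi) * N mu (fun x => (\1_D x : R)%:C * f x).
Proof.
have mdot xi : measurable_fun [set: measurableTypeR R] (dot^~ xi).
  by apply: measurable_funM.
have mD : measurable D by exact: measurable_itv.
have fD : (mu D < +oo)%E.
  by rewrite /D leb_itv /=; case: ifP => // _; rewrite -EFinB ltry.
have V_L2 (g : R -> R[i]) : cspan steps g -> inL2 mu g.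
  by exact: (@cspan_L2 _ _ _ mu _ _ steps_L2).
have V_lin (a0 : R[i]) (g h : R -> R[i]) : cspan steps g -> cspan steps h ->
    cspan steps (fun x => a0 * g x + h x) by exact: cspan_lin.
have V_trf (g : R -> R[i]) : cspan steps g -> inL2 mu (trf mu dot D g) /\
    N mu (trf mu dot D g) = Num.sqrt (2 * pi) * N mu g.
  move: g; apply: (@cspan_isometry _ _ _ mu steps (trf mu dot D)).
  - exact: steps_L2.
  - exact: sqrtr_ge0.
  - by move=> a g h hg hh; apply/funext => xi; exact: (@trf_lin _ _ _ mu dot mdot D mD fD).
  - apply/funext => xi; have z := inL20 mu.
    have := @trf_lin _ _ _ mu dot mdot D mD fD (-1) _ _ xi z z.
    by under [X in trf _ _ _ X]eq_fun do rewrite mulr0 addr0; rewrite mulN1r addNr.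
  - by move=> _ [a ha ->]; exact: (trf_step_L2 ha).1.
  - by move=> _ _ [a ha ->] [b hb ->]; exact: inner_trf_step.
move=> hf; refine (@plancherel_dense _ _ _ mu dot mdot D mD fD _ (cspan steps)
  (sqrtr_ge0 _) V_L2 V_lin _ V_trf f hf).
exact: steps_dense.
Qed.

End Plancherel1.

(** * Tensors and Plancherel in two variables *)

Section Polarization.
Context {d : measure_display} {T : measurableType d} {R : realType}.
Variable mu : {measure set T -> \bar R}.

(** Polarization: the inner product is a combination of the squared norms of [u], [v], [u - v] and
    [u - i v]. *)
Lemma inner_of_N (c : R) (f g u v : T -> R[i]) :
  inL2 mu f -> inL2 mu g -> inL2 mu u -> inL2 mu v ->
  N mu u = c * N mu f -> N mu v = c * N mu g ->
  N mu (fun x => u x - v x) = c * N mu (fun x => f x - g x) ->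
  N mu (fun x => u x - 'i%C * v x) = c * N mu (fun x => f x - 'i%C * g x) ->
  inner mu u v = (c ^+ 2)%:C * inner mu f g.
Proof.
move=> hf hg hu hv Nu Nv Nuv Niuv.
have E1 : rdot mu u v = c ^+ 2 * rdot mu f g.
  by rewrite (rdot_N hu hv) (rdot_N hf hg) Nu Nv Nuv; field.
have E2 : rdot mu u (fun x => 'i%C * v x) = c ^+ 2 * rdot mu f (fun x => 'i%C * g x).
  rewrite (rdot_N hu (inL2Z 'i%C hv)) (rdot_N hf (inL2Z 'i%C hg)).
  by rewrite !Ni Nu Nv Niuv; field.
by rewrite !innerE E1 E2; apply: complexP; rewrite !reimE /=; ring.
Qed.

End Polarization.

Section Tensor.
Context {R : realType}.
Implicit Types (a b : R -> R[i]) (f g : R * R -> R[i]).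
Local Notation mu := (leb R).
Local Notation mu2 := (leb2 R).

Lemma tonelli_x (f : R * R -> \bar R) :
  measurable_fun [set: (measurableTypeR R * measurableTypeR R)%type] f ->
  (forall z, 0 <= f z)%E -> (\int[mu2]_z f z = \int[mu]_x \int[mu]_y f (x, y))%E.
Proof.
by move=> mf f0; exact: (@fubini_tonelli1 _ _ _ _ R (@lebesgue_measure R) (@lebesgue_measure R)).
Qed.

Lemma tonelli_y (f : R * R -> \bar R) :
  measurable_fun [set: (measurableTypeR R * measurableTypeR R)%type] f ->
  (forall z, 0 <= f z)%E -> (\int[mu2]_z f z = \int[mu]_y \int[mu]_x f (x, y))%E.
Proof.
move=> mf f0; apply: (etrans (tonelli_x mf f0)).
exact: (@fubini_tonelli _ _ _ _ R (@lebesgue_measure R) (@lebesgue_measure R)).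
Qed.

Lemma integral_prod (u v : R -> R) :
  mu.-integrable setT (EFin \o u) -> mu.-integrable setT (EFin \o v) ->
  mu2.-integrable setT (EFin \o (fun z => u z.1 * v z.2)) /\
  Rintegral mu2 setT (fun z => u z.1 * v z.2) = Rintegral mu setT u * Rintegral mu setT v.
Proof.
move=> iu iv.
have [/measurable_EFinP mu' _] := (integrableP _ _ _ iu).
have [/measurable_EFinP mv _] := (integrableP _ _ _ iv).
have mf : measurable_fun [set: (measurableTypeR R * measurableTypeR R)%type]
    (EFin \o (fun z => u z.1 * v z.2)).
  apply/measurable_EFinP; apply: measurable_funM.
    exact: (measurableT_comp mu' measurable_fst).
  exact: (measurableT_comp mv measurable_snd).
have [mau _] := integrableP _ _ _ (integrable_norm iu).
have [mav _] := integrableP _ _ _ (integrable_norm iv).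
have iau := integrable_norm iu. have iav := integrable_norm iv.
have I : mu2.-integrable setT (EFin \o (fun z => u z.1 * v z.2)).
  apply/integrableP; split => //.
  rewrite tonelli_x//; last exact: measurableT_comp.
  rewrite (_ : integral _ _ _ = (Rintegral mu setT (fun x => `|u x|) * Rintegral mu setT (fun x => `|v x|))%:E) ?ltry//.
  rewrite EFinM /Rintegral !fineK; [|exact: integrable_fin_num iav|exact: integrable_fin_num iau].
  rewrite -ge0_integralZr//; last by apply: integral_ge0 => x _; rewrite lee_fin.
  apply: eq_integral => x _; rewrite -ge0_integralZl//.
  by apply: eq_integral => y _ /=; rewrite normrM EFinM.
split => //; rewrite {1}/Rintegral.
have E : (\int[mu2]_z (EFin \o (fun z => (u z.1 * v z.2)%R)) z =
    \int[mu]_x \int[mu]_y (u x * v y)%:E)%E.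
  apply/esym; exact: (@integral12_prod_meas1 _ _ _ _ R (@lebesgue_measure R) (@lebesgue_measure R)).
rewrite E -RintegralZr//; congr fine; apply: eq_integral => x _.
rewrite EFinM /Rintegral fineK; last exact: integrable_fin_num iv.
by rewrite -integralZl.
Qed.

Definition tensor a b : R * R -> R[i] := fun z => a z.1 * b z.2.

Lemma cmeas_fst a : cmeas (a : measurableTypeR R -> R[i]) ->
  cmeas (fun z : measurableTypeR R * measurableTypeR R => a z.1).
Proof.
by move=> [m1 m2]; split; [exact: (measurableT_comp m1 measurable_fst)|
  exact: (measurableT_comp m2 measurable_fst)].
Qed.

Lemma cmeas_snd a : cmeas (a : measurableTypeR R -> R[i]) ->
  cmeas (fun z : measurableTypeR R * measurableTypeR R => a z.2).
Proof.
by move=> [m1 m2]; split; [exact: (measurableT_comp m1 measurable_snd)|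
  exact: (measurableT_comp m2 measurable_snd)].
Qed.

Lemma inL2_tensor a b : inL2 mu a -> inL2 mu b -> inL2 mu2 (tensor a b).
Proof.
move=> ha hb; have [I _] := integral_prod (integrable_sqn ha) (integrable_sqn hb).
apply: (inL2_dom _ I).
  apply: (@cmeasM _ _ _ (fun z => a z.1) (fun z => b z.2)).
    exact: cmeas_fst (inL2_cmeas ha).
  exact: cmeas_snd (inL2_cmeas hb).
by move=> z; rewrite sqnM.
Qed.

Lemma inner_tensor a b a' b' : inL2 mu a -> inL2 mu b -> inL2 mu a' -> inL2 mu b' ->
  inner mu2 (tensor a b) (tensor a' b') = inner mu a a' * inner mu b b'.
Proof.
move=> ha hb ha' hb'.
have ire (f g : R -> R[i]) : inL2 mu f -> inL2 mu g ->
    mu.-integrable setT (EFin \o (fun x => re (f x * (g x)^*%C))).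
  move=> hf hg; have := integrable_rdot hf hg; apply: eq_integrable => // x _ /=.
  by congr EFin; rewrite !reimE; ring.
have iim (f g : R -> R[i]) : inL2 mu f -> inL2 mu g ->
    mu.-integrable setT (EFin \o (fun x => im (f x * (g x)^*%C))).
  move=> hf hg; have := integrable_rdot hf (inL2Z 'i%C hg); apply: eq_integrable => // x _ /=.
  by congr EFin; rewrite !reimE /=; ring.
have [I1 E1] := integral_prod (ire _ _ ha ha') (ire _ _ hb hb').
have [I2 E2] := integral_prod (iim _ _ ha ha') (iim _ _ hb hb').
have [I3 E3] := integral_prod (ire _ _ ha ha') (iim _ _ hb hb').
have [I4 E4] := integral_prod (iim _ _ ha ha') (ire _ _ hb hb').
rewrite /inner /cintegral; apply: complexP; rewrite !reimE /=.
  rewrite -E1 -E2 -RintegralB//; apply: eq_Rintegral => z _.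
  by rewrite /tensor !reimE; ring.
rewrite -E3 -E4 -RintegralD//; apply: eq_Rintegral => z _.
by rewrite /tensor !reimE; ring.
Qed.

Lemma N_tensor a b : inL2 mu a -> inL2 mu b -> N mu2 (tensor a b) = N mu a * N mu b.
Proof.
move=> ha hb; have := inner_tensor ha hb ha hb.
rewrite !inner_N//; last exact: inL2_tensor.
rewrite -rmorphM /= -exprMn => /complexI /eqP.
by rewrite eqrXn2 ?mulr_ge0 ?N_ge0// => /eqP.
Qed.

(** The families are indexed by all of [nat] and cut at [n], which suits both the axiom of choice
    and concatenation. *)
Definition tens n (a b : nat -> R -> R[i]) : R * R -> R[i] :=
  fun z => \sum_(k < n) tensor (a k) (b k) z.

Lemma inL2_tens n (a b : nat -> R -> R[i]) : (forall k, inL2 mu (a k)) ->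
  (forall k, inL2 mu (b k)) -> inL2 mu2 (tens n a b).
Proof.
move=> ha hb; exact: (@inL2_sum _ _ _ mu2 n (fun k => tensor (a k) (b k))
  (fun k _ => inL2_tensor (ha k) (hb k))).
Qed.

Lemma inner_tens n (a b : nat -> R -> R[i]) m (a' b' : nat -> R -> R[i]) :
  (forall k, inL2 mu (a k)) -> (forall k, inL2 mu (b k)) ->
  (forall k, inL2 mu (a' k)) -> (forall k, inL2 mu (b' k)) ->
  inner mu2 (tens n a b) (tens m a' b') =
  \sum_(k < n) \sum_(l < m) inner mu (a k) (a' l) * inner mu (b k) (b' l).
Proof.
move=> ha hb ha' hb'.
have h := inL2_tens m ha' hb'.
rewrite (@inner_suml _ _ _ mu2 n (fun k => tensor (a k) (b k)))//; last first.
  by move=> k _; exact: inL2_tensor.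
apply: eq_bigr => k _.
rewrite (@inner_sumr _ _ _ mu2 m (fun k => tensor (a' k) (b' k)))//; last 2 first.
- by move=> l _; exact: inL2_tensor.
- exact: inL2_tensor.
by apply: eq_bigr => l _; rewrite inner_tensor.
Qed.

Definition tenss f := exists n (a b : nat -> R -> R[i]),
  [/\ forall k, inL2 mu (a k), forall k, inL2 mu (b k) & f = tens n a b].

Lemma tenss_L2 f : tenss f -> inL2 mu2 f.
Proof. by move=> [n [a [b [ha hb ->]]]]; exact: inL2_tens. Qed.

Lemma tenss0 : tenss (fun=> 0).
Proof.
exists 0%N, (fun=> fun=> 0), (fun=> fun=> 0); split; [by move=> k; exact: inL20..|].
by apply/funext => z; rewrite /tens big_ord0.
Qed.

Lemma tenss_lin (c : R[i]) f g : tenss f -> tenss g -> tenss (fun z => c * f z + g z).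
Proof.
move=> [n [a [b [ha hb ->]]]] [m [a' [b' [ha' hb' ->]]]].
exists (n + m)%N, (fun k => if (k < n)%N then (fun x => c * a k x) else a' (k - n)%N),
  (fun k => if (k < n)%N then b k else b' (k - n)%N); split.
- by move=> k; case: ifP => // _; exact: inL2Z.
- by move=> k; case: ifP.
- apply/funext => z; rewrite /tens big_split_ord /= mulr_sumr; congr (_ + _).
    by apply: eq_bigr => k _; rewrite ltn_ord /tensor mulrA.
  by apply: eq_bigr => k _; rewrite ltnNge leq_addr /= addKn.
Qed.


Definition box1 (r : R) : set R := `[- r, r]%classic.
Definition dot2 (z zeta : R * R) : R := z.1 * zeta.1 + z.2 * zeta.2.

Lemma box1_measurable r : measurable (box1 r : set (measurableTypeR R)).
Proof. exact: measurable_itv. Qed.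

Lemma box1_fin r : (mu (box1 r) < +oo)%E.
Proof. by rewrite /box1 leb_itv /=; case: ifP => // _; rewrite -EFinB ltry. Qed.

Lemma indic_setX {T1 T2 : Type} (A : set T1) (B : set T2) z :
  \1_(A `*` B) z = \1_A z.1 * \1_B z.2 :> R.
Proof. by rewrite !indicE in_setX; case: (_ \in _); case: (_ \in _); rewrite ?mulr0 ?mulr1. Qed.

Lemma trf_tensor r a b zeta : inL2 mu a -> inL2 mu b ->
  trf mu2 dot2 (box1 r `*` box1 r) (tensor a b) zeta =
  trf mu (fun x xi => x * xi) (box1 r) a zeta.1 * trf mu (fun x xi => x * xi) (box1 r) b zeta.2.
Proof.
move=> ha hb; rewrite !trf_inner -inner_tensor//; last 2 first.
- apply: (@inL2_wave _ _ _ mu (fun x xi => x * xi)).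
  + by move=> xi; apply: measurable_funM.
  + exact: box1_measurable.
  + exact: box1_fin.
- apply: (@inL2_wave _ _ _ mu (fun x xi => x * xi)).
  + by move=> xi; apply: measurable_funM.
  + exact: box1_measurable.
  + exact: box1_fin.
congr inner; apply/funext => -[x y]; rewrite /tensor /wave /dot2 /= cisD.
rewrite indic_setX /=.
by rewrite rmorphM /=; ring.
Qed.


Lemma indicX_tensor (A B : set R) :
  (fun z : R * R => (\1_(A `*` B) z : R)%:C) =
  tensor (fun x => (\1_A x : R)%:C) (fun y => (\1_B y : R)%:C).
Proof. by apply/funext => z; rewrite indic_setX rmorphM. Qed.

Lemma inL2_indicI (A : set R) r : measurable (A : set (measurableTypeR R)) ->
  inL2 mu (fun x => (\1_(A `&` box1 r) x : R)%:C).
Proof.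
move=> mA; apply: inL2_indic.
  by apply: measurableI => //; exact: box1_measurable.
apply: le_lt_trans (box1_fin r); apply: le_measure; rewrite ?inE.
- by apply: measurableI => //; exact: box1_measurable.
- exact: box1_measurable.
- by apply: subIset; right.
Qed.

Lemma tenss1 a b : inL2 mu a -> inL2 mu b -> tenss (tensor a b).
Proof.
move=> ha hb; exists 1%N, (fun=> a), (fun=> b); split => //.
by apply/funext => z; rewrite /tens big_ord1.
Qed.

Definition box2 (r : R) : set (R * R) := box1 r `*` box1 r.

Lemma box2_measurable r : measurable (box2 r : set (measurableTypeR R * measurableTypeR R)).
Proof. by apply: measurableX; exact: box1_measurable. Qed.

Lemma box2_fin r : (mu2 (box2 r) < +oo)%E.
Proof.
have -> : mu2 (box2 r) = (mu (box1 r) * mu (box1 r))%E.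
  by apply: (@product_measure1E _ _ _ _ R (@lebesgue_measure R) (@lebesgue_measure R));
    exact: box1_measurable.
have := box1_fin r; have : (0 <= mu (box1 r))%E by [].
by case: (mu (box1 r)) => // s _ _; rewrite -EFinM ltry.
Qed.

(** Rectangles form a generating pi-system, and the indicator of a rectangle is a tensor. *)
Lemma tenss_dense r f : inL2 mu2 f ->
  L2_closure mu2 tenss (fun z => (\1_(box2 r) z : R)%:C * f z).
Proof.
move=> hf.
pose G := [set A `*` B | A in [set A | measurable (A : set (measurableTypeR R))]
  & B in [set B | measurable (B : set (measurableTypeR R))]].
have GI : setI_closed G.
  move=> X Y [X1 mX1 [X2 mX2 <-{X}]] [Y1 mY1 [Y2 mY2 <-{Y}]].
  exists (X1 `&` Y1); first exact: measurableI.
  by exists (X2 `&` Y2); [exact: measurableI|rewrite setXI].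
have GE : @measurable _ (measurableTypeR R * measurableTypeR R)%type = <<s G >>.
  exact: measurable_prod_measurableType.
have key (A B : set R) : measurable (A : set (measurableTypeR R)) ->
    measurable (B : set (measurableTypeR R)) ->
    L2_closure mu2 tenss (fun z => (\1_((A `&` box1 r) `*` (B `&` box1 r)) z : R)%:C).
  move=> mA mB; rewrite indicX_tensor; apply: (@V_closure _ _ _ mu2 tenss tenss_L2).
  by apply: tenss1; exact: inL2_indicI.
have VG A : G A -> L2_closure mu2 tenss (fun z => (\1_A z * \1_(box2 r) z : R)%:C).
  move=> [A1 mA1 [A2 mA2 <-]]; have := key _ _ mA1 mA2.
  by rewrite setXI; congr L2_closure; apply/funext => z; rewrite indicI.
have VD : L2_closure mu2 tenss (fun z => (\1_(box2 r) z : R)%:C).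
  by have := key setT setT measurableT measurableT; rewrite !setTI.
exact: (@L2_dense _ _ _ mu2 tenss tenss_L2 tenss0 tenss_lin G (box2 r)
  (box2_measurable r) GE GI VG VD f hf).
Qed.

Lemma measurable_dot2 zeta :
  measurable_fun [set: (measurableTypeR R * measurableTypeR R)%type] (dot2^~ zeta).
Proof. by apply: measurable_funD; apply: measurable_funM. Qed.

Lemma trf_tens r n (a b : nat -> R -> R[i]) :
  (forall k, inL2 mu (a k)) -> (forall k, inL2 mu (b k)) ->
  trf mu2 dot2 (box2 r) (tens n a b) =
  tens n (fun k => trf mu (fun x xi => x * xi) (box1 r) (a k))
    (fun k => trf mu (fun x xi => x * xi) (box1 r) (b k)).
Proof.
move=> ha hb; apply/funext => zeta; rewrite trf_inner.
have hw : inL2 mu2 (wave dot2 (box2 r) zeta).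
  by apply: inL2_wave; [exact: measurable_dot2|exact: box2_measurable|exact: box2_fin].
rewrite (@inner_suml _ _ _ mu2 n (fun k => tensor (a k) (b k)))//; last first.
  by move=> k _; exact: inL2_tensor.
by apply: eq_bigr => k _; rewrite -trf_inner trf_tensor.
Qed.

Lemma measurable_dot1 xi : measurable_fun [set: measurableTypeR R] (fun x : R => x * xi).
Proof. by apply: measurable_funM. Qed.

(** The norm of a sum of tensors is determined by the Gram matrices of its two families; scaling
    each by [c ^ 2] scales the squared norm by [c ^ 4]. *)
Lemma sum_isometry (U V : (R -> R[i]) -> R -> R[i]) (c : R) n (a b : nat -> R -> R[i]) :
  0 <= c ->
  (forall h, inL2 mu h -> inL2 mu (U h)) -> (forall h, inL2 mu h -> inL2 mu (V h)) ->
  (forall k l, inner mu (U (a k)) (U (a l)) = (c ^+ 2)%:C * inner mu (a k) (a l)) ->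
  (forall k l, inner mu (V (b k)) (V (b l)) = (c ^+ 2)%:C * inner mu (b k) (b l)) ->
  (forall k, inL2 mu (a k)) -> (forall k, inL2 mu (b k)) ->
  N mu2 (tens n (fun k => U (a k)) (fun k => V (b k))) = c ^+ 2 * N mu2 (tens n a b).
Proof.
move=> c0 hU hV iU iV ha hb.
have hUa k := hU _ (ha k); have hVb k := hV _ (hb k).
apply: N_eq_inner; [exact: inL2_tens|exact: inL2_tens|exact: sqr_ge0|].
rewrite !inner_tens// mulr_sumr; apply: eq_bigr => k _.
rewrite mulr_sumr; apply: eq_bigr => l _; rewrite iU iV.
by rewrite [in RHS]expr2 rmorphM /=; ring.
Qed.

Lemma inner_trf1 (r : R) a b : 0 <= r -> inL2 mu a -> inL2 mu b ->
  inner mu (trf mu (fun x xi => x * xi) (box1 r) a) (trf mu (fun x xi => x * xi) (box1 r) b) =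
  (Num.sqrt (2 * pi) ^+ 2)%:C *
    inner mu (fun x => (\1_(box1 r) x : R)%:C * a x) (fun x => (\1_(box1 r) x : R)%:C * b x).
Proof.
move=> r0 ha hb.
have hbox h : inL2 mu h -> inL2 mu (fun x => (\1_(box1 r) x : R)%:C * h x).
  apply: (inL2M (C := 1)); last by move=> x; exact: sqn_indic.
  by apply: cmeas_real; apply: measurable_indic; exact: box1_measurable.
have trB u v : inL2 mu u -> inL2 mu v ->
    N mu (fun xi => trf mu (fun x xi => x * xi) (box1 r) u xi -
      trf mu (fun x xi => x * xi) (box1 r) v xi) =
    Num.sqrt (2 * pi) * N mu (fun x => (\1_(box1 r) x : R)%:C * u x - (\1_(box1 r) x : R)%:C * v x).
  move=> hu hv; have [_ h] := plancherel1 r0 (inL2B hu hv).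
  apply: etrans; last first.
    apply: etrans; first exact: h.
    by congr (_ * _); apply: eqN => x; rewrite mulrBr.
  apply: eqN => xi; symmetry.
  exact: (@trfB _ _ _ mu _ measurable_dot1 _ (box1_measurable r) (box1_fin r)).
have trZ u xi : inL2 mu u -> trf mu (fun x xi => x * xi) (box1 r) (fun x => 'i%C * u x) xi =
    'i%C * trf mu (fun x xi => x * xi) (box1 r) u xi.
  move=> hu.
  have h0 : trf mu (fun x xi => x * xi) (box1 r) (fun=> 0) xi = 0 by rewrite trf_inner inner0l.
  have := @trf_lin _ _ _ mu _ measurable_dot1 _ (box1_measurable r) (box1_fin r) 'i%C u (fun=> 0) xi hu (inL20 mu).
  rewrite h0 addr0 => <-.
  by apply: (congr1 (fun v => trf mu (fun x xi => x * xi) (box1 r) v xi)); apply/funext => x; rewrite addr0.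
have [la na] := plancherel1 r0 ha.
have [lb nb] := plancherel1 r0 hb.
apply: inner_of_N; [exact: hbox|exact: hbox|exact: la|exact: lb|exact: na|exact: nb|exact: trB|].
apply: etrans; last first.
  apply: etrans; first exact: (trB a (fun x => 'i%C * b x) ha (inL2Z 'i%C hb)).
  by congr (_ * _); apply: eqN => x; rewrite mulrCA.
by apply: eqN => xi; rewrite trZ.
Qed.

Lemma indic_idem {T : Type} (A : set T) x : (\1_A x : R)%:C * (\1_A x : R)%:C = (\1_A x : R)%:C.
Proof. by rewrite -rmorphM /= indicE; case: (x \in A); rewrite ?mulr1 ?mulr0. Qed.

Lemma inL2_box1 (r : R) a : inL2 mu a -> inL2 mu (fun x => (\1_(box1 r) x : R)%:C * a x).
Proof.
apply: (inL2M (C := 1)); last by move=> x; exact: sqn_indic.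
by apply: cmeas_real; apply: measurable_indic; exact: box1_measurable.
Qed.

Lemma inL2_box2 (r : R) f : inL2 mu2 f -> inL2 mu2 (fun z => (\1_(box2 r) z : R)%:C * f z).
Proof.
apply: (inL2M (C := 1)); last by move=> x; exact: sqn_indic.
by apply: cmeas_real; apply: measurable_indic; exact: box2_measurable.
Qed.

Lemma box2_tens (r : R) n (a b : nat -> R -> R[i]) z :
  (\1_(box2 r) z : R)%:C * tens n a b z =
  tens n (fun k x => (\1_(box1 r) x : R)%:C * a k x) (fun k y => (\1_(box1 r) y : R)%:C * b k y) z.
Proof.
rewrite /tens mulr_sumr; apply: eq_bigr => k _.
by rewrite /tensor indic_setX rmorphM /=; ring.
Qed.

Lemma plancherel2 (r : R) f : 0 <= r -> inL2 mu2 f ->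
  inL2 mu2 (trf mu2 dot2 (box2 r) f) /\
  N mu2 (trf mu2 dot2 (box2 r) f) =
    Num.sqrt (2 * pi) ^+ 2 * N mu2 (fun z => (\1_(box2 r) z : R)%:C * f z).
Proof.
move=> r0.
(* Tensor sums supported in the box: on them truncation is the identity, so one-variable Plancherel
   scales the Gram matrices of the factors by a constant. *)
pose V h := tenss h /\ forall z, (\1_(box2 r) z : R)%:C * h z = h z.
apply: (@plancherel_dense _ _ _ mu2 dot2 measurable_dot2 _ (box2_measurable r) (box2_fin r)
  (Num.sqrt (2 * pi) ^+ 2) V); first exact: sqr_ge0.
- by move=> h [/tenss_L2].
- move=> c g h [tg bg] [th bh]; split; first exact: tenss_lin.
  by move=> z; rewrite mulrDr mulrCA bg bh.
- move=> h hh; split; first exact: inL2_box2.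
  move=> e e0; have [_ /(_ _ e0)[g tg ng]] := tenss_dense r hh.
  exists (fun z => (\1_(box2 r) z : R)%:C * g z).
    split; last by move=> z; rewrite mulrA indic_idem.
    have [n [a [b [ha hb ->]]]] := tg.
    exists n, (fun k x => (\1_(box1 r) x : R)%:C * a k x), (fun k y => (\1_(box1 r) y : R)%:C * b k y).
    by split; [move=> k; exact: inL2_box1|move=> k; exact: inL2_box1|apply/funext => z; exact: box2_tens].
  have hg := tenss_L2 tg.
  apply: le_trans ng; apply: N_le; [|exact: inL2B (inL2_box2 r hh) hg|].
    exact: inL2B (inL2_box2 r hh) (inL2_box2 r hg).
  move=> z; rewrite indicE; case: (z \in box2 r); first by rewrite !mul1r.
  by rewrite !mul0r subr0 sqn_real expr0n sqn_ge0.
- move=> h [[n [a [b [ha hb eh]]]] bh].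
  pose a' k x := (\1_(box1 r) x : R)%:C * a k x.
  pose b' k x := (\1_(box1 r) x : R)%:C * b k x.
  have ha' k : inL2 mu (a' k) by exact: inL2_box1.
  have hb' k : inL2 mu (b' k) by exact: inL2_box1.
  have e' : h = tens n a' b'.
    by apply/funext => z; rewrite -bh eh box2_tens.
  have L2t u : inL2 mu u -> inL2 mu (trf mu (fun x xi => x * xi) (box1 r) u).
    by move=> hu; have [] := plancherel1 r0 hu.
  have ia (u : nat -> R -> R[i]) k l : (forall k, inL2 mu (u k)) ->
      inner mu (trf mu (fun x xi => x * xi) (box1 r) (fun x => (\1_(box1 r) x : R)%:C * u k x))
        (trf mu (fun x xi => x * xi) (box1 r) (fun x => (\1_(box1 r) x : R)%:C * u l x)) =
      (Num.sqrt (2 * pi) ^+ 2)%:C * inner mu (fun x => (\1_(box1 r) x : R)%:C * u k x)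
         (fun x => (\1_(box1 r) x : R)%:C * u l x).
    move=> hu; apply: etrans; first exact: (inner_trf1 r0 (inL2_box1 r (hu k)) (inL2_box1 r (hu l))).
    by apply: (congr2 (fun v w => (Num.sqrt (2 * pi) ^+ 2)%:C * inner mu v w));
      apply/funext => x; rewrite mulrA indic_idem.
  rewrite e' trf_tens//; split; first by apply: inL2_tens => k; exact: L2t.
  apply: sum_isometry; [exact: sqrtr_ge0|exact: L2t|exact: L2t| | |exact: ha'|exact: hb'].
  + by move=> k l; exact: (ia a).
  + by move=> k l; exact: (ia b).
Qed.

End Tensor.

(** * Closed graphs and totality by density *)

Section ClosedRelation.
Context {d : measure_display} {T : measurableType d} {R : realType}.
Variable mu : {measure set T -> \bar R}.
Variables (c : R) (E : (T -> R[i]) -> (T -> R[i]) -> Prop).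
Hypothesis isoE : isometric_relation mu c E.
Hypothesis totE : forall f, inL2 mu f -> exists g, E f g.

Lemma le_eps (x : R) : (forall e, 0 < e -> x <= e) -> x <= 0.
Proof. by move=> h; apply/ler_addgt0Pr => e e0; rewrite add0r h. Qed.

Definition graph_closed (E : (T -> R[i]) -> (T -> R[i]) -> Prop) :=
  forall f g, inL2 mu f -> inL2 mu g ->
    (forall e, 0 < e -> exists f' g', [/\ E f' g',
      N mu (fun x => f x - f' x) <= e & N mu (fun x => g x - g' x) <= e]) -> E f g.

(** As [E] is total, [f] and [g] have transforms [fh] and [gh], and only [gh = m fh] almost
    everywhere is at stake. Both sides are close to the same [m fh'] coming from an approximating
    pair. *)
Lemma isometric_multiplier_closed (m : T -> R[i]) : 0 < c -> cmeas m ->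
  (forall x, sqn (m x) = 1) ->
  graph_closed (fun f g => exists2 fh, E f fh & E g (fun x => m x * fh x)).
Proof.
move=> c0 mm m1 f g hf hg appr.
have [fh Efh] := totE hf; have [gh Egh] := totE hg; exists fh => //.
have hfh := iso_r isoE Efh; have hgh := iso_r isoE Egh.
have hm u : inL2 mu u -> inL2 mu (fun x => m x * u x).
  by apply: (inL2M (C := 1)) => // x; rewrite m1.
apply: (iso_ae isoE Egh hg); first exact: hm.
  by rewrite -[RHS](N0 mu); apply: eqN => x; rewrite subrr.
apply/eqP; rewrite eq_le N_ge0 andbT; apply: le_eps => e e0.
have ec : 0 < e / (2 * c) by rewrite divr_gt0// mulr_gt0.
have [f' [g' [[fh' Ef' Eg'] nf ng]]] := appr _ ec.
have hfh' := iso_r isoE Ef'.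
apply: (le_trans (@N_split _ _ _ mu (fun x => m x * fh' x) _ _ hgh (hm _ hfh) (hm _ hfh'))).
have -> : N mu (fun x => m x * fh' x - m x * fh x) = N mu (fun x => fh' x - fh x).
  rewrite -(@NM_unit _ _ _ mu m (fun x => fh' x - fh x))//.
  by apply: eqN => x; rewrite mulrBr.
rewrite (iso_NB isoE Egh Eg') (iso_NB isoE Ef' Efh) NBC -mulrDr.
have -> : e = c * (e / (2 * c) + e / (2 * c)) by field; rewrite gt_eqF.
by apply: ler_wpM2l; [exact: ltW|apply: lerD; rewrite // NBC].
Qed.

End ClosedRelation.

Lemma cvg0_ex {R : realType} (u : nat -> R) e : u @ \oo --> 0 -> 0 < e ->
  exists n0, forall n, (n0 <= n)%N -> u n <= e.
Proof.
move=> /cvgrPdist_le h e0; have [k _ hk] := h _ e0; exists k => n kn.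
by apply: le_trans (hk n kn); rewrite sub0r normrN ler_norm.
Qed.

(** The images of a fast approximating sequence are Cauchy by isometry, and the closed graph accepts
    their limit as a value at [f]. *)
Lemma total_of_dense {d : measure_display} {T : measurableType d} {R : realType}
  (mu : {measure set T -> \bar R}) (E : (T -> R[i]) -> (T -> R[i]) -> Prop) :
  isometric_relation mu 1 E -> graph_closed mu E ->
  (forall f, inL2 mu f -> forall e : R, 0 < e ->
    exists f' g', E f' g' /\ N mu (fun x => f x - f' x) <= e) ->
  forall f, inL2 mu f -> exists g, E f g.
Proof.
move=> isoE clE dE f hf.
have pos k : 0 < (4^-1 : R) ^+ k by rewrite exprn_gt0// invr_gt0.
(* The exponent [k.+1] leaves room for the triangle inequality: [4 ^ -(k+2) + 4 ^ -(k+1) <= 4 ^ -k],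
   the rate that [L2_complete_fast] asks for. *)
have appr k : exists fg : (T -> R[i]) * (T -> R[i]),
    E fg.1 fg.2 /\ N mu (fun x => f x - fg.1 x) <= 4^-1 ^+ k.+1.
  by have [f' [g' ?]] := dE _ hf _ (pos k.+1); exists (f', g').
have [fg hfg] := choice appr.
have hL k := iso_l isoE (hfg k).1.
have hR k := iso_r isoE (hfg k).1.
have [g [hg ng]] : exists g, inL2 mu g /\ forall k, N mu (fun x => g x - (fg k).2 x) <= 2 * 4^-1 ^+ k.
  apply: L2_complete_fast => // k.
  rewrite (iso_NB isoE (hfg k.+1).1 (hfg k).1) mul1r.
  apply: (le_trans (@N_split _ _ _ mu f _ _ (hL _) (hL _) hf)).
  apply: (le_trans (lerD _ (hfg k).2)); first by rewrite NBC; exact: (hfg k.+1).2.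
  rewrite !exprS; have := ltW (pos k); lra.
exists g; apply: clE => // e e0.
have cv : (fun k => 2 * (4^-1 : R) ^+ k) @ \oo --> 0.
  rewrite -[X in _ --> X](mulr0 2); apply: cvgM; first exact: cvg_cst.
  by apply: cvg_expr; rewrite ger0_norm ?invr_ge0// invf_lt1// ltr1n.
have [k hk'] := cvg0_ex cv e0; have hk := hk' k (leqnn k).
exists (fg k).1, (fg k).2; split; [exact: (hfg k).1| |exact: le_trans (ng k) hk].
apply: le_trans (hfg k).2 (le_trans _ hk).
by rewrite exprS; have := ltW (pos k); lra.
Qed.

(** * Fourier transforms and free propagators in one and two variables *)

Section Fourier.
Context {R : realType}.
Local Notation mu := (leb R).
Local Notation mu2 := (leb2 R).
Local Notation dot1 := (fun x xi : R => x * xi).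
Local Notation s2pi := (Num.sqrt (2 * pi : R)).

Lemma s2pi_gt0 : 0 < s2pi.
Proof. by rewrite sqrtr_gt0 mulr_gt0// pi_gt0. Qed.

Lemma box1_nested m n : (m <= n)%N -> (box1 m%:R : set R) `<=` box1 n%:R.
Proof.
move=> mn x; rewrite /box1 /= !in_itv/= => /andP[h1 h2].
have mn' : m%:R <= n%:R :> R by rewrite ler_nat.
by apply/andP; split; lra.
Qed.

Lemma box1_cover (x : R) : exists n, (box1 n%:R : set R) x.
Proof.
exists (Num.trunc `|x|).+1; rewrite /box1 /= in_itv/= -ler_norml.
by apply: ltW; exact: truncnS_gt.
Qed.

Lemma box2_nested m n : (m <= n)%N -> (box2 m%:R : set (R * R)) `<=` box2 n%:R.
Proof. by move=> mn z [h1 h2]; split; exact: (box1_nested mn). Qed.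

Lemma box2_cover (z : R * R) : exists n, (box2 n%:R : set (R * R)) z.
Proof.
have [m hm] := box1_cover z.1; have [n hn] := box1_cover z.2.
by exists (maxn m n); split; [apply: (box1_nested (leq_maxl m n))|apply: (box1_nested (leq_maxr m n))].
Qed.

Let plan1 n f : inL2 mu f -> inL2 mu (trf mu dot1 (box1 n%:R) f) /\
  N mu (trf mu dot1 (box1 n%:R) f) = s2pi * N mu (fun x => (\1_(box1 n%:R) x : R)%:C * f x).
Proof. exact: plancherel1. Qed.

Let plan2 n f : inL2 mu2 f -> inL2 mu2 (trf mu2 dot2 (box2 n%:R) f) /\
  N mu2 (trf mu2 dot2 (box2 n%:R) f) = s2pi ^+ 2 * N mu2 (fun x => (\1_(box2 n%:R) x : R)%:C * f x).
Proof. exact: plancherel2. Qed.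

Lemma isometric_fourier1 : isometric_relation mu s2pi (@fourier1 R).
Proof.
exact: (@isometric_fourier _ _ _ mu dot1 measurable_dot1 (fun n => box1 n%:R)
  (fun n => box1_measurable n%:R) (fun n => box1_fin n%:R) box1_nested box1_cover s2pi (ltW s2pi_gt0) plan1).
Qed.

Lemma fourier1_total f : inL2 mu f -> exists fh, fourier1 f fh.
Proof.
exact: (@fourier_total _ _ _ mu dot1 measurable_dot1 (fun n => box1 n%:R)
  (fun n => box1_measurable n%:R) (fun n => box1_fin n%:R) box1_nested box1_cover s2pi (ltW s2pi_gt0) plan1).
Qed.

Lemma isometric_fourier2 : isometric_relation mu2 (s2pi ^+ 2) (@fourier2 R).
Proof.
exact: (@isometric_fourier _ _ _ mu2 dot2 measurable_dot2 (fun n => box2 n%:R)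
  (fun n => box2_measurable n%:R) (fun n => box2_fin n%:R) box2_nested box2_cover _ (sqr_ge0 _) plan2).
Qed.

Lemma fourier2_total f : inL2 mu2 f -> exists fh, fourier2 f fh.
Proof.
exact: (@fourier_total _ _ _ mu2 dot2 measurable_dot2 (fun n => box2 n%:R)
  (fun n => box2_measurable n%:R) (fun n => box2_fin n%:R) box2_nested box2_cover _ (sqr_ge0 _) plan2).
Qed.

Lemma tenss_dense_full f : inL2 mu2 f -> L2_closure mu2 tenss f.
Proof.
move=> hf; apply: (@clV_cvg _ _ _ mu2 tenss (@tenss_L2 R) (fun n z => (\1_(box2 n%:R) z : R)%:C * f z)) => //.
- by move=> k; exact: tenss_dense.
- exact: (@box_cvg _ _ _ mu2 (fun n => box2 n%:R) (fun n => box2_measurable n%:R) box2_nested box2_cover).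
Qed.

Lemma tensorB (a b a' b' : R -> R[i]) z : tensor a b z - tensor a' b' z =
  tensor (fun x => a x - a' x) b z + tensor a' (fun y => b y - b' y) z.
Proof. by rewrite /tensor; ring. Qed.

Lemma N_tensorB (a b a' b' : R -> R[i]) :
  inL2 mu a -> inL2 mu b -> inL2 mu a' -> inL2 mu b' ->
  N mu2 (fun z => tensor a b z - tensor a' b' z) <=
  N mu (fun x => a x - a' x) * N mu b + N mu a' * N mu (fun y => b y - b' y).
Proof.
move=> ha hb ha' hb'.
rewrite (eqN mu2 (tensorB a b a' b')).
have h1 := inL2B ha ha'; have h2 := inL2B hb hb'.
rewrite -!N_tensor//.
by apply: (@N_triangle _ _ _ mu2); exact: inL2_tensor.
Qed.

(** Over squares the truncated transform factors exactly; the product converges because the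
    truncated transforms of [b] stay bounded, by Plancherel. *)
Lemma fourier2_tensor (a b ah bh : R -> R[i]) : fourier1 a ah -> fourier1 b bh ->
  fourier2 (tensor a b) (tensor ah bh).
Proof.
move=> Fa Fb.
have FP := @fourierP _ _ _ mu dot1 (fun n => box1 n%:R) s2pi plan1.
have [ha hah cvga] := (FP _ _).1 Fa.
have [hb hbh cvgb] := (FP _ _).1 Fb.
apply/(@fourierP _ _ _ mu2 dot2 (fun n => box2 n%:R) _ plan2); split; [exact: inL2_tensor|exact: inL2_tensor|].
pose ta n := trf mu dot1 (box1 n%:R) a; pose tb n := trf mu dot1 (box1 n%:R) b.
have lta n : inL2 mu (ta n) by have [] := plan1 n ha.
have ltb n : inL2 mu (tb n) by have [] := plan1 n hb.
have ntb n : N mu (tb n) <= s2pi * N mu b.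
  have [_] := plan1 n hb; rewrite /tb => ->; apply: ler_wpM2l; first exact: ltW s2pi_gt0.
  exact: (@box_le _ _ _ mu (fun n => box1 n%:R) (fun n => box1_measurable n%:R)).
apply: (@cvg0_le _ _ (fun n => N mu (fun x => ta n x - ah x) * (s2pi * N mu b) +
    N mu ah * N mu (fun x => tb n x - bh x))).
- by move=> n; exact: N_ge0.
- move=> n; have -> : N mu2 (fun xi => trf mu2 dot2 (box2 n%:R) (tensor a b) xi - tensor ah bh xi) =
      N mu2 (fun z => tensor (ta n) (tb n) z - tensor ah bh z).
    by apply: eqN => z; congr (_ - _); exact: trf_tensor.
  apply: (le_trans (N_tensorB _ _ _ _)) => //.
  by rewrite lerD2r; apply: ler_wpM2l; [exact: N_ge0|exact: ntb].
- have -> : 0 = 0 * (s2pi * N mu b) + N mu ah * 0 by rewrite mul0r mulr0 addr0.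
  apply: cvgD; apply: cvgM; [exact: cvga|exact: cvg_cst|exact: cvg_cst|exact: cvgb].
Qed.

Lemma isometric_free1 (eps t : R) : isometric_relation mu 1 (free1 eps t).
Proof.
apply: (isometric_multiplier isometric_fourier1 s2pi_gt0); last by move=> x; exact: sqn_cis.
Qed.

Let m2 (e1 e2 t : R) : cmeas (fun zeta : measurableTypeR R * measurableTypeR R =>
  cis (- (t * (e1 * zeta.1 ^+ 2 + e2 * zeta.2 ^+ 2)))).
Proof.
apply: cmeas_cis; apply: measurableT_comp => //.
by apply: measurable_funM => //; apply: measurable_funD; apply: measurable_funM => //;
  apply: measurable_funX.
Qed.

Lemma isometric_free2 (e1 e2 t : R) : isometric_relation mu2 1 (free2 e1 e2 t).
Proof.
apply: (isometric_multiplier isometric_fourier2); last by move=> x; exact: sqn_cis.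
by rewrite exprn_gt0// s2pi_gt0.
Qed.

Lemma free2_closed (e1 e2 t : R) : graph_closed mu2 (free2 e1 e2 t).
Proof.
apply: (isometric_multiplier_closed isometric_fourier2 fourier2_total); [|exact: m2|by move=> x; exact: sqn_cis].
by rewrite exprn_gt0// s2pi_gt0.
Qed.

Lemma free2_tensor (e1 e2 t : R) (a b a' b' : R -> R[i]) :
  free1 e1 t a a' -> free1 e2 t b b' -> free2 e1 e2 t (tensor a b) (tensor a' b').
Proof.
move=> [ah Fa Fa'] [bh Fb Fb']; exists (tensor ah bh); first exact: fourier2_tensor.
have := fourier2_tensor Fa' Fb'; congr (fourier2 _ _); apply/funext => zeta.
by rewrite /tensor mulrDr opprD cisD; ring.
Qed.

(** Totality says that the multiplied transform is again a transform. Tensors inherit it from their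
    factors, and density with the closed graph extends it to all of L2. *)
Lemma free2_total (e1 e2 t : R) :
  (forall f, inL2 mu f -> exists g, free1 e1 t f g) ->
  (forall f, inL2 mu f -> exists g, free1 e2 t f g) ->
  forall f, inL2 mu2 f -> exists g, free2 e1 e2 t f g.
Proof.
move=> t1 t2; apply: total_of_dense; [exact: isometric_free2|exact: free2_closed|].
move=> f hf e e0; have [_ /(_ _ e0)[g [n [a [b [ha hb ->]]]] ng]] := tenss_dense_full hf.
have [a' ha'] := choice (fun k => t1 _ (ha k)).
have [b' hb'] := choice (fun k => t2 _ (hb k)).
exists (tens n a b), (tens n a' b'); split => //.
apply: (@iso_sum _ _ _ mu2 1 _ (isometric_free2 e1 e2 t) n (fun k => tensor (a k) (b k)) (fun k => tensor (a' k) (b' k))).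
  by apply: (iso0 (isometric_free2 e1 e2 t) (free2_tensor (ha' 0%N) (hb' 0%N))).
by move=> k _; exact: free2_tensor.
Qed.

End Fourier.

(** * [L_2]-valued calculus *)

Section L2Calculus.
Context {d : measure_display} {T : measurableType d} {R : realType}.
Variable mu : {measure set T -> \bar R}.
Implicit Types (f g h : T -> R[i]) (u v F G : R -> T -> R[i]).

Definition L2_continuous v := forall t, 0 <= t -> forall e : R, 0 < e ->
  exists2 delta : R, 0 < delta &
    forall s, 0 <= s -> `|s - t| < delta -> N mu (fun z => v s z - v t z) <= e.

Lemma L2_continuousP v : (forall t, 0 <= t -> inL2 mu (v t)) ->
  (L2_continuous v <-> forall t, 0 <= t ->
        norm2 mu (fun z => v s z - v t z)
          @[s --> within [set s | 0 <= s] (nbhs t)] --> 0%E).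
Proof.
move=> hv.
have key t : 0 <= t -> (norm2 mu (fun z => v s z - v t z)
    @[s --> within [set s | 0 <= s] (nbhs t)] --> 0%E) <->
    (N mu (fun z => v s z - v t z) @[s --> within [set s | 0 <= s] (nbhs t)] --> 0).
  move=> t0; apply: (@norm2_cvg0 _ _ _ mu R _ _ (fun s z => v s z - v t z)).
  near=> s; apply: inL2B; last exact: hv.
  by apply: hv; near: s; exact: withinT.
split=> H t t0.
- apply/(key _ t0)/cvgrPdist_le => e e0.
  have [delta d0 Hd] := H t t0 e e0.
  near=> s; rewrite sub0r normrN ger0_norm ?N_ge0//; apply: Hd.
    by near: s; exact: withinT.
  have : ball t delta s by near: s; apply: cvg_within; exact: nbhsx_ballx.
  by rewrite /ball /= distrC.
- move=> e e0; have /(key _ t0)/cvgrPdist_le/(_ _ e0) := H t t0.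
  move=> /nbhs_ballP[delta /= d0 Hd]; exists delta => // s s0 st.
  have bs : ball t delta s by rewrite /ball /= distrC.
  by have := Hd s bs s0; rewrite sub0r normrN ger0_norm ?N_ge0.
Unshelve. all: by end_near.
Qed.

(** Heine-Cantor by compactness of [[0, a]]: if [x'] is within [eta / 2] of a centre [x] and [s]
    within [eta / 2] of [x'], then both are within [eta] of [x]. *)
Lemma L2_continuous_uniform v (a e : R) : (forall t, 0 <= t -> inL2 mu (v t)) ->
  L2_continuous v -> 0 < e -> exists2 delta : R, 0 < delta &
    forall s t, 0 <= s <= a -> 0 <= t <= a -> `|s - t| < delta ->
      N mu (fun z => v s z - v t z) <= e.
Proof.
move=> hv cv e0.
have e2 : 0 < e / 2 by rewrite divr_gt0.
pose P (delta x : R) := 0 <= x -> forall s, 0 <= s -> `|s - x| < delta ->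
  N mu (fun z => v s z - v x z) <= e.
have /compact_near_coveringP/(_ R (0^'+) P _) := @segment_compact R 0 a.
have H : forall x, `[0, a]%classic x -> \forall x' \near x & i \near 0^'+, P i x'.
  move=> x /=; rewrite in_itv/= => /andP[x0 xa].
  have [eta eta0 Heta] := cv x x0 _ e2.
  exists (ball x (eta / 2), [set y | y < eta / 2]) => /=.
    split; first by apply: nbhsx_ballx; rewrite divr_gt0.
    by apply: nbhs_right_lt; rewrite divr_gt0.
  move=> [x' i] [/= bx' ieta] x'0 s s0 sx'.
  have x'x : `|x' - x| < eta / 2 by rewrite distrC.
  apply: (le_trans (@N_split _ _ _ mu (v x) _ _ (hv _ s0) (hv _ x'0) (hv _ x0))).
  rewrite [leRHS](splitr e); apply: lerD.
    apply: Heta => //; apply: (le_lt_trans (ler_distD x' _ _)).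
    by rewrite (splitr eta) ltrD// (lt_trans sx').
  by rewrite NBC; apply: Heta => //; apply: lt_le_trans x'x _; rewrite ler_pdivrMr// ler_pMr// ler1n.
move=> /(_ H) [delta /= d0 Hd]; exists (delta / 2); first by rewrite divr_gt0.
move=> s t /andP[s0 sa] /andP[t0 ta] st.
apply: (Hd (delta / 2)) => //=.
- by rewrite /ball/= sub0r normrN gtr0_norm ?divr_gt0// ltr_pdivrMr// ltr_pMr// ltr1n.
- by rewrite divr_gt0.
- by rewrite in_itv/= t0 ta.
Qed.

Lemma L2_continuous_bounded v (a : R) : (forall t, 0 <= t -> inL2 mu (v t)) ->
  L2_continuous v -> exists2 B : R, 0 <= B & forall t, 0 <= t <= a -> N mu (v t) <= B.
Proof.
move=> hv cv.
pose P (B x : R) := 0 <= x -> N mu (v x) <= B.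
have /compact_near_coveringP/(_ R (+oo) P _) := @segment_compact R 0 a.
have H : forall x, `[0, a]%classic x -> \forall x' \near x & i \near +oo, P i x'.
  move=> x /=; rewrite in_itv/= => /andP[x0 xa].
  have [eta eta0 Heta] := cv x x0 _ ltr01.
  exists (ball x eta, [set y | N mu (v x) + 1 <= y]) => /=.
    split; first exact: nbhsx_ballx.
    by exists (N mu (v x) + 1); split; [exact: num_real|move=> y /ltW].
  move=> [x' i] [/= bx' ieta] x'0.
  apply: le_trans ieta; apply: (le_trans (N_lip (hv _ x'0) (hv _ x0))).
  by rewrite lerD2l; apply: Heta => //; rewrite distrC.
move=> /(_ H) [B [_ HB]]; exists (Num.max (B + 1) 0); first by rewrite le_max lexx orbT.
move=> t /andP[t0 ta].
have := HB (B + 1); rewrite ltrDl => /(_ ltr01) /(_ t).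
by rewrite /= in_itv/= t0 ta => /(_ isT t0) h; rewrite le_max h.
Qed.

End L2Calculus.

(** * Tagged partitions *)

Section Partitions.
Context {R : realType}.
Implicit Types (a b delta : R) (x tau : nat -> R).

Lemma tagged_le a b delta n x tau : tagged_partition a b delta n x tau ->
  forall k, (k < n)%N -> [/\ a <= x k, x k <= x k.+1, x k.+1 <= b & a <= tau k <= b].
Proof.
move=> [x0 xn H].
have mono k : (k < n)%N -> x k <= x k.+1.
  by move=> kn; have [h1 h2 _] := H k kn; exact: le_trans h1 h2.
have lo k : (k <= n)%N -> a <= x k.
  elim: k => [|k IH kn]; first by rewrite x0.
  by apply: le_trans (mono k kn); exact/IH/ltnW.
have hi k : (k <= n)%N -> x (n - k)%N <= b.
  elim: k => [|k IH kn]; first by rewrite subn0 xn.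
  apply: le_trans (IH (ltnW kn)); have -> : (n - k = (n - k.+1).+1)%N by rewrite -subSn// subSS.
  by apply: mono; rewrite ltn_subrL (leq_ltn_trans _ kn).
move=> k kn; have [h1 h2 _] := H k kn.
have hb : x k.+1 <= b by rewrite -(subKn kn); exact/hi/leq_subr.
split; [exact/lo/ltnW|exact: mono|exact: hb|].
by rewrite (le_trans (lo k (ltnW kn)) h1) (le_trans h2 hb).
Qed.

Lemma tagged_sum a b delta n x tau : tagged_partition a b delta n x tau ->
  \sum_(k < n) (x k.+1 - x k) = b - a.
Proof.
by move=> [x0 xn _]; rewrite -(big_mkord xpredT (fun k => x k.+1 - x k)) telescope_sumr// x0 xn.
Qed.

Definition uniform a b n (k : nat) : R := a + (b - a) * k%:R / n%:R.

Lemma uniform_diff a b n k : uniform a b n k.+1 - uniform a b n k = (b - a) / n%:R.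
Proof. by rewrite /uniform -natr1; ring. Qed.

Lemma uniform0 a b n : uniform a b n 0 = a.
Proof. by rewrite /uniform mulr0 mul0r addr0. Qed.

Lemma uniformn a b n : uniform a b n.+1 n.+1 = b.
Proof. by rewrite /uniform mulfK ?pnatr_eq0// addrC subrK. Qed.

Lemma uniform_small a b delta : 0 < delta -> exists n0, forall n, (n0 <= n)%N -> (b - a) / n.+1%:R < delta.
Proof.
move=> d0; exists (Num.trunc (`|b - a| / delta)) => n n0n.
rewrite ltr_pdivrMr ?ltr0n//; apply: (le_lt_trans (ler_norm _)).
rewrite mulrC -ltr_pdivrMr//; apply: lt_le_trans (truncnS_gt _) _.
by rewrite ler_nat.
Qed.

Lemma tagged_uniform a b delta : a <= b -> 0 < delta -> exists n0, forall n, (n0 <= n)%N ->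
  tagged_partition a b delta n.+1 (uniform a b n.+1) (uniform a b n.+1).
Proof.
move=> ab /(uniform_small a b)[n0 Hn]; exists n0 => n n0n.
split; [exact: uniform0|exact: uniformn|move=> k _; split => //].
  by rewrite -subr_ge0 uniform_diff divr_ge0// subr_ge0.
by rewrite uniform_diff; exact: Hn.
Qed.

Definition glue n x y (k : nat) : R := if (k < n)%N then x k else y (k - n)%N.

Lemma tagged_glue a b c delta m n x y sx sy : tagged_partition a b delta n x sx ->
  tagged_partition b c delta m y sy ->
  tagged_partition a c delta (n + m) (glue n x y) (glue n sx sy).
Proof.
move=> [x0 xn Hx] [y0 ym Hy].
have nE : glue n x y n = y 0%N by rewrite /glue ltnn subnn.
split.
- by case: n x0 xn Hx nE => [x0 xn _ _|n x0 _ _ _]; rewrite /glue //= y0 -xn.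
- by rewrite /glue ltnNge leq_addr /= addKn.
move=> k knm; have [kn|nk] := ltnP k n.
  have -> : glue n x y k = x k by rewrite /glue kn.
  have -> : glue n sx sy k = sx k by rewrite /glue kn.
  have -> : glue n x y k.+1 = x k.+1; last exact: Hx.
  rewrite /glue; case: ltnP => // h; have -> : k.+1 = n by apply/eqP; rewrite eqn_leq kn h.
  by rewrite subnn y0 xn.
have -> : glue n x y k = y (k - n)%N by rewrite /glue ltnNge nk.
have -> : glue n sx sy k = sy (k - n)%N by rewrite /glue ltnNge nk.
have -> : glue n x y k.+1 = y (k - n).+1 by rewrite /glue ltnNge (leqW nk) /= subSn.
by apply: Hy; rewrite ltn_subLR.
Qed.

End Partitions.

(** * Riemann sums with values in L2 *)

Section Riemann.
Context {d : measure_display} {T : measurableType d} {R : realType}.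
Variable mu : {measure set T -> \bar R}.
Implicit Types (f g h S : T -> R[i]) (u v F G : R -> T -> R[i]) (a b e delta : R) (x tau : nat -> R).

Lemma riemann_glue F m n x y sx sy z : x n = y 0%N ->
  riemann_sum F (n + m) (glue n x y) (glue n sx sy) z =
  riemann_sum F n x sx z + riemann_sum F m y sy z.
Proof.
move=> xy; rewrite /riemann_sum big_split_ord /=; congr (_ + _).
  apply: eq_bigr => k _; have kn := ltn_ord k.
  rewrite /glue kn; case: ltnP => // h; have -> : k.+1 = n by apply/eqP; rewrite eqn_leq kn h.
  by rewrite subnn xy.
have glueE (w w' : nat -> R) k : glue n w w' (n + k) = w' k by rewrite /glue ltnNge leq_addr /= addKn.
by apply: eq_bigr => k _; rewrite -addnS !glueE.
Qed.

Lemma inL2_riemann F n x tau : (forall k, (k < n)%N -> inL2 mu (F (tau k))) ->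
  inL2 mu (riemann_sum F n x tau).
Proof.
move=> hF; apply: (@inL2_sum _ _ _ mu n (fun k z => (x k.+1 - x k)%:C * F (tau k) z)) => k kn.
by apply: inL2Z; exact: hF.
Qed.

Lemma N_riemann F n x tau (C : nat -> R) : (forall k, (k < n)%N -> x k <= x k.+1) ->
  (forall k, (k < n)%N -> inL2 mu (F (tau k))) ->
  (forall k, (k < n)%N -> N mu (F (tau k)) <= C k) ->
  N mu (riemann_sum F n x tau) <= \sum_(k < n) (x k.+1 - x k) * C k.
Proof.
move=> hx hF hC.
apply: (le_trans (@N_sum _ _ _ mu n (fun k z => (x k.+1 - x k)%:C * F (tau k) z) _)).
  by move=> k kn; apply: inL2Z; exact: hF.
apply: ler_sum => k _; rewrite NZr; last exact: hF.
rewrite ger0_norm ?subr_ge0 ?hx//.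
by apply: ler_wpM2l; rewrite ?subr_ge0 ?hx// hC.
Qed.

Lemma N_riemann_tagged F a b delta n x tau (C : R) : tagged_partition a b delta n x tau ->
  (forall s, a <= s <= b -> inL2 mu (F s) /\ N mu (F s) <= C) ->
  N mu (riemann_sum F n x tau) <= (b - a) * C.
Proof.
move=> tp hF; rewrite -(tagged_sum tp) mulr_suml.
have hk := tagged_le tp.
by apply: N_riemann => k kn; have [_ h _ /hF[]] := hk k kn.
Qed.

Lemma inL2_riemann_tagged F a b delta n x tau : tagged_partition a b delta n x tau ->
  (forall s, a <= s <= b -> inL2 mu (F s)) -> inL2 mu (riemann_sum F n x tau).
Proof.
by move=> tp hF; apply: inL2_riemann => k kn; have [_ _ _ /hF] := tagged_le tp kn.
Qed.

Lemma riemann_lin c F G n x tau z :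
  riemann_sum (fun s z => c * F s z + G s z) n x tau z =
  c * riemann_sum F n x tau z + riemann_sum G n x tau z.
Proof.
rewrite /riemann_sum mulr_sumr -big_split /=; apply: eq_bigr => k _; ring.
Qed.

Lemma riemannB F G n x tau z :
  riemann_sum F n x tau z - riemann_sum G n x tau z =
  riemann_sum (fun s z => F s z - G s z) n x tau z.
Proof.
rewrite /riemann_sum -sumrB; apply: eq_bigr => k _; ring.
Qed.

Lemma L2_integralP a b F S : (forall s, a <= s <= b -> inL2 mu (F s)) ->
  L2_integral mu a b F S <-> inL2 mu S /\
    forall e, 0 < e -> exists2 delta : R, 0 < delta &
      forall (n : nat) (x tau : nat -> R), tagged_partition a b delta n x tau ->
        N mu (fun z => riemann_sum F n x tau z - S z) <= e.
Proof.
move=> hF; split=> -[hS H]; split=> // e e0.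
  have [delta d0 Hd] := H e e0; exists delta => // n x tau tp.
  have := Hd n x tau tp; rewrite norm2_N; first by rewrite lte_fin => /ltW.
  by apply: inL2B => //; exact: inL2_riemann_tagged tp hF.
have e2 : 0 < e / 2 by rewrite divr_gt0.
have [delta d0 Hd] := H _ e2; exists delta => // n x tau tp.
rewrite norm2_N; last by apply: inL2B => //; exact: inL2_riemann_tagged tp hF.
rewrite lte_fin; apply: (le_lt_trans (Hd n x tau tp)).
by rewrite ltr_pdivrMr// ltr_pMr// ltr1n.
Qed.

Lemma L2_integral_lin c a b F S F' S' :
  (forall s, a <= s <= b -> inL2 mu (F s)) -> (forall s, a <= s <= b -> inL2 mu (F' s)) ->
  L2_integral mu a b F S -> L2_integral mu a b F' S' ->
  L2_integral mu a b (fun s z => c * F s z + F' s z) (fun z => c * S z + S' z).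
Proof.
move=> hF hF' /(L2_integralP _ hF)[hS H] /(L2_integralP _ hF')[hS' H'].
apply/L2_integralP; first by move=> s sab; apply: inL2D; [apply: inL2Z; exact: hF|exact: hF'].
split; first by apply: inL2D => //; exact: inL2Z.
move=> e e0; pose C := Num.sqrt (sqn c) + 1.
have C0 : 0 < C by rewrite ltr_wpDl// sqrtr_ge0.
have eC : 0 < e / (2 * C) by rewrite divr_gt0// mulr_gt0.
have e2 : 0 < e / 2 by rewrite divr_gt0.
have [d1 d10 H1] := H _ eC; have [d2 d20 H2] := H' _ e2.
exists (Num.min d1 d2); first by rewrite lt_min d10 d20.
move=> n x tau tp.
have t1 : tagged_partition a b d1 n x tau.
  case: tp => x0 xn tp; split=> // k /tp[? ?]; by rewrite lt_min => /andP[].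
have t2 : tagged_partition a b d2 n x tau.
  case: tp => x0 xn tp; split=> // k /tp[? ?]; by rewrite lt_min => /andP[].
have L1 := inL2B (inL2_riemann_tagged t1 hF) hS.
have L2 := inL2B (inL2_riemann_tagged t2 hF') hS'.
rewrite (eqN mu (g := fun z => c * (riemann_sum F n x tau z - S z) +
  (riemann_sum F' n x tau z - S' z))); last by move=> z; rewrite riemann_lin; ring.
apply: (le_trans (N_triangle (inL2Z c L1) L2)).
rewrite (splitr e); apply: lerD; last exact: H2.
rewrite NZ//; apply: (@le_trans _ _ (C * (e / (2 * C)))); last first.
  by rewrite le_eqVlt; apply/orP; left; apply/eqP; field; rewrite gt_eqF.
apply: ler_pM; [exact: sqrtr_ge0|exact: N_ge0|by rewrite /C lerDl|exact: H1].
Qed.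

Lemma riemann_cst a b delta n x tau g z : tagged_partition a b delta n x tau ->
  riemann_sum (fun=> g) n x tau z = (b - a)%:C * g z.
Proof.
by move=> tp; rewrite /riemann_sum -mulr_suml -(tagged_sum tp) rmorph_sum.
Qed.

Lemma tagged_mesh a b delta delta' n x tau : delta <= delta' ->
  tagged_partition a b delta n x tau -> tagged_partition a b delta' n x tau.
Proof.
move=> dd [x0 xn H]; split=> // k /H[h1 h2 h3]; split=> //; exact: lt_le_trans h3 dd.
Qed.

(** The integrals over [[0, a]] and [[0, b]] come from separate limits. Gluing a partition of
    [[a, b]] to one of [[0, a]] makes the difference of their Riemann sums a Riemann sum over
    [[a, b]], where [F] stays within [e] of [F tau]. *)
Lemma L2_integral_increment F (S : R -> T -> R[i]) (c e : R) :
  (forall t, 0 <= t <= c -> inL2 mu (F t)) ->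
  (forall t, 0 <= t <= c -> L2_integral mu 0 t F (S t)) ->
  forall a b tau : R, 0 <= a -> a <= b -> b <= c -> a <= tau <= b ->
  (forall s, a <= s <= b -> N mu (fun z => F s z - F tau z) <= e) ->
  N mu (fun z => S b z - S a z - (b - a)%:C * F tau z) <= (b - a) * e.
Proof.
move=> hF hS a b tau a0 ab bc /andP[atau taub] modF.
have in0 t : t <= c -> forall s, 0 <= s <= t -> inL2 mu (F s).
  by move=> tb s /andP[s0 st]; apply: hF; rewrite s0 (le_trans st tb).
have hFtau : inL2 mu (F tau) by apply: (in0 b) => //; rewrite (le_trans a0).
have Ha : 0 <= a <= c by rewrite a0 (le_trans ab).
have Hb : 0 <= b <= c by rewrite (le_trans a0 ab).
have [La Ia] := (L2_integralP _ (in0 a (le_trans ab bc))).1 (hS a Ha).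
have [Lb Ib] := (L2_integralP _ (in0 b bc)).1 (hS b Hb).
apply/ler_addgt0Pr => eta eta0; have e2 : 0 < eta / 2 by rewrite divr_gt0.
have [da da0 Hda] := Ia _ e2; have [db db0 Hdb] := Ib _ e2.
pose delta := Num.min da db.
have delta0 : 0 < delta by rewrite lt_min da0 db0.
have [n0 /(_ _ (leqnn n0)) ta] := tagged_uniform a0 delta0.
have [m0 /(_ _ (leqnn m0)) tab] := tagged_uniform ab delta0.
set xa := uniform 0 a n0.+1 in ta; set xb := uniform a b m0.+1 in tab.
have tb := tagged_glue ta tab.
have da' : delta <= da by rewrite ge_min lexx.
have db' : delta <= db by rewrite ge_min lexx orbT.
have {}Hda := Hda _ _ _ (tagged_mesh da' ta).
have {}Hdb := Hdb _ _ _ (tagged_mesh db' tb).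
have Lra := inL2_riemann_tagged ta (in0 a (le_trans ab bc)).
have Lrb := inL2_riemann_tagged tb (in0 b bc).
have inab s : a <= s <= b -> inL2 mu (F s).
  by move=> /andP[h1 h2]; apply: (in0 b bc); rewrite (le_trans a0 h1).
have Lrab := inL2_riemann_tagged tab inab.
have Lc := inL2Z (b - a)%:C hFtau.
rewrite (eqN mu (g := fun z => (S b z - riemann_sum F (n0.+1 + m0.+1) (glue n0.+1 xa xb) (glue n0.+1 xa xb) z) +
   ((riemann_sum F n0.+1 xa xa z - S a z) +
    (riemann_sum F m0.+1 xb xb z - (b - a)%:C * F tau z)))); last first.
  move=> z; rewrite riemann_glue; last by rewrite /xa /xb uniformn uniform0.
  by ring.
apply: (le_trans (N_triangle (inL2B Lb Lrb) (inL2D (inL2B Lra La) (inL2B Lrab Lc)))).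
apply: (@le_trans _ _ (eta / 2 + (eta / 2 + (b - a) * e))); last by lra.
apply: lerD; first by rewrite NBC; exact: Hdb.
apply: (le_trans (N_triangle (inL2B Lra La) (inL2B Lrab Lc))).
apply: lerD; first exact: Hda.
rewrite (eqN mu (g := riemann_sum (fun s z => F s z - F tau z) m0.+1 xb xb)); last first.
  by move=> z; rewrite -riemannB (riemann_cst _ _ tab).
apply: (N_riemann_tagged tab) => s sab; split; last exact: modF.
by apply: inL2B => //; exact: inab.
Qed.

End Riemann.

(** * Mild solutions *)

Section Mild.
Context {d : measure_display} {T : measurableType d} {R : realType}.
Variable mu : {measure set T -> \bar R}.
Implicit Types (f g h S : T -> R[i]) (u v F G : R -> T -> R[i]) (a b e delta : R) (x tau : nat -> R).
Variables (E : R -> (T -> R[i]) -> (T -> R[i]) -> Prop) (w : T -> R -> R) (M : R).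
Hypothesis isoE : forall t, isometric_relation mu 1 (E t).
Hypothesis mw : forall t, 0 <= t -> measurable_fun [set: T] (w ^~ t).
Hypothesis M0 : 0 <= M.
Hypothesis wM : forall z t, 0 <= t -> `|w z t| <= M.

Let wsq z t : 0 <= t -> sqn (w z t)%:C <= M ^+ 2.
Proof. by move=> t0; rewrite sqn_real -real_normK ?num_real// ler_sqr ?nnegrE// wM. Qed.

Lemma inL2_pot t f : 0 <= t -> inL2 mu f -> inL2 mu (fun z => (w z t)%:C * f z).
Proof.
move=> t0; apply: (inL2M (C := M ^+ 2)); first exact/cmeas_real/mw.
by move=> z; exact: wsq.
Qed.

Lemma N_pot t f : 0 <= t -> inL2 mu f -> N mu (fun z => (w z t)%:C * f z) <= M * N mu f.
Proof.
move=> t0; apply: N_mul_le => //; first exact/cmeas_real/mw.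
by move=> z; exact: wsq.
Qed.

Definition duhamel (v0 : T -> R[i]) v := forall t, 0 <= t -> exists g F S,
  [/\ E t v0 g, forall s, 0 <= s <= t -> E (t - s) (fun z => (w z s)%:C * v s z) (F s),
    L2_integral mu 0 t F S & N mu (fun z => v t z - (g z + 'i%C * S z)) = 0].

Lemma mildP (v0 : T -> R[i]) v : mild_solution mu E w v0 v <->
  [/\ forall t, 0 <= t -> inL2 mu (v t), L2_continuous mu v & duhamel v0 v].
Proof.
have ae g F S t : inL2 mu (v t) -> E t v0 g -> L2_integral mu 0 t F S ->
    v t = (fun z => g z + 'i%C * S z) %[ae mu] <-> N mu (fun z => v t z - (g z + 'i%C * S z)) = 0.
  move=> hv Eg [hS _]; apply: ae_N0 => //.
  by apply: inL2D; [exact: iso_r (isoE t) _ _ Eg|exact: inL2Z].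
split=> -[hv cv Iv]; split => //; try exact/(L2_continuousP hv).
- move=> t t0; have [g [F [S [Eg EF IF ev]]]] := Iv t t0.
  by exists g, F, S; split => //; exact/(ae _ _ _ _ (hv t t0) Eg IF).
- move=> t t0; have [g [F [S [Eg EF IF ev]]]] := Iv t t0.
  by exists g, F, S; split => //; exact/(ae _ _ _ _ (hv t t0) Eg IF).
Qed.

Lemma mild_lin c (v0 : T -> R[i]) v (v0' : T -> R[i]) v' :
  mild_solution mu E w v0 v -> mild_solution mu E w v0' v' ->
  mild_solution mu E w (fun z => c * v0 z + v0' z) (fun t z => c * v t z + v' t z).
Proof.
move=> /mildP[hv cv Iv] /mildP[hv' cv' Iv']; apply/mildP.
have hs t : 0 <= t -> inL2 mu (fun z => c * v t z + v' t z).
  by move=> t0; apply: inL2D; [apply: inL2Z; exact: hv|exact: hv'].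
have C0 : 0 < Num.sqrt (sqn c) + 1 by rewrite ltr_wpDl// sqrtr_ge0.
have NC f : inL2 mu f -> N mu (fun z => c * f z) <= (Num.sqrt (sqn c) + 1) * N mu f.
  by move=> hf; rewrite NZ//; apply: ler_wpM2r; [exact: N_ge0|rewrite lerDl].
split => //.
- move=> t t0 e e0; set C := Num.sqrt (sqn c) + 1 in C0 NC.
  have eC : 0 < e / (2 * C) by rewrite divr_gt0// mulr_gt0.
  have e2 : 0 < e / 2 by rewrite divr_gt0.
  have [d1 d10 H1] := cv t t0 _ eC; have [d2 d20 H2] := cv' t t0 _ e2.
  exists (Num.min d1 d2); first by rewrite lt_min d10 d20.
  move=> s s0; rewrite lt_min => /andP[/(H1 s s0){}H1 /(H2 s s0){}H2].
  have L1 := inL2B (hv s s0) (hv t t0); have L2 := inL2B (hv' s s0) (hv' t t0).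
  rewrite (eqN mu (g := fun z => c * (v s z - v t z) + (v' s z - v' t z))); last by move=> z; ring.
  apply: (le_trans (N_triangle (inL2Z c L1) L2)).
  rewrite (splitr e); apply: lerD => //.
  apply: (le_trans (NC _ L1)); apply: (@le_trans _ _ (C * (e / (2 * C)))); last first.
    by rewrite le_eqVlt; apply/orP; left; apply/eqP; field; rewrite gt_eqF.
  by apply: ler_wpM2l => //; exact: ltW.
- move=> t t0; have [g [F [S [Eg EF IF ev]]]] := Iv t t0.
  have [g' [F' [S' [Eg' EF' IF' ev']]]] := Iv' t t0.
  exists (fun z => c * g z + g' z), (fun s z => c * F s z + F' s z), (fun z => c * S z + S' z); split.
  + exact: iso_lin (isoE t) _ _ _ _ _ Eg Eg'.
  + move=> s st; have := iso_lin (isoE (t - s)) c (EF s st) (EF' s st).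
    by congr (E _ _ _); apply/funext => z; ring.
  + apply: L2_integral_lin => //.
      by move=> s /EF/(iso_r (isoE _)).
    by move=> s /EF'/(iso_r (isoE _)).
  + case: IF IF' => hS _ [hS' _].
    have hg := iso_r (isoE t) Eg; have hg' := iso_r (isoE t) Eg'.
    have L1 := inL2B (hv t t0) (inL2D hg (inL2Z 'i%C hS)).
    have L2 := inL2B (hv' t t0) (inL2D hg' (inL2Z 'i%C hS')).
    apply/eqP; rewrite eq_le N_ge0 andbT.
    rewrite (eqN mu (g := fun z => c * (v t z - (g z + 'i%C * S z)) +
      (v' t z - (g' z + 'i%C * S' z)))); last by move=> z; ring.
    apply: (le_trans (N_triangle (inL2Z c L1) L2)).
    by rewrite NZ// ev ev' mulr0 addr0.
Qed.

(** A discrete form of [N (v t) <= M int_0^t N (v s) ds]: the estimate is made on Riemann sums over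
    a uniform partition, at the cost of [e], so the scalar function is never integrated. *)
Lemma mild_step (v0 : T -> R[i]) v : mild_solution mu E w v0 v -> N mu v0 = 0 ->
  forall t e, 0 <= t -> 0 < e -> exists n,
  N mu (v t) <= e + M * \sum_(k < n.+1)
    (uniform 0 t n.+1 k.+1 - uniform 0 t n.+1 k) * N mu (v (uniform 0 t n.+1 k)).
Proof.
move=> /mildP[hv cv Iv] N0 t e t0 e0.
have [g [F [S [Eg EF IF ev]]]] := Iv t t0.
have hF s : 0 <= s <= t -> inL2 mu (F s) by move=> /EF/(iso_r (isoE _)).
have [hS /(_ e e0)[delta d0 Hd]] := (L2_integralP _ hF).1 IF.
have [n /(_ _ (leqnn n)) tp] := tagged_uniform t0 d0; exists n.
have {}Hd := Hd _ _ _ tp; set x := uniform 0 t n.+1 in tp Hd *.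
have hR := inL2_riemann_tagged tp hF.
have hg := iso_r (isoE t) Eg.
have Ng : N mu g = 0 by rewrite (iso_N (isoE t) Eg) N0 mulr0.
have L1 := inL2D hg (inL2Z 'i%C hS).
apply: (le_trans (N_lip (hv t t0) L1)); rewrite ev addr0.
apply: (le_trans (N_triangle hg (inL2Z 'i%C hS))); rewrite Ng add0r Ni.
apply: (le_trans (N_lip hS hR)); rewrite addrC; apply: lerD; first by rewrite NBC.
have tk := tagged_le tp.
rewrite mulr_sumr.
apply: (@le_trans _ _ (\sum_(k < n.+1) (x k.+1 - x k) * (M * N mu (v (x k))))).
  apply: (@N_riemann _ _ _ mu F n.+1 x x (fun k => M * N mu (v (x k)))) => k kn; have [h1 h2 h3 h4] := tk k kn => //; first exact: hF.
  rewrite (iso_N (isoE _) (EF _ h4)) mul1r; apply: N_pot => //; exact: hv.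
by apply: ler_sum => k _; rewrite mulrCA.
Qed.

(** The left Riemann sum of an increasing exponential lies below its integral, by [1 + y <= e ^ y]
    on each interval. The right side telescopes. *)
Lemma expR_uniform (L t : R) n k : 0 < L -> 0 <= t ->
  (uniform 0 t n.+1 k.+1 - uniform 0 t n.+1 k) * expR (L * uniform 0 t n.+1 k) <=
  (expR (L * uniform 0 t n.+1 k.+1) - expR (L * uniform 0 t n.+1 k)) / L.
Proof.
move=> L0 t0; set a := uniform _ _ _ k; set b := uniform _ _ _ k.+1.
rewrite ler_pdivlMr//; have -> : L * b = L * a + (b - a) * L by ring.
rewrite expRD; have := expR_ge1Dx ((b - a) * L); have := expR_gt0 (L * a).
set p := expR (L * a); set r := expR _; move=> p0 h.
have -> : p * r - p = p * (r - 1) by ring.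
have -> : (b - a) * p * L = p * ((b - a) * L) by ring.
by apply: ler_wpM2l; [exact: ltW|lra].
Qed.

(** Iterating [phi(t) <= M int_0^t phi] improves a bound [B e^{L t}] by the
    factor [M / L <= 1/2] at each step. *)
Lemma mild_zero (v0 : T -> R[i]) v : mild_solution mu E w v0 v -> N mu v0 = 0 ->
  forall t, 0 <= t -> N mu (v t) = 0.
Proof.
move=> Hv N0 a a0; have step := mild_step Hv N0.
have [hv cv _] := (mildP _ _).1 Hv.
have [B B0 HB] := L2_continuous_bounded a hv cv.
(* [M + 1] in place of [M] keeps [L] positive when [M = 0]. *)
pose L := 2 * (M + 1); have L0 : 0 < L by rewrite mulr_gt0// ltr_wpDl.
have bound j t : 0 <= t <= a -> N mu (v t) <= B * 2^-1 ^+ j * expR (L * t).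
  elim: j t => [|j IH] t /andP[t0 ta].
    rewrite mulr1; apply: (le_trans (HB t _)); first by rewrite t0.
    by rewrite ler_peMr// -expR0 ler_expR mulr_ge0// ltW.
  apply/ler_addgt0Pl => e e0; have [n Hn] := step t e t0 e0.
  apply: (le_trans Hn); rewrite lerD2l.
  have u0t k : (k <= n.+1)%N -> 0 <= uniform 0 t n.+1 k <= a.
    move=> kn; rewrite /uniform add0r subr0.
    rewrite divr_ge0 ?mulr_ge0//= ler_pdivrMr ?ltr0n//.
    by apply: ler_pM => //; rewrite ler_nat.
  set x := uniform 0 t n.+1 in Hn u0t *.
  have s1 : \sum_(k < n.+1) (x k.+1 - x k) * N mu (v (x k)) <=
      B * 2^-1 ^+ j * ((expR (L * t) - 1) / L).
    apply: (@le_trans _ _ (\sum_(k < n.+1) B * 2^-1 ^+ j * ((expR (L * x k.+1) - expR (L * x k)) / L))).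
      apply: ler_sum => k _.
      have hd : 0 <= x k.+1 - x k by rewrite uniform_diff subr0 divr_ge0.
      apply: (le_trans (ler_wpM2l hd (IH _ (u0t k (ltnW (ltn_ord k)))))).
      rewrite mulrCA; apply: ler_wpM2l; first by rewrite mulr_ge0// exprn_ge0.
      exact: expR_uniform.
    rewrite -mulr_sumr -mulr_suml -(big_mkord xpredT (fun k => expR (L * x k.+1) - expR (L * x k))).
    by rewrite (telescope_sumr (fun k => expR (L * x k)))// /x uniform0 uniformn mulr0 expR0.
  have Bj : 0 <= B * 2^-1 ^+ j by rewrite mulr_ge0// exprn_ge0.
  apply: (le_trans (ler_wpM2l M0 s1)).
  have p0 := expR_gt0 (L * t).
  have -> : M * (B * 2^-1 ^+ j * ((expR (L * t) - 1) / L)) =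
     B * 2^-1 ^+ j * (2^-1 * ((expR (L * t) - 1) * (M / (M + 1)))).
    by rewrite /L; field; rewrite gt_eqF// ltr_wpDl.
  have -> : B * 2^-1 ^+ j.+1 * expR (L * t) = B * 2^-1 ^+ j * (2^-1 * expR (L * t)).
    by rewrite exprSr; ring.
  apply: ler_wpM2l => //; apply: ler_wpM2l => //.
  have p1 : 1 <= expR (L * t) by rewrite -expR0 ler_expR mulr_ge0// ltW.
  have r1 : M / (M + 1) <= 1 by rewrite ler_pdivrMr ?ltr_wpDl// mul1r lerDl.
  apply: (@le_trans _ _ (expR (L * t) - 1)); last by lra.
  by rewrite ler_piMr// subr_ge0.
apply/eqP; rewrite eq_le N_ge0 andbT.
apply: le_eps => e e0.
have cv0 : (fun j => B * 2^-1 ^+ j * expR (L * a)) @ \oo --> 0.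
  have -> : 0 = B * 0 * expR (L * a) by rewrite mulr0 mul0r.
  apply: cvgM; last exact: cvg_cst.
  apply: cvgM; first exact: cvg_cst.
  by apply: cvg_expr; rewrite ger0_norm ?invr_ge0// invf_lt1// ltr1n.
have [j Hj] := cvg0_ex cv0 e0.
by apply: le_trans (Hj j (leqnn j)); apply: bound; rewrite a0 lexx.
Qed.

Lemma mild_unique (v0 : T -> R[i]) v v' : mild_solution mu E w v0 v ->
  mild_solution mu E w v0 v' ->
  forall t, 0 <= t -> N mu (fun z => v t z - v' t z) = 0.
Proof.
move=> Hv Hv' t t0; have := mild_zero (mild_lin (-1) Hv' Hv) _ t0.
rewrite (@eqN _ _ _ mu (fun z => -1 * v' t z + v t z) (fun z => v t z - v' t z)); last by move=> z; ring.
by apply; rewrite -[RHS](N0 mu); apply: eqN => z; ring.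
Qed.

(** An isometric relation may be empty, so that [E] relates [0] to [0] is extracted from an existing
    solution, subtracted from itself. *)
Lemma mild_zero_exists (v0 : T -> R[i]) v : mild_solution mu E w v0 v ->
  mild_solution mu E w (fun=> 0) (fun _ _ => 0).
Proof.
move=> Hv; have := mild_lin (-1) Hv Hv; congr (mild_solution mu E w _ _).
  by apply/funext => z; ring.
by apply/funext => t; apply/funext => z; ring.
Qed.

Lemma mild_sum n (v0 : nat -> T -> R[i]) (v : nat -> R -> T -> R[i]) :
  (forall k, mild_solution mu E w (v0 k) (v k)) ->
  mild_solution mu E w (fun z => \sum_(k < n) v0 k z) (fun t z => \sum_(k < n) v k t z).
Proof.
move=> Hv; elim: n => [|n IH].
  have := mild_zero_exists (Hv 0%N); congr (mild_solution mu E w _ _).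
    by apply/funext => z; rewrite big_ord0.
  by apply/funext => t; apply/funext => z; rewrite big_ord0.
have := mild_lin 1 IH (Hv n); congr (mild_solution mu E w _ _).
  by apply/funext => z; rewrite big_ord_recr mul1r.
by apply/funext => t; apply/funext => z; rewrite big_ord_recr mul1r.
Qed.

Hypothesis totE : forall t, 0 <= t -> forall f, inL2 mu f -> exists g, E t f g.

(** The Duhamel equations of the [u k] need no convergence of their integrals: the rate [r], uniform
    in time, controls the Riemann sums of [F] against those of [Fk], and the candidate [S] against
    [Sk]. *)
Lemma mild_limit (v0 : T -> R[i]) v (f : nat -> T -> R[i]) (u : nat -> R -> T -> R[i]) (r : nat -> R) :
  inL2 mu v0 -> (forall t, 0 <= t -> inL2 mu (v t)) ->
  (forall k, mild_solution mu E w (f k) (u k)) ->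
  (forall k, inL2 mu (f k)) ->
  r @ \oo --> 0 ->
  (forall k, N mu (fun z => f k z - v0 z) <= r k) ->
  (forall k t, 0 <= t -> N mu (fun z => u k t z - v t z) <= r k) ->
  mild_solution mu E w v0 v.
Proof.
move=> hv0 hv Hu hf r0 Hf Huv; apply/mildP.
have Hu' k := (mildP _ _).1 (Hu k).
have hu k t : 0 <= t -> inL2 mu (u k t) by case: (Hu' k) => h _ _; exact: h.
split => //.
- move=> t t0 e e0; have e3 : 0 < e / 3 by rewrite divr_gt0.
  have [k /(_ k (leqnn k)) rk] := cvg0_ex r0 e3.
  have [_ cu _] := Hu' k; have [delta d0 Hd] := cu t t0 _ e3; exists delta => // s s0 st.
  apply: (le_trans (@N_split _ _ _ mu (u k s) _ _ (hv s s0) (hv t t0) (hu k s s0))).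
  have h1 : N mu (fun z => v s z - u k s z) <= e / 3 by rewrite NBC (le_trans (Huv k s s0)).
  have h2 := @N_split _ _ _ mu (u k t) _ _ (hu k s s0) (hv t t0) (hu k t t0).
  have h3 := Hd s s0 st; have h4 := le_trans (Huv k t t0) rk.
  clear -h1 h2 h3 h4; lra.
- move=> t t0; have [g Eg] := totE t0 hv0.
  have totF s : exists Fs : T -> R[i], 0 <= s <= t -> E (t - s) (fun z => (w z s)%:C * v s z) Fs.
    have [/andP[s0 st]|_] := boolP (0 <= s <= t); last by exists (fun=> 0).
    have ts : 0 <= t - s by rewrite subr_ge0.
    by have [F HF] := totE ts (inL2_pot s0 (hv s s0)); exists F.
  have [F EF] := choice totF.
  have hF s : 0 <= s <= t -> inL2 mu (F s) by move=> /EF/(iso_r (isoE _)).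
  have hg := iso_r (isoE t) Eg.
  (* The Duhamel equation solved for its integral term, with [1 / i = - i]. *)
  pose S z := - 'i%C * (v t z - g z).
  have hS : inL2 mu S by apply: inL2Z; exact: inL2B (hv t t0) hg.
  exists g, F, S; split => //.
    apply/L2_integralP => //; split => // e e0.
    (* [t M r] bounds the difference of the Riemann sums; [2 r] bounds that of the integrals, once
       for the solutions at time [t] and once for the propagated data. *)
    have K0 : 0 < 2 + t * M by rewrite ltr_wpDr// mulr_ge0.
    have e1 : 0 < e / 2 / (2 + t * M) by rewrite !divr_gt0.
    have e2 : 0 < e / 2 by rewrite divr_gt0.
    have [k /(_ k (leqnn k)) rk] := cvg0_ex r0 e1.
    have [_ _ Ik] := Hu' k; have [gk [Fk [Sk [Egk EFk IFk evk]]]] := Ik t t0.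
    have hFk s : 0 <= s <= t -> inL2 mu (Fk s) by move=> /EFk/(iso_r (isoE _)).
    have [hSk /(_ _ e2)[delta d0 Hd]] := (L2_integralP _ hFk).1 IFk.
    have hgk := iso_r (isoE t) Egk.
    exists delta => // n x tau tp; have {}Hd := Hd n x tau tp.
    have hR := inL2_riemann_tagged tp hF; have hRk := inL2_riemann_tagged tp hFk.
    have s1 : N mu (fun z => riemann_sum F n x tau z - riemann_sum Fk n x tau z) <= t * M * r k.
      rewrite (eqN mu (riemannB F Fk n x tau)) -[X in X * M * _](subr0 t) -mulrA.
      apply: (N_riemann_tagged tp) => s st; split; first by apply: inL2B; [exact: hF|exact: hFk].
      have /andP[s0 _] := st.
      rewrite (iso_NB (isoE _) (EF s st) (EFk s st)) mul1r.
      rewrite (eqN mu (g := fun z => (w z s)%:C * (v s z - u k s z))); last by move=> z; ring.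
      apply: (le_trans (N_pot s0 (inL2B (hv s s0) (hu k s s0)))).
      by apply: ler_wpM2l => //; rewrite NBC; exact: Huv.
    have hd := inL2B (hu k t t0) (inL2D hgk (inL2Z 'i%C hSk)).
    have s2 : N mu (fun z => Sk z - S z) <= 2 * r k.
      rewrite -Ni (eqN mu (g := fun z => ((u k t z - v t z) - (gk z - g z)) -
         (u k t z - (gk z + 'i%C * Sk z)))); last first.
        move=> z; rewrite /S; have ii : 'i%C * 'i%C = -1 :> R[i] by rewrite -expr2 sqr_i.
        transitivity ('i%C * Sk z + ('i%C * 'i%C) * (v t z - g z)); first by ring.
        by rewrite ii; ring.
      have ha := inL2B (hu k t t0) (hv t t0); have hb := inL2B hgk hg.
      apply: (le_trans (N_triangleB (inL2B ha hb) hd)); rewrite evk addr0.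
      apply: (le_trans (N_triangleB ha hb)).
      rewrite (iso_NB (isoE t) Egk Eg) mul1r.
      have h1 := Huv k t t0; have h2 := Hf k; clear -h1 h2; lra.
    apply: (le_trans (@N_split _ _ _ mu (riemann_sum Fk n x tau) _ _ hR hS hRk)).
    have s3 := @N_split _ _ _ mu Sk _ _ hRk hS hSk.
    have s4 : (2 + t * M) * r k <= e / 2.
      apply: (le_trans (ler_wpM2l (ltW K0) rk)).
      by rewrite le_eqVlt; apply/orP; left; apply/eqP; field; rewrite gt_eqF.
    clear -s1 s2 s3 s4 Hd; lra.
  rewrite -[RHS](N0 mu); apply: eqN => z; rewrite /S.
  have ii : 'i%C * 'i%C = -1 :> R[i] by rewrite -expr2 sqr_i.
  transitivity (v t z - g z + ('i%C * 'i%C) * (v t z - g z)); first by ring.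
  by rewrite ii; ring.
Qed.

End Mild.

(** * Tensor products of solutions *)

Section Potential.
Context {R : realType}.
Implicit Types (q : R -> R -> R).

Lemma pot_bound q : continuous_bounded q ->
  exists2 M : R, 0 <= M & forall x t, 0 <= t -> `|q x t| <= M.
Proof.
move=> [_ [M HM]]; exists M => //.
by apply: le_trans (HM 0 0 (lexx 0)).
Qed.

Lemma pot_cvg q (x t : R) {U : Type} (F : set_system U) (f : U -> R * R) : Filter F ->
  continuous_bounded q -> 0 <= t -> (forall u, 0 <= (f u).2) -> f @ F --> (x, t) ->
  (fun u => q (f u).1 (f u).2) @ F --> q x t.
Proof.
move=> FF [/subspace_continuousP/(_ (x, t)) cq _] t0 f0 Fx A /(cq t0) wA.
have := Fx _ wA; rewrite /= nbhs_simpl => h.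
apply: (@filterS _ F FF _ _ _ h) => u hu; exact: hu (f0 u).
Qed.

Lemma pot_cvg_seq q (x t : R) (s : nat -> R) : continuous_bounded q -> (forall k, 0 <= s k) ->
  0 <= t -> s @ \oo --> t -> (fun k => q x (s k)) @ \oo --> q x t.
Proof.
move=> hq s0 t0 st.
apply: (@pot_cvg q x t _ \oo (fun k => (x, s k))) => //.
exact: (cvg_pair (cvg_cst x) st).
Qed.

Lemma pot_measurable q (t : R) : continuous_bounded q -> 0 <= t ->
  measurable_fun [set: measurableTypeR R] (q ^~ t).
Proof.
move=> hq t0; apply: continuous_measurable_fun => x.
apply: (@pot_cvg q x t _ (nbhs x) (fun x' => (x', t))) => //.
exact: (cvg_pair cvg_id (cvg_cst t)).
Qed.

Lemma ccvg_cis (k t : R) (s : nat -> R) : s @ \oo --> t ->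
  ccvg (fun n => cis (s n * k) - cis (t * k)) 0.
Proof.
move=> st; have stk : (fun n => s n * k) @ \oo --> t * k by apply: cvgM => //; exact: cvg_cst.
split.
- have -> : (fun n => re (cis (s n * k) - cis (t * k))) = (fun n => cos (s n * k) - cos (t * k)) by [].
  have -> : re (0 : R[i]) = cos (t * k) - cos (t * k) by rewrite subrr.
  apply: cvgB; last exact: cvg_cst.
  exact: (cvg_comp _ _ stk (@continuous_cos R _)).
- have -> : (fun n => im (cis (s n * k) - cis (t * k))) = (fun n => sin (s n * k) - sin (t * k)) by [].
  have -> : im (0 : R[i]) = sin (t * k) - sin (t * k) by rewrite subrr.
  apply: cvgB; last exact: cvg_cst.
  exact: (cvg_comp _ _ stk (@continuous_sin R _)).
Qed.

End Potential.

(** * Continuity along sequences *)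

Section SequentialContinuity.
Context {d : measure_display} {T : measurableType d} {R : realType}.
Variable mu : {measure set T -> \bar R}.
Implicit Types (v : R -> T -> R[i]).

(** Lets dominated convergence, which speaks of sequences, prove continuity in time. *)
Lemma L2_continuous_of_seq v :
  (forall (t : R) (s : nat -> R), 0 <= t -> (forall k, 0 <= s k) -> s @ \oo --> t ->
    (fun k => N mu (fun z => v (s k) z - v t z)) @ \oo --> 0) -> L2_continuous mu v.
Proof.
move=> H t t0 e e0; apply: contrapT => nex.
have bad k : exists s : R, [/\ 0 <= s, `|s - t| < k.+1%:R^-1 &
    e < N mu (fun z => v s z - v t z)].
  apply: contrapT => ns; apply: nex; exists k.+1%:R^-1; first by rewrite invr_gt0.
  move=> s s0 st; rewrite leNgt; apply/negP => h; apply: ns; by exists s.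
have [s Hs] := choice bad.
have st : s @ \oo --> t.
  apply/cvgrPdist_le => e' e'0; have [n _ Hn] := (cvgrPdist_le _ _).1 (@cvg_harmonic R) _ e'0.
  exists n => // k nk; have [_ h _] := Hs k.
  rewrite distrC; apply: (le_trans (ltW h)); have := Hn k nk.
  by rewrite sub0r normrN ger0_norm /harmonic ?invr_ge0.
have [n Hn] := cvg0_ex (H t s t0 (fun k => let: And3 h _ _ := Hs k in h) st) e0.
by have [_ _] := Hs n; rewrite ltNge Hn.
Qed.

Lemma L2_continuous_seq v (t : R) (s : nat -> R) : L2_continuous mu v -> 0 <= t ->
  (forall k, 0 <= s k) -> s @ \oo --> t ->
  (fun k => N mu (fun z => v (s k) z - v t z)) @ \oo --> 0.
Proof.
move=> cv t0 s0 st; apply/cvgrPdist_le => e e0.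
have [delta d0 Hd] := cv t t0 e e0.
have [n _ Hn] := (cvgrPdist_lt _ _).1 st _ d0; exists n => // k nk.
by rewrite sub0r normrN ger0_norm ?N_ge0//; apply: Hd => //; rewrite distrC; exact: Hn.
Qed.

Lemma L2_integral_ae (a b : R) (F : R -> T -> R[i]) S S' :
  (forall s, a <= s <= b -> inL2 mu (F s)) -> L2_integral mu a b F S -> inL2 mu S' ->
  N mu (fun z => S z - S' z) = 0 -> L2_integral mu a b F S'.
Proof.
move=> hF /(L2_integralP _ hF)[hS H] hS' e0; apply/(L2_integralP _ hF); split => // e /H[delta d0 Hd].
exists delta => // n x tau tp.
apply: (le_trans (@N_split _ _ _ mu S _ _ (inL2_riemann_tagged tp hF) hS' hS)).
by rewrite e0 addr0; exact: Hd.
Qed.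

(** A propagator value comes with some transform of [f], given only by existence. Any transform of
    [f] fixed beforehand serves as well, because the two differ by a null function. *)
Lemma isometric_multiplierE (c : R) (E : (T -> R[i]) -> (T -> R[i]) -> Prop) (m : T -> R[i]) f fh g :
  isometric_relation mu c E -> cmeas m -> (forall x, sqn (m x) = 1) -> E f fh ->
  (exists2 fh, E f fh & E g (fun x => m x * fh x)) -> E g (fun x => m x * fh x).
Proof.
move=> isoE mm m1 Ef [fh' Ef' Eg].
apply: (iso_ae isoE Eg (iso_l isoE Eg)).
- by apply: (inL2M (C := 1)) => //; [move=> x; rewrite m1|exact: (iso_r isoE Ef)].
- by rewrite -[RHS](N0 mu); apply: eqN => x; rewrite subrr.
- rewrite (eqN mu (g := fun x => m x * (fh' x - fh x))); last by move=> x; rewrite mulrBr.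
  rewrite NM_unit// (iso_NB isoE Ef' Ef) (eqN mu (g := fun=> 0)) ?N0 ?mulr0//.
  by move=> x; rewrite subrr.
Qed.

End SequentialContinuity.

(** * Solutions on the Fourier side *)

Section Profile.
Context {R : realType}.
Local Notation mu := (leb R).
Local Notation s2pi := (Num.sqrt (2 * pi : R)).

Lemma cmeas_phase (eps t : R) : cmeas (fun xi : measurableTypeR R => cis (t * (eps * xi ^+ 2))).
Proof.
by apply: cmeas_cis; apply: measurable_funM => //; apply: measurable_funM => //; exact: measurable_funX.
Qed.

Lemma sqn_sub_cis (a b : R) : sqn (cis a - cis b) <= 4.
Proof.
apply: le_trans (sqnD_le _ _) _; rewrite -[- cis b]mulN1r sqnM !sqn_cis mulr1.
have -> : sqn (-1 : R[i]) = 1 by rewrite /sqn /= oppr0 expr0n addr0 sqrrN expr1n.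
by lra.
Qed.

Variables (eps : R) (q : R -> R -> R) (a : R -> R[i]) (v : R -> R -> R[i]).
Hypothesis hq : continuous_bounded q.
Hypothesis Hv : schrodinger1 eps q a v.

(** Multiplying the Duhamel equation on the Fourier side by the inverse phase
    removes the propagator from the integral. *)
Lemma schrodinger_profile : exists (vh nh : R -> R -> R[i]) (ah : R -> R[i]),
  let V t := fun xi => cis (t * (eps * xi ^+ 2)) * vh t xi in
  let G t := fun xi => cis (t * (eps * xi ^+ 2)) * nh t xi in
  [/\ fourier1 a ah, forall t, 0 <= t -> fourier1 (v t) (vh t),
    forall t, 0 <= t -> fourier1 (fun x => (q x t)%:C * v t x) (nh t),
    L2_continuous mu G &
    forall t, 0 <= t -> L2_integral mu 0 t G (fun xi => - 'i%C * (V t xi - ah xi))].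
Proof.
have [M M0 HM] := pot_bound hq.
have [hv cv Iv] := (mildP _ (isometric_free1 eps) _ _).1 Hv.
have mq t (t0 : 0 <= t) := pot_measurable hq t0.
have potL := @inL2_pot _ _ _ mu q M mq M0 HM.
have potN := @N_pot _ _ _ mu q M mq M0 HM.
have hn t : 0 <= t -> inL2 mu (fun x => (q x t)%:C * v t x).
  by move=> t0; apply: potL => //; exact: hv.
have tot (f : R -> R -> R[i]) t : exists fh, 0 <= t -> inL2 mu (f t) -> fourier1 (f t) fh.
  have [t0|_] := boolP (0 <= t); last by exists (fun=> 0).
  have [hf|nf] := pselect (inL2 mu (f t)); last by exists (fun=> 0).
  by have [fh] := fourier1_total hf; exists fh.
have [vh Hvh] := choice (tot v).
have [nh Hnh] := choice (tot (fun t x => (q x t)%:C * v t x)).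
have {}Hvh t (t0 : 0 <= t) := Hvh t t0 (hv t t0).
have {}Hnh t (t0 : 0 <= t) := Hnh t t0 (hn t t0).
have isoF := @isometric_fourier1 R.
have [ah Fa] : exists ah, fourier1 a ah.
  have [g [F [S [[ah Fa _] _ _ _]]]] := Iv 0 (lexx 0); by exists ah.
have lnh t (t0 : 0 <= t) := iso_r isoF (Hnh t t0).
have lvh t (t0 : 0 <= t) := iso_r isoF (Hvh t t0).
exists vh, nh, ah => V G; split => //.
- apply: L2_continuous_of_seq => t s t0 s0 st.
  (* Three errors: the displacements of [v] and of the potential, both measured before the
     transform, and that of the phase on the Fourier side. *)
  pose r k := s2pi * (M * N mu (fun x => v (s k) x - v t x) +
     N mu (fun x => (q x (s k) - q x t)%:C * v t x)) +
     N mu (fun xi => (cis (s k * (eps * xi ^+ 2)) - cis (t * (eps * xi ^+ 2))) * nh t xi).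
  have mqs k : cmeas (fun x : measurableTypeR R => (q x (s k) - q x t)%:C).
    by apply: cmeas_real; apply: measurable_funB; apply: pot_measurable.
  have bqs k (x : R) : sqn (q x (s k) - q x t)%:C <= (2 * M) ^+ 2.
    rewrite sqn_real -real_normK ?num_real// ler_sqr ?nnegrE ?mulr_ge0//.
    by apply: (le_trans (ler_normB _ _)); have := HM x _ (s0 k); have := HM x _ t0; lra.
  have mcs k : cmeas (fun xi : measurableTypeR R => cis (s k * (eps * xi ^+ 2)) - cis (t * (eps * xi ^+ 2))).
    rewrite (_ : (fun xi => _) = fun xi : measurableTypeR R => cis (s k * (eps * xi ^+ 2)) + (-1) * cis (t * (eps * xi ^+ 2))).
      apply: cmeasD; first exact: cmeas_phase.
      apply: cmeasM; [exact: cmeas_cst|exact: cmeas_phase].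
    by apply/funext => xi; rewrite mulN1r.
  apply: (@cvg0_le _ _ r) => [k|k|]; first exact: N_ge0.
    rewrite /r /G.
    rewrite (@eqN _ _ _ mu (fun z => _ - _) (fun xi => cis (s k * (eps * xi ^+ 2)) * (nh (s k) xi - nh t xi) +
      (cis (s k * (eps * xi ^+ 2)) - cis (t * (eps * xi ^+ 2))) * nh t xi)); last by move=> xi; ring.
    have L0 := inL2B (lnh _ (s0 k)) (lnh _ t0).
    have L1 : inL2 mu (fun xi => cis (s k * (eps * xi ^+ 2)) * (nh (s k) xi - nh t xi)).
      by apply: (inL2M (C := 1)) => //; [exact: cmeas_phase|move=> x; rewrite sqn_cis].
    have L2 : inL2 mu (fun xi => (cis (s k * (eps * xi ^+ 2)) - cis (t * (eps * xi ^+ 2))) * nh t xi).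
      apply: (inL2M (C := 4)); [exact: mcs|move=> xi; exact: sqn_sub_cis|exact: lnh].
    apply: (le_trans (N_triangle L1 L2)); rewrite lerD2r NM_unit; last by move=> x; exact: sqn_cis.
    rewrite (iso_NB isoF (Hnh _ (s0 k)) (Hnh _ t0)); apply: ler_wpM2l; first exact: sqrtr_ge0.
    have D := inL2B (hv _ (s0 k)) (hv _ t0).
    rewrite (@eqN _ _ _ mu (fun z => _ - _) (fun x => (q x (s k))%:C * (v (s k) x - v t x) +
      (q x (s k) - q x t)%:C * v t x)); last by move=> x; rewrite rmorphB /=; ring.
    apply: (le_trans (N_triangle (potL _ _ (s0 k) D) _)).
      exact: (inL2M (mqs k) (bqs k) (hv _ t0)).
    rewrite lerD2r; exact: (potN _ _ (s0 k) D).
  have -> : 0 = s2pi * (M * 0 + 0) + 0 by rewrite mulr0 !addr0 mulr0.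
  apply: cvgD.
    apply: cvgM; first exact: cvg_cst.
    apply: cvgD; first by apply: cvgM; [exact: cvg_cst|exact: L2_continuous_seq].
    apply: (N_mul_cvg0 mqs bqs); last exact: hv.
    move=> x; split; last by apply: cvg_cst.
    have -> : re (0 : R[i]) = q x t - q x t by rewrite subrr.
    by apply: cvgB; [exact: pot_cvg_seq|exact: cvg_cst].
  apply: (N_mul_cvg0 mcs (fun k xi => sqn_sub_cis _ _)); last exact: lnh.
  by move=> xi; exact: ccvg_cis.
- move=> t t0; have [g [F [S [Eg EF IF ev]]]] := Iv t t0.
  have hF s : 0 <= s <= t -> inL2 mu (F s) by move=> /EF/(iso_r (isometric_free1 eps _)).
  have [hS HS] := (L2_integralP _ hF).1 IF.
  have m1 u xi : sqn (cis (- (u * (eps * xi ^+ 2)))) = 1 :> R by exact: sqn_cis.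
  have mm u : cmeas (fun xi : measurableTypeR R => cis (- (u * (eps * xi ^+ 2)))).
    rewrite (_ : (fun xi => _) = fun xi : measurableTypeR R => cis ((- u) * (eps * xi ^+ 2))); first exact: cmeas_phase.
    by apply/funext => xi; rewrite mulNr.
  have Fg := isometric_multiplierE isoF (mm t) (m1 t) Fa Eg.
  pose Fh s xi := cis (- ((t - s) * (eps * xi ^+ 2))) * nh s xi.
  have FF s : 0 <= s <= t -> fourier1 (F s) (Fh s).
    move=> st; have /andP[s0 _] := st.
    exact: (isometric_multiplierE isoF (mm (t - s)) (m1 (t - s)) (Hnh s s0) (EF s st)).
  have hG s : 0 <= s <= t -> inL2 mu (G s).
    by move=> /andP[/lnh h _]; apply: (inL2M (C := 1)) => //; [exact: cmeas_phase|move=> x; rewrite sqn_cis].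
  have [Sh FS] := fourier1_total hS.
  have hSh := iso_r isoF FS.
  have mSh f : inL2 mu f -> inL2 mu (fun xi => cis (t * (eps * xi ^+ 2)) * f xi).
    by apply: (inL2M (C := 1)) => //; [exact: cmeas_phase|move=> x; rewrite sqn_cis].
  (* The transform of the Duhamel integral, multiplied by the phase of [t], is the integral of [G]:
     the phase of [t] combines with the inverse phase of [t - s] to the phase of [s]. *)
  apply: (@L2_integral_ae _ _ _ mu 0 t G (fun xi => cis (t * (eps * xi ^+ 2)) * Sh xi)) => //.
  + apply/(L2_integralP _ hG); split; first exact: mSh.
    move=> e e0; have ec : 0 < e / s2pi by rewrite divr_gt0// s2pi_gt0.
    have [delta d0 Hd] := HS _ ec; exists delta => // n x tau tp.
    have {}Hd := Hd n x tau tp.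
    have FR : fourier1 (riemann_sum F n x tau) (riemann_sum Fh n x tau).
      apply: (@iso_sum _ _ _ mu s2pi _ isoF n (fun k z => (x k.+1 - x k)%:C * F (tau k) z)
        (fun k z => (x k.+1 - x k)%:C * Fh (tau k) z)); first exact: (iso0 isoF Fa).
      move=> k kn; apply: (isoZ isoF); apply: FF.
      by have [] := tagged_le tp kn.
    rewrite (@eqN _ _ _ mu (fun z => _ - _) (fun xi => cis (t * (eps * xi ^+ 2)) * (riemann_sum Fh n x tau xi - Sh xi))).
      rewrite NM_unit; last by move=> xi; exact: sqn_cis.
      by rewrite (iso_NB isoF FR FS) mulrC -ler_pdivlMr ?s2pi_gt0.
    move=> xi; rewrite mulrBr; congr (_ - _); rewrite /riemann_sum mulr_sumr; apply: eq_bigr => k _.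
    rewrite [RHS]mulrCA; congr (_ * _); rewrite /G /Fh [RHS]mulrA -cisD.
    by congr (cis _ * _); ring.
  + by apply: inL2Z; apply: inL2B (mSh _ (lvh t t0)) (iso_r isoF Fa).
  (* [vh t] agrees, up to a null function, with the transform of the right side of the Duhamel
     equation; multiplying by [i] and the phase of [t] gives the claim. *)
  + have FgS := isoD isoF Fg (isoZ isoF 'i%C FS).
    have e0 := iso_NB isoF (Hvh t t0) FgS; rewrite ev mulr0 in e0; apply: etrans e0.
    rewrite -(@NM_unit _ _ _ mu (fun xi => 'i%C * cis (t * (eps * xi ^+ 2)))
      (fun x => vh t x - (cis (- (t * (eps * x ^+ 2))) * ah x + 'i%C * Sh x))); last first.
      by move=> xi; rewrite sqnM sqn_cis mulr1 /sqn /= expr0n add0r expr1n.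
    apply: eqN => xi; rewrite /V.
    have ii : 'i%C * 'i%C = -1 :> R[i] by rewrite -expr2 sqr_i.
    have cc : cis (t * (eps * xi ^+ 2)) * cis (- (t * (eps * xi ^+ 2))) = 1 :> R[i].
      by rewrite -cisD subrr cis0.
    set c := cis (t * _) in cc *; set c' := cis (- _) in cc *.
    transitivity ('i%C * c * vh t xi - 'i%C * (c * c') * ah xi - ('i%C * 'i%C) * c * Sh xi); last by ring.
    by rewrite cc ii; ring.
Qed.

End Profile.

(** * Primitives in L2 *)

Section Primitive.
Context {d : measure_display} {T : measurableType d} {R : realType}.
Variable mu : {measure set T -> \bar R}.

(** Up to the factor [i], [V] is the primitive of [G] with initial value [A]. *)
Definition L2_primitive (G V : R -> T -> R[i]) (A : T -> R[i]) :=
  [/\ inL2 mu A, forall t, 0 <= t -> inL2 mu (V t), forall t, 0 <= t -> inL2 mu (G t),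
    L2_continuous mu G &
    forall t, 0 <= t -> L2_integral mu 0 t G (fun z => - 'i%C * (V t z - A z))].

Variables (G V : R -> T -> R[i]) (A : T -> R[i]).
Hypothesis HP : L2_primitive G V A.

(** [V b - V a] is [i] times the integral of [G], so the two terms nearly cancel: this is a
    first-order Taylor remainder, controlled by the oscillation of [G]. *)
Lemma primitive_increment (a b tau e : R) : 0 <= a -> a <= b -> a <= tau <= b ->
  (forall s, a <= s <= b -> N mu (fun z => G s z - G tau z) <= e) ->
  N mu (fun z => (b - a)%:C * G tau z + 'i%C * (V b z - V a z)) <= (b - a) * e.
Proof.
move=> a0 ab atb modG; have [_ _ hG _ IV] := HP.
have hG' t : 0 <= t <= b -> inL2 mu (G t) by move=> /andP[/hG].
have IV' t : 0 <= t <= b -> L2_integral mu 0 t G (fun z => - 'i%C * (V t z - A z)).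
  by move=> /andP[/IV].
have := L2_integral_increment hG' IV' a0 ab (lexx b) atb modG.
rewrite -NN; congr (_ <= _); apply: eqN => z; ring.
Qed.

Lemma primitive_start : N mu (fun z => V 0 z - A z) = 0.
Proof.
have [hA hV hG _ IV] := HP.
have hG' t : 0 <= t <= 0 -> inL2 mu (G t) by move=> /andP[/hG].
have [hS HS] := (L2_integralP _ hG').1 (IV 0 (lexx 0)).
apply/eqP; rewrite eq_le N_ge0 andbT; apply: le_eps => e e0.
have [delta d0 Hd] := HS e e0.
(* The empty partition of [[0, 0]] has Riemann sum [0], which forces the integral to be null. *)
have tp : tagged_partition 0 0 delta 0 (fun=> 0 : R) (fun=> 0) by split.
have := Hd _ _ _ tp; rewrite -(Ni mu (fun z => V 0 z - A z)).
by congr (_ <= _); apply: eqN => z; rewrite /riemann_sum big_ord0; ring.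
Qed.

Lemma primitive_continuous : L2_continuous mu V.
Proof.
have [hA hV hG cG IV] := HP.
move=> t t0 e e0.
have [B B0 HB] := L2_continuous_bounded (t + 1) hG cG.
(* A Lipschitz constant on [[0, t + 1]]: [2 B] bounds the oscillation of [G] and [B] its value at
   [a], while the [+ 1] allows division when [B = 0]. *)
have C0 : 0 < 3 * B + 1 by rewrite ltr_wpDl// mulr_ge0.
have lip (a b : R) : 0 <= a -> a <= b -> b <= t + 1 ->
    N mu (fun z => V b z - V a z) <= (b - a) * (3 * B + 1).
  move=> a0 ab bt.
  have b0 := le_trans a0 ab.
  have inB s : a <= s <= b -> 0 <= s <= t + 1.
    by move=> /andP[as_ sb]; rewrite (le_trans a0 as_) (le_trans sb bt).
  have modG s : a <= s <= b -> N mu (fun z => G s z - G a z) <= 2 * B.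
    move=> /inB s01; have /andP[s0 _] := s01.
    have a01 : 0 <= a <= t + 1 by rewrite a0 (le_trans ab bt).
    apply: (le_trans (N_triangleB (hG s s0) (hG a a0))).
    by have := HB s s01; have := HB a a01; lra.
  have aab : a <= a <= b by rewrite lexx.
  have := primitive_increment a0 ab aab modG.
  rewrite -(Ni mu (fun z => V b z - V a z)) => h.
  have L1 := inL2Z (b - a)%:C (hG a a0).
  have L2 := inL2Z 'i%C (inL2B (hV b b0) (hV a a0)).
  rewrite (eqN mu (g := fun z => ((b - a)%:C * G a z + 'i%C * (V b z - V a z)) - (b - a)%:C * G a z)); last first.
    by move=> z; ring.
  apply: (le_trans (N_triangleB (inL2D L1 L2) L1)).
  have ba : 0 <= b - a by rewrite subr_ge0.
  rewrite (NZr _ (hG a a0)) ger0_norm//.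
  have := ler_wpM2l ba (HB a (inB a aab)).
  have : 0 <= b - a by []; nra.
exists (Num.min 1 (e / (3 * B + 1))); first by rewrite lt_min ltr01 divr_gt0.
move=> s s0; rewrite lt_min => /andP[st1 st2].
have st3 : `|s - t| * (3 * B + 1) <= e by rewrite -ler_pdivlMr// ltW.
have [ts|ts] := leP t s.
  rewrite ger0_norm ?subr_ge0// in st1 st3.
  by apply: le_trans st3; apply: lip => //; lra.
rewrite ltr0_norm ?subr_lt0// opprB in st1 st3.
by rewrite NBC; apply: le_trans st3; apply: lip => //; [exact: ltW|lra].
Qed.

End Primitive.

(** * The product rule *)

Section ProductRule.
Context {R : realType}.
Local Notation mu := (leb R).
Local Notation mu2 := (leb2 R).
Variables (G1 V1 G2 V2 : R -> R -> R[i]) (A1 A2 : R -> R[i]).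
Hypothesis P1 : L2_primitive mu G1 V1 A1.
Hypothesis P2 : L2_primitive mu G2 V2 A2.

(** On each interval of a partition, the increment of the product is compared
    with [h (G1 (x) V2 + V1 (x) G2)] at the tag through
    [V1' (x) V2' - V1 (x) V2 = (V1' - V1) (x) V2' + V1 (x) (V2' - V2)]. *)
Lemma product_rule (t : R) : 0 <= t -> L2_integral mu2 0 t
  (fun s z => tensor (G1 s) (V2 s) z + tensor (V1 s) (G2 s) z)
  (fun z => - 'i%C * (tensor (V1 t) (V2 t) z - tensor A1 A2 z)).
Proof.
move=> t0.
have [hA1 hV1 hG1 cG1 _] := P1; have [hA2 hV2 hG2 cG2 _] := P2.
have cV1 := primitive_continuous P1; have cV2 := primitive_continuous P2.
set H := fun s z => _ + _.
have hH s : 0 <= s <= t -> inL2 mu2 (H s).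
  by move=> /andP[s0 _]; apply: (@inL2D _ _ _ mu2); apply: inL2_tensor; auto.
have hW s : 0 <= s -> inL2 mu2 (tensor (V1 s) (V2 s)) by move=> s0; apply: inL2_tensor; auto.
have hS : inL2 mu2 (fun z => - 'i%C * (tensor (V1 t) (V2 t) z - tensor A1 A2 z)).
  by apply: inL2Z; apply: inL2B; [exact: hW|exact: inL2_tensor].
apply/(L2_integralP _ hH); split => // e e0.
have [B0 B00 HB0] := L2_continuous_bounded t hV1 cV1.
have [B1 B10 HB1] := L2_continuous_bounded t hV2 cV2.
have [B2 B20 HB2] := L2_continuous_bounded t hG1 cG1.
have [B3 B30 HB3] := L2_continuous_bounded t hG2 cG2.
pose B := B0 + B1 + B2 + B3.
have [B0B B1B B2B B3B] : [/\ B0 <= B, B1 <= B, B2 <= B & B3 <= B] by rewrite /B; split; lra.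
have K0 : 0 < t * (4 * B) + 1 by rewrite ltr_wpDl// !mulr_ge0// !addr_ge0.
(* An interval of length [h] will contribute at most [4 B h om], hence all of them at most
   [4 B t om], which does not exceed [e]. *)
have om0 : 0 < e / (t * (4 * B) + 1) by rewrite divr_gt0.
set om := e / _ in om0.
have [d1 d10 H1] := L2_continuous_uniform t hV1 cV1 om0.
have [d2 d20 H2] := L2_continuous_uniform t hV2 cV2 om0.
have [d3 d30 H3] := L2_continuous_uniform t hG1 cG1 om0.
have [d4 d40 H4] := L2_continuous_uniform t hG2 cG2 om0.
exists (Num.min (Num.min d1 d2) (Num.min d3 d4)); first by rewrite !lt_min d10 d20 d30.
move=> n x tau tp; have tk := tagged_le tp.
have [x0 xn mesh] := tp.
pose D k z := (x k.+1 - x k)%:C * H (tau k) z +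
  'i%C * (tensor (V1 (x k.+1)) (V2 (x k.+1)) z - tensor (V1 (x k)) (V2 (x k)) z).
have LD k : (k < n)%N -> inL2 mu2 (D k).
  move=> kn; have [k0 k1 k2 k3] := tk k kn.
  apply: inL2D; first by apply: inL2Z; exact: hH.
  by apply: inL2Z; apply: inL2B; apply: hW => //; exact: le_trans k1.
(* Each primitive takes its initial value only almost everywhere, so the telescoped sum keeps a null
   term at its left end. *)
have start : N mu2 (fun z => tensor (V1 0) (V2 0) z - tensor A1 A2 z) = 0.
  apply/eqP; rewrite eq_le N_ge0 andbT.
  apply: (le_trans (N_tensorB (hV1 0 (lexx 0)) (hV2 0 (lexx 0)) hA1 hA2)).
  by rewrite (primitive_start P1) (primitive_start P2) mul0r mulr0 addr0.
have hst : inL2 mu2 (fun z => 'i%C * (tensor (V1 0) (V2 0) z - tensor A1 A2 z)).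
  by apply: inL2Z; apply: inL2B; [exact: hW|exact: inL2_tensor].
have ND k : (k < n)%N -> N mu2 (D k) <= (x k.+1 - x k) * (4 * B * om).
  move=> kn; have [k0 k1 k2 k3] := tk k kn; have [t1 t2 dd] := mesh k kn.
  set h := x k.+1 - x k in dd *; set a := x k in k0 k1 t1 h dd *; set b := x k.+1 in k1 k2 t2 h dd *.
  have h0 : 0 <= h by rewrite subr_ge0.
  have b0 : 0 <= b by exact: le_trans k1.
  have tau0 : 0 <= tau k by case/andP: k3.
  have ain : 0 <= a <= t by rewrite k0 (le_trans k1).
  have bin : 0 <= b <= t by rewrite b0.
  have close s s' : a <= s <= b -> a <= s' <= b -> `|s - s'| < Num.min (Num.min d1 d2) (Num.min d3 d4).
    move=> /andP[s1 s2] /andP[s3 s4]; apply: le_lt_trans dd; rewrite /h ler_norml.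
    clear -s1 s2 s3 s4; lra.
  have inab s : a <= s <= b -> 0 <= s <= t.
    by move=> /andP[s1 s2]; rewrite (le_trans k0 s1) (le_trans s2 k2).
  have atb : a <= tau k <= b by rewrite t1.
  have aab : a <= a <= b by rewrite lexx.
  have bab : a <= b <= b by rewrite lexx k1.
  have E1 : N mu (fun z => h%:C * G1 (tau k) z + 'i%C * (V1 b z - V1 a z)) <= h * om.
    apply: (primitive_increment P1) => // s sab; apply: H3; [exact: inab|exact: inab|].
    by apply: lt_le_trans (close _ _ sab atb) _; rewrite !ge_min lexx !orbT.
  have E2 : N mu (fun z => h%:C * G2 (tau k) z + 'i%C * (V2 b z - V2 a z)) <= h * om.
    apply: (primitive_increment P2) => // s sab; apply: H4; [exact: inab|exact: inab|].
    by apply: lt_le_trans (close _ _ sab atb) _; rewrite !ge_min lexx !orbT.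
  have E3 : N mu (fun z => V2 (tau k) z - V2 b z) <= om.
    apply: H2; [exact: inab|exact: inab|].
    by apply: lt_le_trans (close _ _ atb bab) _; rewrite !ge_min lexx !orbT.
  have E4 : N mu (fun z => V1 (tau k) z - V1 a z) <= om.
    apply: H1; [exact: inab|exact: inab|].
    by apply: lt_le_trans (close _ _ atb aab) _; rewrite !ge_min lexx.
  set e1 := fun z => _ in E1; set e2 := fun z => _ in E2.
  set f3 := fun z => _ in E3; set f4 := fun z => _ in E4.
  have L1 : inL2 mu e1 by apply: inL2D; [apply: inL2Z; auto|apply: inL2Z; apply: inL2B; auto].
  have L2 : inL2 mu e2 by apply: inL2D; [apply: inL2Z; auto|apply: inL2Z; apply: inL2B; auto].
  have L3 : inL2 mu f3 by apply: inL2B; auto.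
  have L4 : inL2 mu f4 by apply: inL2B; auto.
  have T1 : inL2 mu2 (tensor e1 (V2 b)) by apply: inL2_tensor; auto.
  have T2 : inL2 mu2 (tensor (V1 a) e2) by apply: inL2_tensor; auto.
  have T3 : inL2 mu2 (tensor (G1 (tau k)) f3) by apply: inL2_tensor; auto.
  have T4 : inL2 mu2 (tensor f4 (G2 (tau k))) by apply: inL2_tensor; auto.
  (* Four errors: the Taylor remainders [e1] and [e2] of the two primitives, and the displacements
     [f3] of [V2] from [b] to the tag and [f4] of [V1] from [a] to the tag. *)
  rewrite (@eqN _ _ _ mu2 (D k) (fun z => (tensor e1 (V2 b) z + tensor (V1 a) e2 z) +
    (h%:C * tensor (G1 (tau k)) f3 z + h%:C * tensor f4 (G2 (tau k)) z))); last first.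
    by move=> z; rewrite /D /H /tensor /e1 /e2 /f3 /f4 -/a -/b -/h; ring.
  apply: (le_trans (N_triangle (inL2D T1 T2) (inL2D (inL2Z h%:C T3) (inL2Z h%:C T4)))).
  have := N_triangle T1 T2; have := N_triangle (inL2Z h%:C T3) (inL2Z h%:C T4).
  rewrite (NZr h T3) (NZr h T4) ger0_norm// !N_tensor; auto.
  have om0' := ltW om0.
  have Q1 : N mu e1 * N mu (V2 b) <= h * om * B.
    apply: ler_pM => //; try exact: N_ge0.
    exact: le_trans (HB1 b bin) B1B.
  have Q2 : N mu (V1 a) * N mu e2 <= B * (h * om).
    apply: ler_pM => //; try exact: N_ge0.
    exact: le_trans (HB0 a ain) B0B.
  have Q3 : h * (N mu (G1 (tau k)) * N mu f3) <= h * (B * om).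
    apply: ler_wpM2l => //; apply: ler_pM => //; try exact: N_ge0.
    exact: le_trans (HB2 _ k3) B2B.
  have Q4 : h * (N mu f4 * N mu (G2 (tau k))) <= h * (om * B).
    apply: ler_wpM2l => //; apply: ler_pM => //; try exact: N_ge0.
    exact: le_trans (HB3 _ k3) B3B.
  have -> : h * (4 * B * om) = (h * om * B + B * (h * om)) + (h * (B * om) + h * (om * B)) by ring.
  move=> q34 q12; apply: lerD; first exact: le_trans q12 (lerD Q1 Q2).
  exact: le_trans q34 (lerD Q3 Q4).
rewrite (@eqN _ _ _ mu2 (fun z => _ - _) (fun z => (\sum_(k < n) D k z) +
   'i%C * (tensor (V1 0) (V2 0) z - tensor A1 A2 z))); last first.
  move=> z; rewrite /D big_split /= -mulr_sumr.
  rewrite -(big_mkord xpredT (fun k => tensor (V1 (x k.+1)) (V2 (x k.+1)) z - tensor (V1 (x k)) (V2 (x k)) z)).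
  rewrite (telescope_sumr (fun k => tensor (V1 (x k)) (V2 (x k)) z))// x0 xn /riemann_sum.
  by ring.
apply: (le_trans (N_triangle (inL2_sum LD) hst)).
rewrite Ni start addr0.
apply: (le_trans (@N_sum _ _ _ mu2 n D LD)).
apply: (@le_trans _ _ (\sum_(k < n) (x k.+1 - x k) * (4 * B * om))).
  by apply: ler_sum => k _; exact: ND.
rewrite -mulr_suml (tagged_sum tp) subr0 mulrA.
have -> : e = (t * (4 * B) + 1) * om by rewrite /om mulrC divfK// gt_eqF.
by rewrite ler_pM2r// lerDl.
Qed.

End ProductRule.

(** * Products of one-variable solutions *)

Section TensorSolution.
Context {R : realType}.
Local Notation mu := (leb R).
Local Notation mu2 := (leb2 R).
Local Notation s2pi := (Num.sqrt (2 * pi : R)).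

Lemma L2_continuous_tensor (v1 v2 : R -> R -> R[i]) :
  (forall t, 0 <= t -> inL2 mu (v1 t)) -> (forall t, 0 <= t -> inL2 mu (v2 t)) ->
  L2_continuous mu v1 -> L2_continuous mu v2 ->
  L2_continuous mu2 (fun t => tensor (v1 t) (v2 t)).
Proof.
move=> h1 h2 c1 c2; apply: L2_continuous_of_seq => t s t0 s0 st.
have C1 := L2_continuous_seq c1 t0 s0 st; have C2 := L2_continuous_seq c2 t0 s0 st.
pose d1 k := N mu (fun z => v1 (s k) z - v1 t z); pose d2 k := N mu (fun z => v2 (s k) z - v2 t z).
apply: (@cvg0_le _ _ (fun k => d1 k * (N mu (v2 t) + d2 k) + N mu (v1 t) * d2 k)).
- by move=> k; exact: N_ge0.
- move=> k; apply: (le_trans (N_tensorB (h1 _ (s0 k)) (h2 _ (s0 k)) (h1 _ t0) (h2 _ t0))).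
  rewrite lerD2r; apply: ler_wpM2l; first exact: N_ge0.
  exact: N_lip (h2 _ (s0 k)) (h2 _ t0).
- have -> : 0 = 0 * (N mu (v2 t) + 0) + N mu (v1 t) * 0 by rewrite mul0r mulr0 addr0.
  apply: cvgD; apply: cvgM; [exact: C1| |exact: cvg_cst|exact: C2].
  by apply: cvgD; [exact: cvg_cst|exact: C2].
Qed.

Variables (eps1 eps2 : R) (p q : R -> R -> R).
Hypothesis hp : continuous_bounded p.
Hypothesis hq : continuous_bounded q.
Hypothesis tot1 : forall t, 0 <= t -> forall f, inL2 mu f -> exists g, free1 eps1 t f g.
Hypothesis tot2 : forall t, 0 <= t -> forall f, inL2 mu f -> exists g, free1 eps2 t f g.

Lemma pot2_measurable t : 0 <= t ->
  measurable_fun [set: (measurableTypeR R * measurableTypeR R)%type]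
    (fun z : R * R => p z.2 t + q z.1 t).
Proof.
move=> t0; apply: measurable_funD.
  by apply: (measurableT_comp (pot_measurable hp t0)); exact: measurable_snd.
by apply: (measurableT_comp (pot_measurable hq t0)); exact: measurable_fst.
Qed.

Lemma pot2_bound : exists2 M : R, 0 <= M &
  forall (z : R * R) t, 0 <= t -> `|p z.2 t + q z.1 t| <= M.
Proof.
have [Mp Mp0 HMp] := pot_bound hp; have [Mq Mq0 HMq] := pot_bound hq.
exists (Mp + Mq) => [|z t t0]; first exact: addr_ge0.
by apply: (le_trans (ler_normD _ _)); apply: lerD; auto.
Qed.

Definition phase2 (t : R) (zeta : R * R) : R[i] :=
  cis (- (t * (eps1 * zeta.1 ^+ 2 + eps2 * zeta.2 ^+ 2))).

Lemma cmeas_phase2 t : cmeas (phase2 t : (measurableTypeR R * measurableTypeR R)%type -> R[i]).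
Proof.
apply: cmeas_cis; apply: measurableT_comp => //.
by apply: measurable_funM => //; apply: measurable_funD; apply: measurable_funM => //;
  apply: measurable_funX.
Qed.

(** The propagated values [F s] are not explicit, but their Fourier transforms are. By isometry, and
    after removal of the phase of [t], the Riemann sums of [F] become those of the product rule for
    the two profiles. *)
Lemma tensor_solution (a b : R -> R[i]) (v1 v2 : R -> R -> R[i]) :
  schrodinger1 eps1 q a v1 -> schrodinger1 eps2 p b v2 ->
  schrodinger2 eps1 eps2 p q (tensor a b) (fun t => tensor (v1 t) (v2 t)).
Proof.
move=> H1 H2; apply/(mildP _ (isometric_free2 eps1 eps2)).
have [hv1 cv1 Iv1] := (mildP _ (isometric_free1 eps1) _ _).1 H1.
have [hv2 cv2 Iv2] := (mildP _ (isometric_free1 eps2) _ _).1 H2.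
have hu t : 0 <= t -> inL2 mu2 (tensor (v1 t) (v2 t)) by move=> t0; apply: inL2_tensor; auto.
split; [exact: hu|exact: L2_continuous_tensor|].
move=> t t0.
have [vh1 [nh1 [ah [Fa Fv1 Fn1 cG1 IG1]]]] := schrodinger_profile hq H1.
have [vh2 [nh2 [bh [Fb Fv2 Fn2 cG2 IG2]]]] := schrodinger_profile hp H2.
have isoF := @isometric_fourier1 R; have isoF2 := @isometric_fourier2 R.
have iso2 := isometric_free2 eps1 eps2.
have c20 : 0 < s2pi ^+ 2 by rewrite exprn_gt0// s2pi_gt0.
have phL eps s h : inL2 mu h -> inL2 mu (fun xi => cis (s * (eps * xi ^+ 2)) * h xi).
  by apply: (inL2M (C := 1)); [exact: cmeas_phase|move=> x; rewrite sqn_cis].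
have Q1 : L2_primitive mu (fun s xi => cis (s * (eps1 * xi ^+ 2)) * nh1 s xi)
    (fun s xi => cis (s * (eps1 * xi ^+ 2)) * vh1 s xi) ah.
  split=> //; first exact: iso_r isoF _ _ Fa.
    by move=> s s0; apply: phL; exact: iso_r isoF _ _ (Fv1 s s0).
  by move=> s s0; apply: phL; exact: iso_r isoF _ _ (Fn1 s s0).
have Q2 : L2_primitive mu (fun s xi => cis (s * (eps2 * xi ^+ 2)) * nh2 s xi)
    (fun s xi => cis (s * (eps2 * xi ^+ 2)) * vh2 s xi) bh.
  split=> //; first exact: iso_r isoF _ _ Fb.
    by move=> s s0; apply: phL; exact: iso_r isoF _ _ (Fv2 s s0).
  by move=> s s0; apply: phL; exact: iso_r isoF _ _ (Fn2 s s0).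
have [ga [_ [_ [Ea _ _ _]]]] := Iv1 t t0; have [gb [_ [_ [Eb _ _ _]]]] := Iv2 t t0.
have Eg := free2_tensor Ea Eb.
pose nh s z := tensor (nh1 s) (vh2 s) z + tensor (vh1 s) (nh2 s) z.
pose wu s (z : R * R) := (p z.2 s + q z.1 s)%:C * tensor (v1 s) (v2 s) z.
(* The potential splits over the tensor, [q] acting on the first factor and [p] on the second, so
   the transform has the Leibniz shape of the product rule. *)
have Fwu s : 0 <= s -> fourier2 (wu s) (nh s).
  move=> s0.
  have := isoD isoF2 (fourier2_tensor (Fn1 s s0) (Fv2 s s0)) (fourier2_tensor (Fv1 s s0) (Fn2 s s0)).
  by congr (fourier2 _ _); apply/funext => z; rewrite /wu /tensor rmorphD /=; ring.
have totF s : exists Fs, 0 <= s <= t -> free2 eps1 eps2 (t - s) (wu s) Fs.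
  have [/andP[s0 st]|_] := boolP (0 <= s <= t); last by exists (fun=> 0).
  have ts : 0 <= t - s by rewrite subr_ge0.
  have [Fs HF] := free2_total (tot1 ts) (tot2 ts) (iso_l isoF2 (Fwu s s0)).
  by exists Fs.
have [F EF] := choice totF.
have hF s : 0 <= s <= t -> inL2 mu2 (F s) by move=> /EF/(iso_r (iso2 _)).
have hg := iso_r (iso2 t) Eg.
pose S z := - 'i%C * (tensor (v1 t) (v2 t) z - tensor ga gb z).
have hS : inL2 mu2 S by apply: inL2Z; exact: inL2B (hu t t0) hg.
exists (tensor ga gb), F, S; split => //; last first.
  rewrite -[RHS](N0 mu2); apply: eqN => z; rewrite /S.
  have ii : 'i%C * 'i%C = -1 :> R[i] by rewrite -expr2 sqr_i.
  set u := tensor _ _ z; set u' := tensor _ _ z.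
  transitivity (u - u' + ('i%C * 'i%C) * (u - u')); first by ring.
  by rewrite ii; ring.
have m1 s zeta : sqn (phase2 s zeta) = 1 by exact: sqn_cis.
have Fg := isometric_multiplierE isoF2 (cmeas_phase2 t) (m1 t) (fourier2_tensor Fa Fb) Eg.
pose Fh s zeta := phase2 (t - s) zeta * nh s zeta.
have FF s : 0 <= s <= t -> fourier2 (F s) (Fh s).
  move=> st; have /andP[s0 _] := st.
  exact: (isometric_multiplierE isoF2 (cmeas_phase2 (t - s)) (m1 (t - s)) (Fwu s s0) (EF s st)).
have FS := isoZ isoF2 (- 'i%C) (isoB isoF2 (fourier2_tensor (Fv1 t t0) (Fv2 t t0)) Fg).
have := product_rule Q1 Q2 t0.
set H := fun s z => _ + _ => IH.
have hH s : 0 <= s <= t -> inL2 mu2 (H s).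
  move=> /andP[s0 _]; have [_ l1 l2 _ _] := Q1; have [_ l3 l4 _ _] := Q2.
  by apply: (@inL2D _ _ _ mu2); apply: inL2_tensor; auto.
have [_ HH] := (L2_integralP _ hH).1 IH.
apply/(L2_integralP _ hF); split => // e e0.
have ec : 0 < s2pi ^+ 2 * e by rewrite mulr_gt0.
have [delta d0 Hd] := HH _ ec; exists delta => // n x tau tp.
have {}Hd := Hd n x tau tp.
have FR : fourier2 (riemann_sum F n x tau) (riemann_sum Fh n x tau).
  apply: (@iso_sum _ _ _ mu2 (s2pi ^+ 2) _ isoF2 n (fun k z => (x k.+1 - x k)%:C * F (tau k) z)
    (fun k z => (x k.+1 - x k)%:C * Fh (tau k) z)); first exact: (iso0 isoF2 Fg).
  move=> k kn; apply: (isoZ isoF2); apply: FF.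
  by have [] := tagged_le tp kn.
have := iso_NB isoF2 FR FS.
move=> /(congr1 (fun r => r <= s2pi ^+ 2 * e)); rewrite (ler_pM2l c20) => <-.
(* [phase2 (- t)] is the inverse of the phase of the propagator at time [t]; multiplying by it turns
   [Fh s] into the integrand [H s]. *)
rewrite -(@NM_unit _ _ _ mu2 (phase2 (- t))); last by move=> z; exact: sqn_cis.
move: Hd; congr (_ <= _); apply: eqN => zeta; rewrite [RHS]mulrBr; congr (_ - _).
  rewrite /riemann_sum mulr_sumr; apply: eq_bigr => k _.
  rewrite [RHS]mulrCA; congr (_ * _); rewrite /Fh [RHS]mulrA -cisD /H /nh /tensor.
  have -> : cis (- (- t * (eps1 * zeta.1 ^+ 2 + eps2 * zeta.2 ^+ 2)) +
      - ((t - tau k) * (eps1 * zeta.1 ^+ 2 + eps2 * zeta.2 ^+ 2))) =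
      cis (tau k * (eps1 * zeta.1 ^+ 2)) * cis (tau k * (eps2 * zeta.2 ^+ 2)) :> R[i].
    by rewrite -cisD; congr cis; ring.
  by ring.
have cc : phase2 (- t) zeta * phase2 t zeta = 1.
  by rewrite /phase2 -cisD -cis0; congr cis; ring.
have ee : phase2 (- t) zeta = cis (t * (eps1 * zeta.1 ^+ 2)) * cis (t * (eps2 * zeta.2 ^+ 2)).
  by rewrite /phase2 -cisD; congr cis; ring.
transitivity (- 'i%C * (phase2 (- t) zeta * tensor (vh1 t) (vh2 t) zeta - (phase2 (- t) zeta * phase2 t zeta) * tensor ah bh zeta)).
  by rewrite cc ee /tensor; ring.
by ring.
Qed.

End TensorSolution.

(** * Unitary operators and slices *)

Section Unitary.
Context {d : measure_display} {T : measurableType d} {R : realType}.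
Variable mu : {measure set T -> \bar R}.
Implicit Types (f g h : T -> R[i]).

Variable U : (T -> R[i]) -> T -> R[i].
Hypothesis HU : L2_unitary mu U.

Lemma unitary_L2 f : inL2 mu f -> inL2 mu (U f).
Proof. by case: HU => -[h _ _] _ _; exact: h. Qed.

Lemma unitary_NB f g : inL2 mu f -> inL2 mu g ->
  N mu (fun x => U f x - U g x) = N mu (fun x => f x - g x).
Proof.
move=> hf hg; case: HU => _ h _.
by apply: N_sub_inner; rewrite ?h//; exact: unitary_L2.
Qed.

Lemma unitary_N f : inL2 mu f -> N mu (U f) = N mu f.
Proof.
move=> hf; case: HU => _ h _.
have := congr1 (fun z : R[i] => re z) (h f f hf hf); rewrite (inner_N hf) (inner_N (unitary_L2 hf)) /= => e.
by apply/eqP; rewrite -(@eqrXn2 _ 2%N) ?N_ge0// e.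
Qed.

Lemma unitary_lin a f g : inL2 mu f -> inL2 mu g ->
  N mu (fun x => U (fun x => a * f x + g x) x - (a * U f x + U g x)) = 0.
Proof.
move=> hf hg; case: HU => -[_ _ h] _ _; apply/ae_N0; last exact: h.
  by apply: unitary_L2; apply: inL2D => //; exact: inL2Z.
by apply: inL2D; [apply: inL2Z; exact: unitary_L2|exact: unitary_L2].
Qed.

Lemma unitary_sum n (c : nat -> R[i]) (b : nat -> T -> R[i]) : (forall k, inL2 mu (b k)) ->
  N mu (fun x => U (fun x => \sum_(k < n) c k * b k x) x - \sum_(k < n) c k * U (b k) x) = 0.
Proof.
move=> hb; have hUb k := unitary_L2 (hb k).
have hs m : inL2 mu (fun x => \sum_(k < m) c k * b k x).
  by apply: (@inL2_sum _ _ _ mu m (fun k x => c k * b k x)) => k _; exact: inL2Z.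
have hUs m : inL2 mu (fun x => \sum_(k < m) c k * U (b k) x).
  by apply: (@inL2_sum _ _ _ mu m (fun k x => c k * U (b k) x)) => k _; exact: inL2Z.
elim: n => [|n IH].
  have := unitary_lin (-1) (hs 0%N) (hs 0%N).
  have -> : (fun x => -1 * (\sum_(k < 0) c k * b k x) + \sum_(k < 0) c k * b k x) =
      (fun x => \sum_(k < 0) c k * b k x) by apply/funext => x; rewrite big_ord0; ring.
  by move=> e0; apply: etrans e0; apply: eqN => x; rewrite [X in _ - X]big_ord0; ring.
have e : (fun x => \sum_(k < n.+1) c k * b k x) = (fun x => c n * b n x + \sum_(k < n) c k * b k x).
  by apply/funext => x; rewrite big_ord_recr addrC.
apply/eqP; rewrite eq_le N_ge0 andbT e.
have L := unitary_lin (c n) (hb n) (hs n).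
have LU := unitary_L2 (inL2D (inL2Z (c n) (hb n)) (hs n)).
apply: (le_trans (@N_split _ _ _ mu (fun x => c n * U (b n) x + U (fun x => \sum_(k < n) c k * b k x) x) _ _ LU (hUs n.+1) _)).
  by apply: inL2D; [exact: inL2Z|exact: unitary_L2].
rewrite L add0r -IH le_eqVlt; apply/orP; left; apply/eqP; apply: eqN => x.
by rewrite big_ord_recr /=; ring.
Qed.

(** With [d = V g - f], adjointness gives [<d, V g> = <U d, g>] and unitarity gives
    [<d, f> = <U d, U f>]; hence [<d, d>] is [<U d, g - U f>], which vanishes. *)
Lemma adjoint_inverse V f g : L2_adjoint mu U V -> inL2 mu f -> inL2 mu g ->
  N mu (fun x => U f x - g x) = 0 -> N mu (fun x => V g x - f x) = 0.
Proof.
move=> [hV adj] hf hg Ufg; have [_ iU _] := HU.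
have hUf := unitary_L2 hf; have hVg := hV _ hg.
have hd := inL2B hVg hf.
have e : inner mu (fun x => V g x - f x) (fun x => V g x - f x) = 0.
  rewrite inner_linBr// -(adj _ _ hd hg) -(iU _ _ hd hf).
  rewrite -inner_linBr ?inner_null//; try exact: unitary_L2; first exact: inL2B.
  by rewrite NBC.
have := congr1 (fun z : R[i] => re z) e; rewrite (inner_N hd) /= => /eqP.
by rewrite sqrf_eq0 => /eqP.
Qed.

Lemma unitary_surjective g : inL2 mu g -> exists2 f, inL2 mu f & N mu (fun x => U f x - g x) = 0.
Proof.
move=> hg; have [_ _ sur] := HU; have [f hf Ufg] := sur g hg; exists f => //.
by apply/ae_N0 => //; exact: unitary_L2.
Qed.

(** By surjectivity [g] is almost everywhere some [U f], and then [V g] is almost everywhere [f]. *)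
Lemma adjoint_N V g : L2_adjoint mu U V -> inL2 mu g -> N mu (V g) = N mu g.
Proof.
move=> HV hg; have [f hf Ufg] := unitary_surjective hg.
have VN := adjoint_inverse HV hf hg Ufg; have [hV _] := HV.
have eqNorm f1 f2 : inL2 mu f1 -> inL2 mu f2 -> N mu (fun x => f1 x - f2 x) = 0 -> N mu f1 = N mu f2.
  move=> h1 h2 e; apply/eqP; rewrite eq_le.
  have := N_lip h1 h2; have := N_lip h2 h1; rewrite NBC e !addr0 => -> /= ; by move=> ->.
rewrite (eqNorm _ _ (hV _ hg) hf VN) -(unitary_N hf).
exact: eqNorm (unitary_L2 hf) hg Ufg.
Qed.

End Unitary.

(** * Slices and Tonelli's theorem *)

Section Slices.
Context {R : realType}.
Local Notation mu := (leb R).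
Local Notation mu2 := (leb2 R).
Local Notation T2 := (measurableTypeR R * measurableTypeR R)%type.

(** Abstracts the direction of the cut, so that one argument serves operators in [x] and operators
    in [y]. *)
Definition slicing (sl : R -> R -> R * R) :=
  (forall x, measurable_fun [set: measurableTypeR R] (sl x : measurableTypeR R -> T2)) /\
  forall F : T2 -> \bar R, measurable_fun [set: T2] F -> (forall z, 0 <= F z)%E ->
    measurable_fun [set: measurableTypeR R] (fun x => \int[mu]_y F (sl x y))%E /\
    (\int[mu2]_z F z = \int[mu]_x \int[mu]_y F (sl x y))%E.

Lemma slicing_x : slicing (fun x y => (x, y)).
Proof.
split; first by move=> x; exact: pair1_measurable.
move=> F mF F0; split; last exact: tonelli_x.
exact: (@measurable_fun_fubini_tonelli_F _ _ _ _ R (@lebesgue_measure R) F mF F0).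
Qed.

Lemma slicing_y : slicing (fun y x => (x, y)).
Proof.
split; first by move=> y; exact: pair2_measurable.
move=> F mF F0; split; last exact: tonelli_y.
exact: (@measurable_fun_fubini_tonelli_G _ _ _ _ R (@lebesgue_measure R) F mF F0).
Qed.

Variable sl : R -> R -> R * R.
Hypothesis Hsl : slicing sl.

Lemma cmeas_slice (f : R * R -> R[i]) x : cmeas (f : T2 -> R[i]) ->
  cmeas (fun y : measurableTypeR R => f (sl x y)).
Proof.
by move=> [h1 h2]; split; [apply: (measurableT_comp h1)|apply: (measurableT_comp h2)]; case: Hsl.
Qed.

(** Extended-valued, since individual slices of an L2 function may have infinite energy. *)
Definition slice_energy (f : R * R -> R[i]) x : \bar R := (\int[mu]_y (sqn (f (sl x y)))%:E)%E.

Lemma measurable_sqnE (f : R * R -> R[i]) : cmeas (f : T2 -> R[i]) ->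
  measurable_fun [set: T2] (fun z => (sqn (f z))%:E).
Proof. by move=> hf; apply/measurable_EFinP; exact: measurable_sqn. Qed.

Lemma slice_energy_measurable f : cmeas (f : T2 -> R[i]) ->
  measurable_fun [set: measurableTypeR R] (slice_energy f).
Proof.
move=> hf; have [_ H] := Hsl.
by have [] := H _ (measurable_sqnE hf) (fun z => sqn_ge0 _).
Qed.

Lemma slice_energy_ge0 f x : (0 <= slice_energy f x)%E.
Proof. by apply: integral_ge0 => y _; rewrite lee_fin sqn_ge0. Qed.

Lemma integral_slice_energy f : inL2 mu2 f ->
  (\int[mu]_x slice_energy f x = (N mu2 f ^+ 2)%:E)%E.
Proof.
move=> hf; rewrite -integral_sqn//; have [_ H] := Hsl.
by have [_ ->] := H _ (measurable_sqnE (inL2_cmeas hf)) (fun z => sqn_ge0 _).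
Qed.

Lemma slice_L2 f x : cmeas (f : T2 -> R[i]) -> (slice_energy f x < +oo)%E ->
  inL2 mu (fun y => f (sl x y)) /\ slice_energy f x = (N mu (fun y => f (sl x y)) ^+ 2)%:E.
Proof.
move=> hf fx; have h : inL2 mu (fun y => f (sl x y)).
  by apply: inL2_lty fx; exact: cmeas_slice.
by split => //; rewrite /slice_energy integral_sqn.
Qed.

(** The infimum over [k] of the slice energies of the two errors has integral
    [0], hence vanishes on almost every slice. *)
Lemma slice_limit (V : (R -> R[i]) -> R -> R[i]) (f g : R * R -> R[i]) (fk gk : nat -> R * R -> R[i]) :
  L2_unitary mu V -> inL2 mu2 f -> inL2 mu2 g ->
  (forall k, inL2 mu2 (fk k)) -> (forall k, inL2 mu2 (gk k)) ->
  (forall k x, inL2 mu (fun y => fk k (sl x y))) ->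
  (forall k x, inL2 mu (fun y => gk k (sl x y))) ->
  (forall k x, N mu (fun y => V (fun y => fk k (sl x y)) y - gk k (sl x y)) = 0) ->
  (fun k => N mu2 (fun z => f z - fk k z)) @ \oo --> 0 ->
  (fun k => N mu2 (fun z => g z - gk k z)) @ \oo --> 0 ->
  {ae mu, forall x, (fun y => g (sl x y)) = V (fun y => f (sl x y)) %[ae mu]}.
Proof.
move=> HV hf hg hfk hgk sfk sgk Vk cf cg.
have hdf k := inL2B hf (hfk k); have hdg k := inL2B hg (hgk k).
pose gam k x := (slice_energy (fun z => f z - fk k z)%R x + slice_energy (fun z => g z - gk k z)%R x)%E.
have gam0 k x : (0 <= gam k x)%E by apply: adde_ge0; exact: slice_energy_ge0.
have mgam k : measurable_fun [set: measurableTypeR R] (gam k).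
  by apply: emeasurable_funD; apply: slice_energy_measurable; exact: inL2_cmeas.
(* Convergence in L2 of the plane gives no convergence of the whole sequence on an individual slice;
   the infimum stands in for the choice of a subsequence. *)
pose I x := einfs (gam ^~ x) 0.
have mI : measurable_fun [set: measurableTypeR R] I by exact: measurable_fun_einfs.
have I0 x : (0 <= I x)%E by apply: le_ereal_inf_tmp => _ [k _ <-].
have Ik k x : (I x <= gam k x)%E by apply: ereal_inf_lbound; exists k.
have intI : (\int[mu]_x I x = 0)%E.
  apply/eqP; rewrite eq_le integral_ge0 ?andbT//.
  apply/lee_addgt0Pr => e e0; rewrite add0e.
  have e2 : 0 < Num.sqrt (e / 2) by rewrite sqrtr_gt0 divr_gt0.
  have [k1 H1] := cvg0_ex cf e2; have [k2 H2] := cvg0_ex cg e2.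
  pose k := maxn k1 k2.
  apply: (@le_trans _ _ (\int[mu]_x gam k x)%E).
    by apply: ge0_le_integral => // x _.
  rewrite ge0_integralD//; first last.
    - by apply: slice_energy_measurable; exact: inL2_cmeas.
    - by move=> x _; exact: slice_energy_ge0.
    - by apply: slice_energy_measurable; exact: inL2_cmeas.
    - by move=> x _; exact: slice_energy_ge0.
  rewrite !integral_slice_energy// -EFinD lee_fin.
  have sq (r : R) : 0 <= r -> r <= Num.sqrt (e / 2) -> r ^+ 2 <= e / 2.
    move=> r0 hr; apply: (@le_trans _ _ (Num.sqrt (e / 2) ^+ 2)).
      by rewrite ler_sqr ?nnegrE ?sqrtr_ge0.
    by rewrite sqr_sqrtr// divr_ge0// ltW.
  have := sq _ (N_ge0 _ _) (H1 k (leq_maxl _ _)).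
  have := sq _ (N_ge0 _ _) (H2 k (leq_maxr _ _)).
  lra.
have aeI : ae_eq mu setT I (cst 0%E).
  apply/ae_eq_integral_abs => //.
  by rewrite -[RHS]intI; apply: eq_integral => x _; rewrite gee0_abs.
apply: filterS aeI => x /(_ Logic.I) Ix.
have fin_split k : (gam k x < +oo)%E -> [/\ inL2 mu (fun y => f (sl x y) - fk k (sl x y)),
    inL2 mu (fun y => g (sl x y) - gk k (sl x y)) &
    gam k x = (N mu (fun y => f (sl x y) - fk k (sl x y)) ^+ 2 +
      N mu (fun y => g (sl x y) - gk k (sl x y)) ^+ 2)%:E].
  move=> gx.
  have g1 : (slice_energy (fun z => f z - fk k z)%R x < +oo)%E.
    by apply: le_lt_trans gx; rewrite leeDl// slice_energy_ge0.
  have g2 : (slice_energy (fun z => g z - gk k z)%R x < +oo)%E.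
    by apply: le_lt_trans gx; rewrite leeDr// slice_energy_ge0.
  have [L1 E1] := slice_L2 (inL2_cmeas (hdf k)) g1.
  have [L2 E2] := slice_L2 (inL2_cmeas (hdg k)) g2.
  by split => //; rewrite /gam E1 E2.
(* As [I x = 0], some [gam k x] is finite; the slices of [fk k0] and [gk k0] being in L2, so are
   those of [f] and [g]. *)
have [k0 gk0] : exists k, (gam k x < +oo)%E.
  apply: contrapT => nk; have : (+oo <= I x)%E.
    apply: le_ereal_inf_tmp => _ [k _ <-]; rewrite leNgt; apply/negP => h; apply: nk; by exists k.
  by rewrite Ix.
have [L1 L2 _] := fin_split k0 gk0.
have hfx : inL2 mu (fun y => f (sl x y)).
  have -> : (fun y => f (sl x y)) = (fun y => (f (sl x y) - fk k0 (sl x y)) + fk k0 (sl x y)).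
    by apply/funext => y; rewrite subrK.
  exact: inL2D.
have hgx : inL2 mu (fun y => g (sl x y)).
  have -> : (fun y => g (sl x y)) = (fun y => (g (sl x y) - gk k0 (sl x y)) + gk k0 (sl x y)).
    by apply/funext => y; rewrite subrK.
  exact: inL2D.
have hVf := unitary_L2 HV hfx.
apply/(ae_N0 hgx hVf).
set h := N mu _.
have h0 : 0 <= h := N_ge0 _ _.
(* For each [k], [h] is at most the sum of the two slice errors, so [h ^ 2 / 2] is at most the sum
   of their squares, and hence at most the infimum [0]. *)
have : ((h ^+ 2 / 2)%:E <= I x)%E.
  apply: le_ereal_inf_tmp => _ [k _ <-] /=.
  have [gx|] := ltP (gam k x) +oo%E; last by apply: le_trans; rewrite leey.
  have [M1 M2 ->] := fin_split k gx; rewrite lee_fin.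
  set al := N mu _; set be := N mu _.
  have hk : h <= be + al.
    have Vfk := unitary_L2 HV (sfk k x).
    apply: (le_trans (@N_split _ _ _ mu (fun y => gk k (sl x y)) _ _ hgx hVf (sgk k x))).
    rewrite lerD2l.
    apply: (le_trans (@N_split _ _ _ mu (V (fun y => fk k (sl x y))) _ _ (sgk k x) hVf Vfk)).
    by rewrite NBC Vk add0r (unitary_NB HV (sfk k x) hfx) NBC.
  have a0 : 0 <= al := N_ge0 _ _; have b0 : 0 <= be := N_ge0 _ _.
  have : h ^+ 2 <= (be + al) ^+ 2 by rewrite ler_sqr ?nnegrE// addr_ge0.
  have := sqr_ge0 (be - al); lra.
rewrite Ix lee_fin => h2.
apply/eqP; rewrite -sqrf_eq0 eq_le sqr_ge0 andbT.
by move: h2; rewrite pmulr_lle0// invr_gt0.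
Qed.

End Slices.

(** * Hilbert-Schmidt operators *)

Section IntegralOperator.
Context {R : realType}.
Local Notation mu := (leb R).
Local Notation mu2 := (leb2 R).
Local Notation T2 := (measurableTypeR R * measurableTypeR R)%type.
Implicit Types (k : R * R -> R[i]) (phi psi : R -> R[i]).

(** By definition the integral is the difference of those of the positive and negative parts, so
    Tonelli gives measurability even where a slice is not integrable. *)
Lemma measurable_slice_Rintegral (F : T2 -> R) : measurable_fun [set: T2] F ->
  measurable_fun [set: measurableTypeR R] (fun x => \int[mu]_y F (x, y)).
Proof.
move=> mF; have [_ H] := @slicing_x R.
have mE : measurable_fun [set: T2] (EFin \o F) by exact/measurable_EFinP.
have mp := (H _ (measurable_funepos mE) (fun z => funepos_ge0 _ z)).1.
have mn := (H _ (measurable_funeneg mE) (fun z => funeneg_ge0 _ z)).1.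
apply: (@measurableT_comp _ _ _ _ _ _ (fine : \bar R -> R) _ (fun x => \int[mu]_y (F (x, y))%:E)%E).
  exact: fine_measurable.
have := emeasurable_funB mp mn; congr (measurable_fun _ _); apply/funext => x.
by rewrite [RHS]integralE; congr (_ - _)%E; apply: eq_integral => y _; rewrite ?funeposE ?funenegE.
Qed.

Lemma cmeas_integral_operator k phi : cmeas (k : T2 -> R[i]) ->
  cmeas (phi : measurableTypeR R -> R[i]) ->
  cmeas (integral_operator k phi : measurableTypeR R -> R[i]).
Proof.
move=> hk hphi.
have [m1 m2] : cmeas (fun z : T2 => k z * phi z.2) by apply: cmeasM => //; exact: cmeas_snd.
by split; [exact: (measurable_slice_Rintegral m1)|exact: (measurable_slice_Rintegral m2)].
Qed.

Lemma integral_operatorE k phi x :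
  integral_operator k phi x = inner mu (fun y => k (x, y)) (fun y => (phi y)^*%C).
Proof.
by rewrite /inner /integral_operator; congr (cintegral _ _ _); apply/funext => y; rewrite conjcK.
Qed.

(** The factor [2] comes from bounding the real and imaginary parts separately. *)
Lemma sqn_inner (f g : R -> R[i]) : inL2 mu f -> inL2 mu g ->
  sqn (inner mu f g) <= 2 * N mu g ^+ 2 * N mu f ^+ 2.
Proof.
move=> hf hg; rewrite innerE /sqn /=.
have sq (r : R) : `|r| <= N mu f * N mu g -> r ^+ 2 <= N mu g ^+ 2 * N mu f ^+ 2.
  move=> h; rewrite -real_normK ?num_real// -exprMn mulrC ler_sqr ?nnegrE//.
  by rewrite mulr_ge0 ?N_ge0.
have h1 := sq _ (rdot_abs hf hg).
have := rdot_abs hf (inL2Z 'i%C hg); rewrite Ni => /sq h2.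
lra.
Qed.

(** Each value is an integral over [y], blind to null changes of [phi]; hence equality at every
    [x]. *)
Lemma integral_operator_ae k phi psi : cmeas (k : T2 -> R[i]) -> inL2 mu phi -> inL2 mu psi ->
  N mu (fun x => phi x - psi x) = 0 -> integral_operator k phi = integral_operator k psi.
Proof.
move=> hk hphi hpsi /(ae_N0 hphi hpsi) e; apply/funext => x.
have ck : cmeas (fun y : measurableTypeR R => k (x, y)).
  exact: (@cmeas_slice R (fun x y => (x, y)) (@slicing_x R) k x hk).
have [r1 i1] := cmeasM ck (inL2_cmeas hphi); have [r2 i2] := cmeasM ck (inL2_cmeas hpsi).
rewrite /integral_operator /cintegral /Rintegral; congr (fine _ +i* fine _).
- apply: ae_eq_integral => //; [exact/measurable_EFinP|exact/measurable_EFinP|].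
  by apply: filterS e => y ey /ey ->.
- apply: ae_eq_integral => //; [exact/measurable_EFinP|exact/measurable_EFinP|].
  by apply: filterS e => y ey /ey ->.
Qed.

Lemma tens_slice_L2 n (a b : nat -> R -> R[i]) x : (forall j, inL2 mu (b j)) ->
  inL2 mu (fun y => tens n a b (x, y)).
Proof.
move=> hb; apply: (@inL2_sum _ _ _ mu n (fun j y => a j x * b j y)) => j _; exact: inL2Z.
Qed.

Lemma tens_slice_L2y n (a b : nat -> R -> R[i]) y : (forall j, inL2 mu (a j)) ->
  inL2 mu (fun x => tens n a b (x, y)).
Proof.
move=> ha; have := @inL2_sum _ _ _ mu n (fun j x => b j y * a j x) (fun j _ => inL2Z (b j y) (ha j)).
by congr (inL2 mu _); apply/funext => x; apply: eq_bigr => j _; rewrite mulrC.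
Qed.

Lemma integral_operator_tens n (a b : nat -> R -> R[i]) phi x : (forall j, inL2 mu (b j)) ->
  inL2 mu phi -> integral_operator (tens n a b) phi x =
  \sum_(j < n) inner mu (b j) (fun y => (phi y)^*%C) * a j x.
Proof.
move=> hb hphi; have hc := inL2J hphi.
rewrite integral_operatorE (@inner_suml _ _ _ mu n (fun j y => a j x * b j y))//; last first.
  by move=> j _; exact: inL2Z.
apply: eq_bigr => j _.
have := @inner_linl _ _ _ mu (a j x) (b j) (fun=> 0) _ (hb j) (inL20 mu) hc.
rewrite inner0l addr0 mulrC => <-.
apply: (congr1 (fun h => inner mu h (fun y => (phi y)^*%C))).
by apply/funext => y; rewrite addr0.
Qed.

(** Cauchy-Schwarz on each slice, then Tonelli. The slices of [k'] are all in L2; those of [k] are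
    then in L2 wherever [k - k'] has finite energy. *)
Lemma hilbert_schmidt k k' phi : inL2 mu2 k -> inL2 mu2 k' ->
  (forall x, inL2 mu (fun y => k' (x, y))) -> inL2 mu phi ->
  inL2 mu (fun x => integral_operator k phi x - integral_operator k' phi x) /\
  N mu (fun x => integral_operator k phi x - integral_operator k' phi x) <=
    Num.sqrt (2 * N mu phi ^+ 2 + 1) * N mu2 (fun z => k z - k' z).
Proof.
move=> hk hk' sk' hphi.
(* The [+ 1] makes the pointwise bound trivial on slices of infinite energy,
   also when [phi] vanishes (in [\bar R], [0 * +oo = 0]). *)
set C := 2 * N mu phi ^+ 2 + 1; set D := fun x => _ - _.
have C0 : 0 < C by rewrite ltr_wpDl// mulr_ge0// sqr_ge0.
have cD : cmeas (D : measurableTypeR R -> R[i]).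
  have c1 := cmeas_integral_operator (inL2_cmeas hk) (inL2_cmeas hphi).
  have c2 := cmeas_integral_operator (inL2_cmeas hk') (inL2_cmeas hphi).
  have := cmeasD c1 (cmeasM (cmeas_cst (-1)) c2).
  by congr (cmeas _); apply/funext => x; rewrite /D mulN1r.
have hd := inL2B hk hk'.
pose E := slice_energy (fun x y : R => (x, y)) (fun z => k z - k' z).
have pt x : ((sqn (D x))%:E <= C%:E * E x)%E.
  have [Ex|] := ltP (E x) +oo%E; last first.
    by rewrite leye_eq => /eqP ->; rewrite gt0_muley ?lte_fin// leey.
  have [L e] := slice_L2 (@slicing_x R) (inL2_cmeas hd) Ex.
  have hkx : inL2 mu (fun y => k (x, y)).
    have -> : (fun y => k (x, y)) = (fun y => (k (x, y) - k' (x, y)) + k' (x, y)).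
      by apply/funext => y; rewrite subrK.
    exact: inL2D.
  have hc := inL2J hphi.
  have -> : D x = inner mu (fun y => k (x, y) - k' (x, y)) (fun y => (phi y)^*%C).
    rewrite /D !integral_operatorE.
    have := @inner_linl _ _ _ mu (-1) (fun y => k' (x, y)) (fun y => k (x, y)) _ (sk' x) hkx hc.
    rewrite mulN1r addrC => <-.
    apply: (congr1 (fun h => inner mu h (fun y => (phi y)^*%C))).
    by apply/funext => y; ring.
  rewrite /E e -EFinM lee_fin; apply: (le_trans (sqn_inner L hc)).
  rewrite NJ; apply: ler_wpM2r; first exact: sqr_ge0.
  by rewrite /C lerDl.
have mE := slice_energy_measurable (@slicing_x R) (inL2_cmeas hd).
have iD : (\int[mu]_x (sqn (D x))%:E <= (C * N mu2 (fun z => k z - k' z)%R ^+ 2)%:E)%E.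
  apply: (@le_trans _ _ (\int[mu]_x (C%:E * E x))%E).
    apply: ge0_le_integral => //.
    - by move=> x _; rewrite lee_fin sqn_ge0.
    - by apply/measurable_EFinP; exact: measurable_sqn.
    - exact: measurable_funeM.
  rewrite ge0_integralZl//; last 2 first.
    - by move=> x _; exact: slice_energy_ge0.
    - by rewrite lee_fin ltW.
  by rewrite (integral_slice_energy (@slicing_x R) hd).
have hD : inL2 mu D by apply: inL2_lty => //; apply: le_lt_trans iD _; rewrite ltry.
split => //.
have : N mu D ^+ 2 <= C * N mu2 (fun z => k z - k' z) ^+ 2 by rewrite -lee_fin -integral_sqn.
have -> : C * N mu2 (fun z => k z - k' z) ^+ 2 = (Num.sqrt C * N mu2 (fun z => k z - k' z)) ^+ 2.
  by rewrite exprMn (sqr_sqrtr (ltW C0)).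
by rewrite ler_sqr ?nnegrE ?N_ge0// mulr_ge0 ?sqrtr_ge0 ?N_ge0.
Qed.

Lemma inL2_integral_operator k phi : inL2 mu2 k -> inL2 mu phi ->
  inL2 mu (integral_operator k phi).
Proof.
move=> hk hphi; have [h _] := hilbert_schmidt hk (inL20 mu2) (fun x => inL20 mu) hphi.
have := h; congr (inL2 mu _); apply/funext => x.
by rewrite [X in _ - X]integral_operatorE inner0l subr0.
Qed.

End IntegralOperator.

(** * Factorization of solutions *)

Section Assembly.
Context {R : realType}.
Local Notation mu := (leb R).
Local Notation mu2 := (leb2 R).
Implicit Types (U V : (R -> R[i]) -> R -> R[i]) (n : nat -> nat) (a b : nat -> nat -> R -> R[i]).

(** Allows [U2] alone to be applied to tensor sums, as the case of the identity in [x]. *)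
Lemma unitary_id : L2_unitary mu (fun f : R -> R[i] => f).
Proof.
split=> [|//|g hg]; last by exists g => //; exact: aeW.
by split=> // c f g _ _; exact: aeW.
Qed.

(** Distances between tensor sums depend only on Gram matrices, so no operator on L2 of the plane
    has to be defined before passing to limits. *)
Lemma N_tensB_unitary U V m (x y : nat -> R -> R[i]) m' (x' y' : nat -> R -> R[i]) :
  L2_unitary mu U -> L2_unitary mu V ->
  (forall k, inL2 mu (x k)) -> (forall k, inL2 mu (y k)) ->
  (forall k, inL2 mu (x' k)) -> (forall k, inL2 mu (y' k)) ->
  N mu2 (fun z => tens m (fun k => U (x k)) (fun k => V (y k)) z -
                  tens m' (fun k => U (x' k)) (fun k => V (y' k)) z) =
  N mu2 (fun z => tens m x y z - tens m' x' y' z).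
Proof.
move=> HU HV hx hy hx' hy'.
have U2 h (hh : inL2 mu h) := unitary_L2 HU hh; have V2 h (hh : inL2 mu h) := unitary_L2 HV hh.
have [_ iU _] := HU; have [_ iV _] := HV.
have eqi m1 m2 (x1 y1 x2 y2 : nat -> R -> R[i]) :
    (forall k, inL2 mu (x1 k)) -> (forall k, inL2 mu (y1 k)) ->
    (forall k, inL2 mu (x2 k)) -> (forall k, inL2 mu (y2 k)) ->
    inner mu2 (tens m1 (fun k => U (x1 k)) (fun k => V (y1 k))) (tens m2 (fun k => U (x2 k)) (fun k => V (y2 k))) =
    inner mu2 (tens m1 x1 y1) (tens m2 x2 y2).
  move=> h1 h2 h3 h4; rewrite !inner_tens; auto.
  by apply: eq_bigr => k _; apply: eq_bigr => l _; rewrite iU ?iV.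
by apply: N_sub_inner; try (exact: eqi); apply: inL2_tens; auto.
Qed.

Lemma tens_approx (f : R * R -> R[i]) : inL2 mu2 f -> exists n a b,
  [/\ forall k j, inL2 mu (a k j), forall k j, inL2 mu (b k j) &
      forall k, N mu2 (fun z => f z - tens (n k) (a k) (b k) z) <= 4^-1 ^+ k.+1].
Proof.
move=> hf.
have pos k : 0 < (4^-1 : R) ^+ k by rewrite exprn_gt0// invr_gt0.
have H k : exists nab : nat * ((nat -> R -> R[i]) * (nat -> R -> R[i])),
    [/\ forall j, inL2 mu (nab.2.1 j), forall j, inL2 mu (nab.2.2 j) &
      N mu2 (fun z => f z - tens nab.1 nab.2.1 nab.2.2 z) <= 4^-1 ^+ k.+1].
  have [_ /(_ _ (pos k.+1))[g [m [x [y [hx hy ->]]]] ng]] := tenss_dense_full hf.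
  by exists (m, (x, y)).
have [nab Hn] := choice H.
exists (fun k => (nab k).1), (fun k => (nab k).2.1), (fun k => (nab k).2.2).
by split=> k; have [h1 h2 h3] := Hn k.
Qed.

Lemma tens_limit U V (f : R * R -> R[i]) n a b : L2_unitary mu U -> L2_unitary mu V ->
  inL2 mu2 f -> (forall k j, inL2 mu (a k j)) -> (forall k j, inL2 mu (b k j)) ->
  (forall k, N mu2 (fun z => f z - tens (n k) (a k) (b k) z) <= 4^-1 ^+ k.+1) ->
  exists g, inL2 mu2 g /\ forall k,
    N mu2 (fun z => g z - tens (n k) (fun j => U (a k j)) (fun j => V (b k j)) z) <= 2 * 4^-1 ^+ k.
Proof.
move=> HU HV hf ha hb Hk.
have hUV k : inL2 mu2 (tens (n k) (fun j => U (a k j)) (fun j => V (b k j))).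
  by apply: inL2_tens => j; apply: unitary_L2.
apply: L2_complete_fast => // k.
rewrite N_tensB_unitary//.
have ht l := inL2_tens (n l) (ha l) (hb l).
apply: (le_trans (@N_split _ _ _ mu2 f _ _ (ht k.+1) (ht k) hf)).
apply: (le_trans (lerD _ (Hk k))); first by rewrite NBC; exact: Hk k.+1.
have pos : 0 < (4^-1 : R) ^+ k by rewrite exprn_gt0// invr_gt0.
rewrite !exprS; lra.
Qed.

Lemma cvg_rate (u : nat -> R) : (forall k, 0 <= u k) -> (forall k, u k <= 2 * 4^-1 ^+ k) ->
  u @ \oo --> 0.
Proof.
move=> u0 uk; apply: (cvg0_le u0 uk).
have -> : 0 = 2 * 0 :> R by rewrite mulr0.
apply: cvgM; first exact: cvg_cst.
by apply: cvg_expr; rewrite ger0_norm ?invr_ge0// invf_lt1// ltr1n.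
Qed.

Lemma acts_on_y_limit V (f g : R * R -> R[i]) n a b : L2_unitary mu V ->
  inL2 mu2 f -> inL2 mu2 g -> (forall k j, inL2 mu (a k j)) -> (forall k j, inL2 mu (b k j)) ->
  (fun k => N mu2 (fun z => f z - tens (n k) (a k) (b k) z)) @ \oo --> 0 ->
  (fun k => N mu2 (fun z => g z - tens (n k) (a k) (fun j => V (b k j)) z)) @ \oo --> 0 ->
  acts_on_y V f g.
Proof.
move=> HV hf hg ha hb cf cg; split => //.
have hVb k j := unitary_L2 HV (hb k j).
apply: (@slice_limit R (fun x y => (x, y)) (@slicing_x R) V f g
  (fun k => tens (n k) (a k) (b k)) (fun k => tens (n k) (a k) (fun j => V (b k j)))) => //.
- by move=> k; exact: inL2_tens.
- by move=> k; exact: inL2_tens.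
- by move=> k x; exact: tens_slice_L2.
- by move=> k x; exact: tens_slice_L2.
- by move=> k x; exact: (unitary_sum HV (n k) (fun j => a k j x) (hb k)).
Qed.

Lemma acts_on_x_limit U (f g : R * R -> R[i]) n a b : L2_unitary mu U ->
  inL2 mu2 f -> inL2 mu2 g -> (forall k j, inL2 mu (a k j)) -> (forall k j, inL2 mu (b k j)) ->
  (fun k => N mu2 (fun z => f z - tens (n k) (a k) (b k) z)) @ \oo --> 0 ->
  (fun k => N mu2 (fun z => g z - tens (n k) (fun j => U (a k j)) (b k) z)) @ \oo --> 0 ->
  acts_on_x U f g.
Proof.
move=> HU hf hg ha hb cf cg; split => //.
have hUa k j := unitary_L2 HU (ha k j).
apply: (@slice_limit R (fun y x => (x, y)) (@slicing_y R) U f g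
  (fun k => tens (n k) (a k) (b k)) (fun k => tens (n k) (fun j => U (a k j)) (b k))) => //.
- by move=> k; exact: inL2_tens.
- by move=> k; exact: inL2_tens.
- by move=> k y; exact: tens_slice_L2y.
- by move=> k y; exact: tens_slice_L2y.
move=> k y; have := unitary_sum HU (n k) (fun j => b k j y) (ha k).
have -> : (fun x => tens (n k) (a k) (b k) (x, y)) = (fun x => \sum_(j < n k) b k j y * a k j x).
  by apply/funext => x; apply: eq_bigr => j _; rewrite mulrC.
move=> e; apply: etrans e; apply: eqN => x; congr (_ - _).
by apply: eq_bigr => j _; rewrite mulrC.
Qed.

(** For a tensor sum both sides equal the sum of [c j] times [U (a j)], where [c j] is the inner
    product of [b j] with the adjoint applied to the conjugate of [phi]. The Hilbert-Schmidt bound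
    and the isometry of [U] carry this to the limit. *)
Lemma kernel_identity U V Vadj (f g : R * R -> R[i]) n a b (phi : R -> R[i]) :
  L2_unitary mu U -> L2_unitary mu V -> L2_adjoint mu V Vadj ->
  inL2 mu2 f -> inL2 mu2 g -> (forall k j, inL2 mu (a k j)) -> (forall k j, inL2 mu (b k j)) ->
  (fun k => N mu2 (fun z => f z - tens (n k) (a k) (b k) z)) @ \oo --> 0 ->
  (fun k => N mu2 (fun z => g z - tens (n k) (fun j => U (a k j)) (fun j => V (b k j)) z)) @ \oo --> 0 ->
  inL2 mu phi ->
  N mu (fun x => integral_operator g phi x -
    U (integral_operator f (conjop (Vadj (conjop phi)))) x) = 0.
Proof.
move=> HU HV Hadj hf hg ha hb cf cg hphi; have [hVadj adj] := Hadj.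
have hUa k j := unitary_L2 HU (ha k j); have hVb k j := unitary_L2 HV (hb k j).
have hJ : inL2 mu (conjop phi) by exact: inL2J.
have hA := hVadj _ hJ.
set psi := conjop (Vadj (conjop phi)).
have hpsi : inL2 mu psi by exact: inL2J.
pose fk k := tens (n k) (a k) (b k); pose gk k := tens (n k) (fun j => U (a k j)) (fun j => V (b k j)).
have hfk k : inL2 mu2 (fk k) by exact: inL2_tens.
have hgk k : inL2 mu2 (gk k) by exact: inL2_tens.
have kid k : N mu (fun x => U (integral_operator (fk k) psi) x - integral_operator (gk k) phi x) = 0.
  pose c j := inner mu (b k j) (Vadj (conjop phi)).
  have -> : integral_operator (fk k) psi = (fun x => \sum_(j < n k) c j * a k j x).
    apply/funext => x; rewrite integral_operator_tens//; apply: eq_bigr => j _.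
    by congr (inner mu _ _ * _); apply/funext => y; exact: conjcK.
  have -> : integral_operator (gk k) phi = (fun x => \sum_(j < n k) c j * U (a k j) x).
    by apply/funext => x; rewrite integral_operator_tens//; apply: eq_bigr => j _; rewrite adj.
  exact: (unitary_sum HU (n k) c (ha k)).
have sf k x : inL2 mu (fun y => fk k (x, y)) by exact: tens_slice_L2.
have sg k x : inL2 mu (fun y => gk k (x, y)) by exact: tens_slice_L2.
have If := inL2_integral_operator hf hpsi; have Ig := inL2_integral_operator hg hphi.
have Ifk k := inL2_integral_operator (hfk k) hpsi; have Igk k := inL2_integral_operator (hgk k) hphi.
have UIf := unitary_L2 HU If; have UIfk k := unitary_L2 HU (Ifk k).
pose C := Num.sqrt (2 * N mu phi ^+ 2 + 1); pose C' := Num.sqrt (2 * N mu psi ^+ 2 + 1).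
have cv : (fun k => C * N mu2 (fun z => g z - gk k z) + C' * N mu2 (fun z => f z - fk k z)) @ \oo --> 0.
  have -> : 0 = C * 0 + C' * 0 by rewrite !mulr0 addr0.
  by apply: cvgD; apply: cvgM => //; exact: cvg_cst.
apply/eqP; rewrite eq_le N_ge0 andbT; apply: le_eps => e e0.
have [k Hk] := cvg0_ex cv e0; apply: le_trans (Hk k (leqnn k)).
apply: (le_trans (@N_split _ _ _ mu (integral_operator (gk k) phi) _ _ Ig UIf (Igk k))).
apply: lerD; first by have [] := hilbert_schmidt hg (hgk k) (sg k) hphi.
apply: (le_trans (@N_split _ _ _ mu (U (integral_operator (fk k) psi)) _ _ (Igk k) UIf (UIfk k))).
rewrite NBC kid add0r unitary_NB// NBC.
by have [] := hilbert_schmidt hf (hfk k) (sf k) hpsi.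
Qed.

(** The conjugated adjoint maps the unit ball onto itself up to null functions, with the conjugated
    [V] as inverse, and [U] preserves norms; so both suprema run over the same set. *)
Lemma opnorm_identity U V Vadj (f g : R * R -> R[i]) :
  L2_unitary mu U -> L2_unitary mu V -> L2_adjoint mu V Vadj ->
  inL2 mu2 f -> inL2 mu2 g ->
  (forall phi, inL2 mu phi -> N mu (fun x => integral_operator g phi x -
    U (integral_operator f (conjop (Vadj (conjop phi)))) x) = 0) ->
  opnorm mu (integral_operator g) = opnorm mu (integral_operator f).
Proof.
move=> HU HV Hadj hf hg H; have [hVadj adj] := Hadj.
have key phi : inL2 mu phi -> N mu (integral_operator g phi) =
    N mu (integral_operator f (conjop (Vadj (conjop phi)))).
  move=> hphi; have hpsi : inL2 mu (conjop (Vadj (conjop phi))) by apply: inL2J; apply: hVadj; exact: inL2J.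
  have If := inL2_integral_operator hf hpsi; have Ig := inL2_integral_operator hg hphi.
  rewrite -(unitary_N HU If); have UIf := unitary_L2 HU If.
  apply/eqP; rewrite eq_le.
  have := N_lip Ig UIf; have := N_lip UIf Ig; rewrite NBC (H _ hphi) !addr0 => -> /=.
  by move=> ->.
have nf phi : inL2 mu phi -> norm2 mu (integral_operator f phi) = (N mu (integral_operator f phi))%:E.
  by move=> hphi; exact: norm2_N (inL2_integral_operator hf hphi).
have ng phi : inL2 mu phi -> norm2 mu (integral_operator g phi) = (N mu (integral_operator g phi))%:E.
  by move=> hphi; exact: norm2_N (inL2_integral_operator hg hphi).
congr ereal_sup; apply/seteqP; split => _ [phi [hphi nphi] <-].
- have hJ : inL2 mu (conjop phi) by exact: inL2J.
  have hpsi : inL2 mu (conjop (Vadj (conjop phi))) by apply: inL2J; exact: hVadj.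
  exists (conjop (Vadj (conjop phi))).
    split => //; move: nphi; rewrite (norm2_N hphi) (norm2_N hpsi).
    by rewrite (NJ mu (Vadj (conjop phi))) (adjoint_N HV Hadj hJ) (NJ mu phi).
  by rewrite (nf _ hpsi) (ng _ hphi) (key _ hphi).
- have hJ : inL2 mu (conjop phi) by exact: inL2J.
  have hVJ := unitary_L2 HV hJ.
  have hpsi : inL2 mu (conjop (V (conjop phi))) by exact: inL2J.
  exists (conjop (V (conjop phi))).
    split => //; move: nphi; rewrite (norm2_N hphi) (norm2_N hpsi).
    by rewrite (NJ mu (V (conjop phi))) (unitary_N HV hJ) (NJ mu phi).
  rewrite (ng _ hpsi) (nf _ hphi) (key _ hpsi).
  have JJ : conjop (conjop (V (conjop phi))) = V (conjop phi).
    by apply/funext => x; exact: conjcK.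
  rewrite JJ; apply: (congr1 (fun h => (N mu h)%:E)).
  have hVV := hVadj _ hVJ.
  (* [Vadj] inverts [V] only almost everywhere, which does not change the value of the integral
     operator. *)
  apply: integral_operator_ae; [exact: inL2_cmeas hf|exact: inL2J hVV|exact: hphi|].
  have VV : N mu (fun x => V (conjop phi) x - V (conjop phi) x) = 0.
    by apply: etrans (N0 mu); apply: eqN => x; rewrite subrr.
  have e := adjoint_inverse HV Hadj hJ hVJ VV.
  apply: etrans e; rewrite -[RHS]NJ; apply: eqN => x.
  by rewrite rmorphB /= /conjop conjcK.
Qed.

(** The Duhamel equation of the solution with datum [f] contains a value of the free propagator at
    [f]. *)
Lemma propagator_total (eps : R) (q : R -> R -> R) (U : R -> (R -> R[i]) -> R -> R[i]) : solution_operator eps q U ->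
  forall t, 0 <= t -> forall f, inL2 mu f -> exists g, free1 eps t f g.
Proof.
by move=> [_ H] t t0 f hf; have [_ _ /(_ t t0)[g [_ [_ [Eg _ _ _]]]]] := H f hf; exists g.
Qed.

End Assembly.

Theorem theorem3p2 (R : realType) (eps1 eps2 : R)
  (heps1 : eps1 = 1 \/ eps1 = -1) (heps2 : eps2 = 1 \/ eps2 = -1)
  (p q : R -> R -> R)
  (hp : continuous_bounded p) (hq : continuous_bounded q)
  (u0 : R * R -> R[i]) (hu0 : inL2 (leb2 R) u0)
  (U1 U2 U2adj : R -> (R -> R[i]) -> (R -> R[i]))
  (hU1 : solution_operator eps1 q U1) (hU2 : solution_operator eps2 p U2)
  (hU2adj : forall t, 0 <= t -> L2_adjoint (leb R) (U2 t) (U2adj t)) :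
  (exists u, schrodinger2 eps1 eps2 p q u0 u) /\
  (forall u, schrodinger2 eps1 eps2 p q u0 u -> forall t, 0 <= t ->
    let A0 := integral_operator u0 in
    let A := integral_operator (u t) in
    [/\ exists2 u', acts_on_y (U2 t) u0 u' & acts_on_x (U1 t) u' (u t),
        forall phi, inL2 (leb R) phi ->
          A phi = U1 t (A0 (conjop (U2adj t (conjop phi)))) %[ae leb R] &
        opnorm (leb R) A = opnorm (leb R) A0]).
Proof.
have [n [a [b [ha hb Hk]]]] := tens_approx hu0.
have [un1 sol1] := hU1; have [un2 sol2] := hU2.
have tot1 := propagator_total hU1; have tot2 := propagator_total hU2.
have mw := pot2_measurable hp hq; have [M M0 HM] := pot2_bound hp hq.
have iso2 := isometric_free2 eps1 eps2.
pose w k t := tens (n k) (fun j => U1 t (a k j)) (fun j => U2 t (b k j)).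
have hw k t : 0 <= t -> inL2 (leb2 R) (w k t).
  by move=> t0; apply: inL2_tens => j; apply: unitary_L2; auto.
(* The rate is the same for every [t], because the one-variable operators are unitary; this is the
   uniformity that [mild_limit] asks for. *)
have lim t : exists g, 0 <= t -> inL2 (leb2 R) g /\
    forall k, N (leb2 R) (fun z => g z - w k t z) <= 2 * 4^-1 ^+ k.
  have [t0|_] := boolP (0 <= t); last by exists (fun=> 0).
  have [g Hg] := tens_limit (un1 t t0) (un2 t t0) hu0 ha hb Hk.
  by exists g => _; exact: Hg.
have [v Hv] := choice lim.
have hf k := inL2_tens (n k) (ha k) (hb k).
have rate0 : (fun k => 2 * (4^-1 : R) ^+ k) @ \oo --> 0.
  by apply: cvg_rate => // k; rewrite mulr_ge0// exprn_ge0// invr_ge0.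
have Hk2 k : N (leb2 R) (fun z => u0 z - tens (n k) (a k) (b k) z) <= 2 * 4^-1 ^+ k.
  apply: (le_trans (Hk k)); rewrite exprS.
  have : 0 < (4^-1 : R) ^+ k by rewrite exprn_gt0// invr_gt0.
  lra.
have solw k : schrodinger2 eps1 eps2 p q (tens (n k) (a k) (b k)) (w k).
  apply: (mild_sum iso2 (n k) (v0 := fun j => tensor (a k j) (b k j))
    (v := fun j t => tensor (U1 t (a k j)) (U2 t (b k j)))) => j.
  by apply: tensor_solution => //; [exact: sol1|exact: sol2].
have solv : schrodinger2 eps1 eps2 p q u0 v.
  have tot t : 0 <= t -> forall f, inL2 (leb2 R) f -> exists g, free2 eps1 eps2 t f g.
    by move=> t0; exact: free2_total (tot1 t t0) (tot2 t t0).
  apply: (mild_limit iso2 mw M0 HM tot hu0 _ solw hf rate0).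
  - by move=> t /Hv[].
  - by move=> k; rewrite NBC; exact: Hk2.
  - by move=> k t /Hv[_ h]; rewrite NBC; exact: h.
split; first by exists v.
move=> u solu t t0 A0 A.
have hut : inL2 (leb2 R) (u t) by case: solu => h _ _; exact: h.
have [hvt Hvt] := Hv t t0.
(* By uniqueness any solution [u] differs from the constructed [v] by a null function at each time,
   so it has the same approximants. *)
have cu : (fun k => N (leb2 R) (fun z => u t z - w k t z)) @ \oo --> 0.
  apply: cvg_rate => k; first exact: N_ge0.
  apply: (le_trans (@N_split _ _ _ (leb2 R) (v t) _ _ hut (hw k t t0) hvt)).
  by rewrite (mild_unique iso2 mw M0 HM solu solv t0) add0r; exact: Hvt.
have c0 : (fun k => N (leb2 R) (fun z => u0 z - tens (n k) (a k) (b k) z)) @ \oo --> 0.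
  by apply: cvg_rate => // k; exact: N_ge0.
have identity phi : inL2 (leb R) phi -> N (leb R) (fun x => A phi x -
    U1 t (A0 (conjop (U2adj t (conjop phi)))) x) = 0.
  by move=> hphi; apply: (kernel_identity (un1 t t0) (un2 t t0) (hU2adj t t0) hu0 hut ha hb c0 cu hphi).
split.
(* The intermediate function is the limit of the same tensor sums with only the [y] factors evolved;
   the [x] factors are then evolved from it. *)
- have [u' [hu' Hu']] := tens_limit unitary_id (un2 t t0) hu0 ha hb Hk.
  have cu' : (fun k => N (leb2 R) (fun z => u' z - tens (n k) (a k) (fun j => U2 t (b k j)) z)) @ \oo --> 0.
    by apply: cvg_rate => k; [exact: N_ge0|exact: Hu'].
  have hb' k j := unitary_L2 (un2 t t0) (hb k j).
  exists u'; first exact: acts_on_y_limit (un2 t t0) hu0 hu' ha hb c0 cu'.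
  exact: acts_on_x_limit (un1 t t0) hu' hut ha hb' cu' cu.
- move=> phi hphi; apply/ae_N0; [exact: inL2_integral_operator| |exact: identity].
  apply: unitary_L2 (un1 t t0) _ _; apply: inL2_integral_operator => //.
  by apply: inL2J; have [h _] := hU2adj t t0; apply: h; exact: inL2J.
- exact: opnorm_identity (un1 t t0) (un2 t t0) (hU2adj t t0) hu0 hut identity.
Qed.
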